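(* Let $A$ and $B$ be unital semisimple commutative Banach algebras. Suppose that $T$ is a group homomorphism from $A^{-1}$ onto $B^{-1}$. Then the following are equivalent. (i) $T$ is an isometry with respect to the spectral radius, that is, $\mathrm{r}(Tf-Tg)=\mathrm{r}(f-g)$ holds for every pair $f$ and $g$ in $A^{-1}$. (ii) $\mathrm{r}(Tf-1)=\mathrm{r}(f-1)$ holds for every $f\in A^{-1}$. (iii) There exist a homeomorphism $\phi$ from $\mathrm{Ch}(\mathrm{cl}\,B)$ onto $\mathrm{Ch}(\mathrm{cl}\,A)$ and a clopen subset $K$ of $\mathrm{Ch}(\mathrm{cl}\,B)$ such that $$Tf(y)=\begin{cases} f(\phi(y)), & y\in K,\\ \overline{f(\phi(y))}, & y\in\mathrm{Ch}(\mathrm{cl}\,B)\setminus K\end{cases}$$ holds for every $f\in A^{-1}$. Thus if at least one of the conditions (i), (ii) and (iii) holds, then $T$ is extended to a real-algebra isomorphism from $A$ onto $B$; $A$ is real-algebraically isomorphic to $B$.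
   Context: Banach algebras are over $\mathbb{C}$. $A^{-1}$ is the group of invertible elements of $A$; $\mathrm{r}(\cdot)$ is the spectral radius; $M_A$ is the maximal ideal space of $A$. $\mathrm{cl}\,A$ is the closure, in the supremum norm, of the Gelfand transform $\hat A$ in $C(M_A)$; it is a uniform algebra on $M_A$, i.e. a uniformly closed subalgebra of $C(M_A)$ containing the constants and separating points. Elements of a semisimple $A$ are identified with their Gelfand transforms, so that $A\subset\mathrm{cl}\,A\subset C(M_A)$. $\mathrm{Ch}(\mathrm{cl}\,A)\subset M_A$ is the Choquet boundary of $\mathrm{cl}\,A$. A real-algebra isomorphism is a bijective real-linear multiplicative map. *)

(* Defs.v *)
(* Mathematical Components and MathComp-Analysis; the complex numbers are
   [R[i]] for an arbitrary [R : realType]. *)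
From HB Require Import structures.
From mathcomp Require Import all_boot all_order all_algebra.
From mathcomp Require Import all_classical all_reals all_analysis.
From mathcomp Require Export complex.

Set Implicit Arguments.
Unset Strict Implicit.
Unset Printing Implicit Defensive.

Import Order.TTheory GRing.Theory Num.Theory.
Import numFieldNormedType.Exports.

Local Open Scope classical_set_scope.
Local Open Scope ring_scope.
Local Open Scope complex_scope.

(* Hierarchy-Builder refuses a common child of [completeNormedModType] and
   [comUnitAlgType] (the missing join should have preceded [numDomainType]), so
   the type of unital commutative Banach algebras is a plain record over
   [completeNormedModType], whose carrier is then given both structures.  Only
   submultiplicativity is required of the norm: [`|1| = 1] is not assumed. *)
Record comBanachAlgType (K : numFieldType) := ComBanachAlgType {
  banach_space : completeNormedModType K;
  banach_one : banach_space;
  banach_mul : banach_space -> banach_space -> banach_space;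
  banach_mulA : associative banach_mul;
  banach_mulC : commutative banach_mul;
  banach_mul1 : left_id banach_one banach_mul;
  banach_mulDl : left_distributive banach_mul +%R;
  banach_one_neq0 : banach_one != 0;
  banach_scaleAl : forall (a : K) (x y : banach_space),
    a *: banach_mul x y = banach_mul (a *: x) y;
  banach_normM_le : forall x y : banach_space,
    `|banach_mul x y| <= `|x| * `|y|
}.

Definition banach_sort (K : numFieldType) (A : comBanachAlgType K) : Type :=
  banach_space A.
Coercion banach_sort : comBanachAlgType >-> Sortclass.

Section ComBanachAlgebra.
Context {K : numFieldType} (A : comBanachAlgType K).

HB.instance Definition _ :=
  CompleteNormedModule.copy (banach_sort A) (banach_space A).

HB.instance Definition _ := GRing.Zmodule_isComNzRing.Build (banach_sort A)
  (@banach_mulA K A) (@banach_mulC K A) (@banach_mul1 K A)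
  (@banach_mulDl K A) (@banach_one_neq0 K A).

HB.instance Definition _ := GRing.Lmodule_isLalgebra.Build K (banach_sort A)
  (@banach_scaleAl K A).

HB.instance Definition _ := GRing.Lalgebra_isComAlgebra.Build K (banach_sort A).

Let invertible : pred (banach_sort A) := fun x => `[< exists y, y * x = 1 >].

Let inverse (x : banach_sort A) : banach_sort A := xget x [set y | y * x = 1].

Let inverseP : {in invertible, left_inverse 1 inverse *%R}.
Proof. by move=> x /asboolP[y yx]; rewrite /inverse; case: xgetP => // /(_ y). Qed.

Let invertiblePl (x y : banach_sort A) : y * x = 1 -> x \in invertible.
Proof. by move=> yx; apply/asboolP; exists y. Qed.

Let inverse_out : {in [predC invertible], inverse =1 id}.
Proof.
move=> x /negP xn; rewrite /inverse; case: xgetP => // y _ yx.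
by case: xn; exact: invertiblePl yx.
Qed.

HB.instance Definition _ := GRing.ComNzRing_hasMulInverse.Build (banach_sort A)
  inverseP invertiblePl inverse_out.

End ComBanachAlgebra.

Section UniformAlgebra.
Context {R : realType}.

Definition cabs (z : R[i]) : R := complex.Re `|z|.

Definition supnorm (X : Type) (f : X -> R[i]) : R := sup (range (cabs \o f)).

(* A linear functional on a subspace [E] of functions is represented by a map
   [L] on all functions, of which only the restriction to [E] is relevant. *)
Definition is_state (X : Type) (E : set (X -> R[i]))
    (L : (X -> R[i]) -> R[i]) : Prop :=
  [/\ forall (a : R[i]) f g, E f -> E g ->
        L (fun x => a * f x + g x) = a * L f + L g,
      L (fun=> 1) = 1 &
      forall f, E f -> cabs (L f) <= supnorm f].

Definition extreme_state (X : Type) (E : set (X -> R[i]))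
    (L : (X -> R[i]) -> R[i]) : Prop :=
  is_state E L /\
  forall (L1 L2 : (X -> R[i]) -> R[i]) (t : R),
    is_state E L1 -> is_state E L2 -> 0 < t < 1 ->
    (forall f, E f -> L f = t%:C * L1 f + (1 - t)%:C * L2 f) ->
    forall f, E f -> L1 f = L f /\ L2 f = L f.

(* The points whose evaluation functional is an extreme point of the state
   space [{L \in E^* | `|L| = L 1 = 1}] (Bishop-de Leeuw, Phelps). *)
Definition choquet_boundary (X : Type) (E : set (X -> R[i])) : set X :=
  [set x | extreme_state E (fun f => f x)].

End UniformAlgebra.

Section BanachAlgebra.
Context {R : realType}.
Implicit Type A : comBanachAlgType R[i].

Definition spectrum A (f : A) : set R[i] :=
  [set a | a%:A - f \isn't a GRing.unit].

Definition spectral_radius A (f : A) : R := sup (cabs @` spectrum f).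

(* [idealr_closed] includes properness. *)
Definition maximal_ideal A (I : {pred A}) : Prop :=
  idealr_closed I /\
  forall J : {pred A}, idealr_closed J -> {subset I <= J} -> {subset J <= I}.

Definition semisimple A : Prop :=
  forall f : A, (forall I : {pred A}, maximal_ideal I -> f \in I) -> f = 0.

Definition characters A : set {ptws A -> R[i]^o} :=
  [set m | [/\ exists f : A, m f != 0,
      forall (a : R[i]) (f g : A), m (a *: f + g) = a * m f + m g &
      forall f g : A, m (f * g) = m f * m g]].

(* Maximal ideals are identified with the nonzero complex homomorphisms; the
   instance on [set_type] gives the topology induced by pointwise convergence,
   i.e. the Gelfand topology. *)
Definition max_ideal_space A : topologicalType :=
  set_type (@characters A).

Definition gelfand A (f : A) : max_ideal_space A -> R[i]^o :=
  fun m => set_val m f.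

Definition cl A : set {uniform max_ideal_space A -> R[i]^o} :=
  closure
    (range (@gelfand A) : set {uniform max_ideal_space A -> R[i]^o}).

Definition Ch A : set (max_ideal_space A) := choquet_boundary (@cl A).

End BanachAlgebra.

Arguments semisimple {R} A.
Arguments characters {R} A.
Arguments max_ideal_space {R} A.
Arguments cl {R} A.
Arguments Ch {R} A.

Definition homeomorphism (X Y : topologicalType) (phi : X -> Y) : Prop :=
  exists psi : Y -> X,
    [/\ cancel phi psi, cancel psi phi, continuous phi & continuous psi].

Section Maps.
Context {R : realType} {A B : comBanachAlgType R[i]}.

(* Group homomorphisms [A^-1 -> B^-1] are maps [A -> B] of which only the
   restriction to the invertible elements is relevant. *)
Definition unit_group_epimorphism (T : A -> B) : Prop :=
  [/\ forall f, f \is a GRing.unit -> T f \is a GRing.unit,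
      {in GRing.unit &, {morph T : f g / f * g}} &
      forall g, g \is a GRing.unit -> exists2 f, f \is a GRing.unit & T f = g].

Definition real_algebra_isomorphism (S : A -> B) : Prop :=
  [/\ bijective S,
      forall (a : R) (f g : A), S (a%:C *: f + g) = a%:C *: S f + S g &
      {morph S : f g / f * g}].

Definition choquet_representation (T : A -> B) : Prop :=
  exists (phi : set_type (Ch B) -> set_type (Ch A)) (K : set (set_type (Ch B))),
    [/\ homeomorphism phi, clopen K &
      forall f, f \is a GRing.unit -> forall y,
        gelfand (T f) (set_val y) =
          if y \in K then gelfand f (set_val (phi y))
          else (gelfand f (set_val (phi y)))^*].

End Maps.

(* Main.v *)
(* A homomorphism [T : A^-1 -> B^-1] with [r (T f - 1) = r (f - 1)] is
   differentiable at [1]: since [(1 + a / 2) ^ 2 = 1 + a + O(a ^ 2)], the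
   difference quotients [2 ^ j (T (1 + a / 2 ^ j) - 1)] converge, uniformly on
   [M_B], to a real-linear map [L] from [A] to [cl B], which is isometric with
   dense range.  Its adjoint therefore maps extreme points of dual unit balls to
   extreme points, which for [cl A] and [cl B] are the unimodular multiples of
   evaluations at Choquet boundary points.  For [y] in [Ch (cl B)] and [c] equal
   to [1], [-i] and [(3 - 4i) / 5], the functional [Re (c L(.)(y))] is thus of
   the form [Re (d x(.))] with [x] a character, and comparing the three gives
   [L a (y) = a (x)] for all [a], or [L a (y)] is the conjugate of [a (x)] for
   all [a].  So the quotient of [T f (y)] by [f (x)] (or its conjugate) is a
   homomorphism of [f] with zero derivative; it is trivial near [1] and on
   constants.  For arbitrary [f] with [f (x) = 1], multiply by
   [N ((2 + g) / 3) ^ m], where [g] peaks at [x]: the product has distance about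
   [N - 1] from [1], which forces the quotient at [f] to be [1]. *)

Require Import Defs.
From mathcomp Require Import all_boot all_order all_algebra.
From mathcomp Require Import all_classical all_reals all_analysis.
From mathcomp Require Import ring lra.

Set Implicit Arguments.
Unset Strict Implicit.
Unset Printing Implicit Defensive.

Import Order.TTheory GRing.Theory Num.Theory.
Import numFieldNormedType.Exports.

Local Open Scope classical_set_scope.
Local Open Scope ring_scope.
Local Open Scope complex_scope.

Local Notation Re := complex.Re.
Local Notation Im := complex.Im.

(** * Complex numbers *)

Section ComplexNumbers.
Context {R : realType}.
Implicit Types (z w : R[i]) (t : R).

(** The values of [L] are functions on [M_B] rather than elements of [B], and [L] is only
    real-linear. It is therefore paired with the derivative [L'] of the inverse of [T]; the two are
    compared only to second order near 0. Functionals are real-linear, dominated by the spectral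
    radius, and extended by Hahn-Banach to all bounded functions on the maximal ideal space, so that
    they apply to the values of [L']. These extensions also act as representing measures: by
    extremality, multiplying inside them by a bounded real function acts on [A] as a scalar.

    Three values of [c] occur because the real and the imaginary part of [L a (y)] come from two
    characters that could differ; the third value mixes both parts, and multiplicativity then
    identifies the characters.

    At a general unit only distances to 1 are controlled. [N] times the chosen power stays in the
    disc of centre 1 and radius [N - 1], which meets the circle of radius [N] about 0 only at [N].
    The same disc confines [N] times the quotient, and using [f^-1] as well leaves only the value
    1. *)

Lemma normC_cabs z : `|z| = (cabs z)%:C.
Proof. by rewrite /cabs normc_def. Qed.

Lemma cabs_sqr z : cabs z ^+ 2 = Re z ^+ 2 + Im z ^+ 2.
Proof. by rewrite /cabs normc_def /= sqr_sqrtr // addr_ge0 ?sqr_ge0. Qed.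

Lemma cabs_ge0 z : 0 <= cabs z.
Proof. by rewrite /cabs normc_def /= sqrtr_ge0. Qed.

Lemma cabsM : {morph @cabs R : z w / z * w}.
Proof. by move=> z w; apply: complexI; rewrite rmorphM /= -!normC_cabs normrM. Qed.

Lemma cabsD z w : cabs (z + w) <= cabs z + cabs w.
Proof. by rewrite -lecR rmorphD /= -!normC_cabs ler_normD. Qed.

Lemma cabsN z : cabs (- z) = cabs z.
Proof. by apply: complexI; rewrite -!normC_cabs normrN. Qed.

Lemma cabsB z w : cabs (z - w) <= cabs z + cabs w.
Proof. by rewrite -(cabsN w) cabsD. Qed.

Lemma cabs_distC z w : cabs (z - w) = cabs (w - z).
Proof. by rewrite -cabsN opprB. Qed.

Lemma cabs_distD z w v : cabs (z - v) <= cabs (z - w) + cabs (w - v).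
Proof. by rewrite (_ : z - v = (z - w) + (w - v)) ?cabsD //; ring. Qed.

Lemma cabs0 : cabs (0 : R[i]) = 0.
Proof. by rewrite /cabs normr0. Qed.

Lemma cabs1 : cabs (1 : R[i]) = 1.
Proof. by rewrite /cabs normr1. Qed.

Lemma cabs_eq0 z : (cabs z == 0) = (z == 0).
Proof. by rewrite -(inj_eq (@complexI R)) /= -normC_cabs normr_eq0. Qed.

Lemma cabs_gt0 z : (0 < cabs z) = (z != 0).
Proof. by rewrite lt0r cabs_ge0 andbT cabs_eq0. Qed.

Lemma cabsR t : cabs t%:C = `|t|.
Proof. by rewrite /cabs normc_def /= expr0n /= addr0 sqrtr_sqr. Qed.

Lemma cabsV z : cabs z^-1 = (cabs z)^-1.
Proof.
have [->|z0] := eqVneq z 0; first by rewrite invr0 cabs0 invr0.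
have c0 : cabs z != 0 by rewrite cabs_eq0.
by apply: (mulIf c0); rewrite -cabsM !mulVf // cabs1.
Qed.

Lemma cabsX z n : cabs (z ^+ n) = cabs z ^+ n.
Proof. by elim: n => [|n IH]; rewrite ?cabs1 // !exprS cabsM IH. Qed.

Lemma cabsJ z : cabs (z^*) = cabs z.
Proof. by rewrite /cabs normcJ. Qed.

Lemma cabs_i : cabs ('i : R[i]) = 1.
Proof. by rewrite /cabs normc_def /= expr0n /= add0r expr1n sqrtr1. Qed.

Lemma Re_add z w : Re (z + w) = Re z + Re w. Proof. by case: z; case: w. Qed.
Lemma Im_add z w : Im (z + w) = Im z + Im w. Proof. by case: z; case: w. Qed.
Lemma Re_opp z : Re (- z) = - Re z. Proof. by case: z. Qed.
Lemma Im_opp z : Im (- z) = - Im z. Proof. by case: z. Qed.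
Lemma Re_mul z w : Re (z * w) = Re z * Re w - Im z * Im w.
Proof. by case: z; case: w. Qed.
Lemma Im_mul z w : Im (z * w) = Re z * Im w + Im z * Re w.
Proof. by case: z; case: w. Qed.
Lemma Re_one : Re (1 : R[i]) = 1. Proof. by []. Qed.
Lemma Im_one : Im (1 : R[i]) = 0. Proof. by []. Qed.
Lemma Re_zero : Re (0 : R[i]) = 0. Proof. by []. Qed.
Lemma Im_zero : Im (0 : R[i]) = 0. Proof. by []. Qed.
Lemma Re_real t : Re t%:C = t. Proof. by []. Qed.
Lemma Im_real t : Im t%:C = 0. Proof. by []. Qed.
Lemma Re_i : Re ('i : R[i]) = 0. Proof. by []. Qed.
Lemma Im_i : Im ('i : R[i]) = 1. Proof. by []. Qed.
Lemma Re_conj z : @complex.Re R (z^*) = @complex.Re R z. Proof. by case: z. Qed.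
Lemma Im_conj z : @complex.Im R (z^*) = - @complex.Im R z. Proof. by case: z. Qed.

Lemma Re_rmul t z : Re (t%:C * z) = t * Re z.
Proof. by rewrite Re_mul Re_real Im_real mul0r subr0. Qed.
Lemma Im_rmul t z : Im (t%:C * z) = t * Im z.
Proof. by rewrite Im_mul Re_real Im_real mul0r addr0. Qed.

Definition ReImE := (Re_add, Im_add, Re_opp, Im_opp, Re_mul, Im_mul, Re_one, Im_one, Re_zero, Im_zero,
  Re_real, Im_real, Re_i, Im_i, Re_conj, Im_conj).

Lemma complexP z w : Re z = Re w -> Im z = Im w -> z = w.
Proof. by case: z w => a b [c d] /= -> ->. Qed.

Lemma mulc_ReIm z w : z * w = (Re z)%:C * w + (Im z)%:C * ('i * w).
Proof. by apply: complexP; rewrite !ReImE; ring. Qed.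

Lemma Re_le_cabs z : `|Re z| <= cabs z.
Proof. by have := normc_ge_Re z; rewrite normC_cabs lecR. Qed.

Lemma Im_le_cabs z : `|Im z| <= cabs z.
Proof.
rewrite -ler_sqr ?nnegrE ?cabs_ge0 ?normr_ge0 //.
by rewrite cabs_sqr real_normK ?num_real // lerDr sqr_ge0.
Qed.

Lemma Re_cabs z : Re z <= cabs z.
Proof. exact: le_trans (ler_norm _) (Re_le_cabs z). Qed.

Lemma cabs_le_ReIm z : cabs z <= `|Re z| + `|Im z|.
Proof.
rewrite -ler_sqr ?nnegrE ?cabs_ge0 ?addr_ge0 // cabs_sqr sqrrD !real_normK ?num_real //.
by rewrite -addrA (addrC (_ *+ 2)) addrA lerDl mulrn_wge0 // mulr_ge0.
Qed.

Lemma mulc_conj_sqr z : z * z^* = (cabs z ^+ 2)%:C.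
Proof. by apply: complexP; rewrite !ReImE ?cabs_sqr; ring. Qed.

Lemma phase z : exists c : R[i], cabs c = 1 /\ c * z = (cabs z)%:C.
Proof.
have [->|z0] := eqVneq z 0.
  by exists 1; rewrite cabs1 mulr0 cabs0.
have c0 : cabs z != 0 by rewrite cabs_eq0.
exists (z^* * (cabs z)^-1%:C); split.
  by rewrite cabsM cabsJ cabsR ger0_norm ?invr_ge0 ?cabs_ge0 ?divff.
rewrite mulrAC (mulrC _ z) mulc_conj_sqr -rmorphM /=; congr (_%:C).
by rewrite expr2 mulfK.
Qed.

Lemma le_eps (x y : R) : (forall e, 0 < e -> x <= y + e) -> x <= y.
Proof. by move=> H; apply/ler_addgt0Pr => e; exact: H. Qed.

Lemma cabs_le0 z : cabs z <= 0 -> z = 0.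
Proof.
by move=> h; apply/eqP; rewrite -cabs_eq0 eq_le h cabs_ge0.
Qed.

Lemma cabs_eps z w (K : R) :
  (forall e, 0 < e -> cabs (z - w) <= K * e) -> z = w.
Proof.
move=> H; apply/eqP; rewrite -subr_eq0; apply/eqP/cabs_le0/le_eps => e e0.
rewrite add0r; have K1 : 0 < `|K| + 1 by rewrite ltr_wpDl.
apply: le_trans (H (e / (`|K| + 1)) _) _; first by rewrite divr_gt0.
rewrite mulrCA ger_pMr // ler_pdivrMr // mul1r.
by rewrite (le_trans (ler_norm K)) // lerDl.
Qed.

Lemma sqrt_Re_ge0 (l : R[i]) : exists m : R[i], m ^+ 2 = l /\ 0 <= Re m.
Proof.
have H := sqr_sqrtc l.
have [h|h] := leP 0 (Re (sqrtc l)); first by exists (sqrtc l).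
by exists (- sqrtc l); rewrite sqrrN H Re_opp oppr_ge0 (ltW h).
Qed.

(** Evaluation and conjugate evaluation are handled at once: for each [s] this is an isometric
    involution preserving sums, products and real scalars. *)
Definition conj_unless (s : bool) z : R[i] := if s then z else z^*.

Lemma conj_unlessK s : involutive (conj_unless s).
Proof. by move=> z; case: s => //; exact: conjcK. Qed.

Lemma conj_unlessD s z w : conj_unless s (z + w) = conj_unless s z + conj_unless s w.
Proof. by case: s => //; rewrite /conj_unless rmorphD. Qed.

Lemma conj_unlessB s z w : conj_unless s (z - w) = conj_unless s z - conj_unless s w.
Proof. by case: s => //; rewrite /conj_unless rmorphB. Qed.

Lemma conj_unlessM s z w : conj_unless s (z * w) = conj_unless s z * conj_unless s w.
Proof. by case: s => //; rewrite /conj_unless rmorphM. Qed.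

Lemma conj_unless1 s : conj_unless s 1 = 1.
Proof. by case: s => //; exact: conjc1. Qed.

Lemma conj_unless_real s t : conj_unless s t%:C = t%:C.
Proof. by case: s => //; exact: conjc_real. Qed.

Lemma cabs_conj_unless s z : cabs (conj_unless s z) = cabs z.
Proof. by case: s => //; exact: cabsJ. Qed.

Lemma conj_unless_comp s s' z :
  conj_unless s (conj_unless s' z) = conj_unless (s == s') z.
Proof. by case: s; case: s' => //; rewrite /conj_unless conjcK. Qed.

Lemma conj_unless_i s : conj_unless s 'i%C = 'i%C -> s.
Proof.
case: s => //= -[] /eqP.
by rewrite eq_sym -subr_eq0 opprK -mulr2n mulrn_eq0 /= oner_eq0.
Qed.

End ComplexNumbers.

(** * The Gelfand-Mazur theorem *)

(** Compactness of the square containing the disc, in near-covering form with the bound [K] tending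
    to infinity as parameter. *)
Lemma locally_bounded_square (R : realType) (n : R[i] -> R) (r : R) :
  (forall z, exists K d, 0 < d /\
     forall w, cabs (w - z) < d -> n w <= K) ->
  exists K, forall z, cabs z <= r -> n z <= K.
Proof.
move=> loc.
have cpt : compact ([set` `[- r, r]] `*` [set` `[- r, r]] : set (R * R)).
  by apply: compact_setX; exact: segment_compact.
have H := (compact_near_coveringP _).1 cpt R (+oo)%R
  (fun K p => n (p.1 +i* p.2) <= K) _.
have {}H : \forall K \near +oo%R,
    [set` `[- r, r]] `*` [set` `[- r, r]] `<=` (fun p => n (p.1 +i* p.2) <= K).
  apply: H => -[x y] _.
  have [K [d [d0 Hd]]] := loc (x +i* y).
  have d20 : 0 < d / 2 by rewrite divr_gt0.
  exists (ball (x, y) (d / 2), [set K' | K <= K']) => /=.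
    by split; [exact: nbhsx_ballx | exact: nbhs_pinfty_ge (num_real _)].
  move=> [[u v] K'] /= [[/= Hu Hv] KK']; apply: le_trans KK'; apply: Hd.
  apply: le_lt_trans (cabs_le_ReIm _) _; rewrite (splitr d) /=.
  by apply: ltrD; rewrite distrC.
have [K HK] : exists K : R, [set` `[- r, r]] `*` [set` `[- r, r]] `<=`
    (fun p => n (p.1 +i* p.2) <= K).
  by near (+oo%R : set_system R) => K; exists K; near: K.
exists K => -[x y] zr; apply: (HK (x, y)); split => /=;
  rewrite in_itv /= -ler_norml; apply: le_trans zr;
  [exact: Re_le_cabs (x +i* y) | exact: Im_le_cabs (x +i* y)].
Unshelve. all: by end_near. Qed.

Section GelfandMazur.
Context {R : realType} {A : comBanachAlgType R[i]}.
Variable q : A -> R.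
Hypothesis qD : forall f g, q (f + g) <= q f + q g.
Hypothesis qM : forall f g, q (f * g) <= q f * q g.
Hypothesis qZ : forall a f, q (a *: f) = cabs a * q f.
Hypothesis q1 : 0 < q 1.

Let q0 : q 0 = 0. Proof. by rewrite -(scale0r 0) qZ cabs0 mul0r. Qed.
Let qN f : q (- f) = q f.
Proof. by rewrite -scaleN1r qZ cabsN cabs1 mul1r. Qed.
Let q_ge0 f : 0 <= q f.
Proof. have := qD f (- f); rewrite subrr q0 qN; lra. Qed.

(** Equality in the quotient by the kernel of [q] is written [q (f - g) = 0]; the kernel is an
    ideal, so such identities can be multiplied and combined as in the quotient algebra. *)
Let N0M f g : q g = 0 -> q (f * g) = 0.
Proof.
by move=> g0; apply/eqP; rewrite eq_le q_ge0 andbT (le_trans (qM _ _)) // g0 mulr0.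
Qed.
Let N0D f g : q f = 0 -> q g = 0 -> q (f + g) = 0.
Proof.
by move=> f0 g0; apply/eqP; rewrite eq_le q_ge0 andbT (le_trans (qD _ _)) // f0 g0 addr0.
Qed.
Let N0B f g : q f = 0 -> q g = 0 -> q (f - g) = 0.
Proof. by move=> f0 g0; apply: N0D => //; rewrite qN. Qed.
Let N0Z a f : q f = 0 -> q (a *: f) = 0.
Proof. by move=> f0; rewrite qZ f0 mulr0. Qed.
Let N0_le f g : q (f - g) = 0 -> q f <= q g.
Proof. by move=> h; have := qD (f - g) g; rewrite subrK h add0r. Qed.
Let N0_eq f g : q (f - g) = 0 -> q f = q g.
Proof.
move=> h; apply/eqP; rewrite eq_le N0_le //= N0_le // -opprB qN //.
Qed.

Lemma seminorm_expr_le f n : q (f ^+ n.+1) <= q f ^+ n.+1.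
Proof.
elim: n => [|n IH]; first by rewrite !expr1.
by rewrite exprS (exprS (q f)); apply: le_trans (qM _ _) _; apply: ler_wpM2l.
Qed.

Variables (z : A) (g : R[i] -> A).
Hypothesis gP : forall l, q (g l * (z - l%:A) - 1) = 0.

Let n l := q (g l).

Let resolvent_eq l m : q (g m - g l - (m - l) *: (g l * g m)) = 0.
Proof.
have E : g m - g l - (m - l) *: (g l * g m) =
    g l * (g m * (z - m%:A) - 1) - g m * (g l * (z - l%:A) - 1).
  rewrite scalerBl -[m *: (g l * g m)]mulr_algl -[l *: (g l * g m)]mulr_algl.
    by ring.
by rewrite E; apply: N0B; apply: N0M.
Qed.

Let resolvent_lip l m : n m <= n l + cabs (m - l) * (n l * n m).
Proof.
have h : q (g m - (g l + (m - l) *: (g l * g m))) = 0.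
  by rewrite opprD addrA resolvent_eq.
apply: le_trans (N0_le h) _; apply: le_trans (qD _ _) _; apply: lerD => //.
by rewrite qZ ler_wpM2l ?cabs_ge0.
Qed.

Let n_gt0 l : 0 < n l.
Proof.
rewrite lt0r q_ge0 andbT; apply/eqP => nl0.
have := q1; rewrite -(@N0_eq (g l * (z - l%:A)) 1) // lt_neqAle => /andP[/eqP + _].
by apply; apply/esym; rewrite mulrC N0M.
Qed.

(** Modulo the kernel of [q], [l *: g l] is [g l * z - 1]; hence the resolvent decays like
    [q 1 / (cabs l - q z)]. *)
Let far l : cabs l * n l <= n l * q z + q 1.
Proof.
rewrite -qZ.
have h : q (l *: g l - (g l * z - 1)) = 0.
  have -> : l *: g l - (g l * z - 1) = - (g l * (z - l%:A) - 1).
    by rewrite -[l *: g l]mulr_algl; ring.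
  by rewrite qN.
apply: le_trans (N0_le h) _; apply: le_trans (qD _ _) _; rewrite qN lerD2r.
exact: qM.
Qed.

(** When [cabs (m - l) * n l <= 2^-1], the right side of [resolvent_lip] contains at most half of
    [n m], which the left side absorbs. *)
Let n_locally_bounded l : exists K d, 0 < d /\
  forall m, cabs (m - l) < d -> n m <= K.
Proof.
exists (2 * n l), ((2 * n l)^-1); have nl0 := n_gt0 l.
split => [|m]; first by rewrite invr_gt0 mulr_gt0.
move=> h; have H := resolvent_lip l m.
have h2 : cabs (m - l) * n l <= 2^-1.
  apply: le_trans (ler_wpM2r (ltW nl0) (ltW h)) _.
  by rewrite invfM -mulrA mulVf ?mulr1 // gt_eqF.
have := ler_wpM2r (ltW (n_gt0 m)) h2; rewrite -mulrA; lra.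
Qed.

Let n_bounded : exists K, forall l, n l <= K.
Proof.
have [K HK] := locally_bounded_square (q z + 1) n_locally_bounded.
exists (Num.max K (q 1)) => l; rewrite le_max.
have [/HK -> //|h] := leP (cabs l) (q z + 1); apply/orP; right.
have := far l; have := ler_wpM2r (ltW (n_gt0 l)) (ltW h); lra.
Qed.

Let zeta m : R[i] := (2 ^ m)%N.-root (-1).
Let zetaX m : zeta m ^+ (2 ^ m)%N = -1.
Proof. by rewrite rootCK // expn_gt0. Qed.

(* [avg m l mu] is the mean of the resolvent over the [2 ^ m]-th roots of
   [mu ^ (2 ^ m)] added to [l]. *)
Let avg := fix avg m l mu : A := if m is m'.+1 then
   2^-1%:C *: (avg m' l mu + avg m' l (zeta m' * mu)) else g (l + mu).

(** Modulo the kernel, [g (l + mu)] is [g l / (1 - mu *: g l)], and the mean of [1 / (1 - w X)] over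
    the [N]-th roots of unity [w] is [1 / (1 - X ^ N)]. The induction doubles [N]: [zeta m] changes
    the sign of [X ^ (2 ^ m)], and the mean of [1 / (1 - X)] and [1 / (1 + X)] is
    [1 / (1 - X ^ 2)]. *)
Let avgP m l mu :
  q (avg m l mu * (1 - (mu *: g l) ^+ (2 ^ m)%N) - g l) = 0.
Proof.
elim: m mu => [|m IH] mu.
  rewrite expn0 expr1 /=; set G := g (l + mu).
  have -> : G * (1 - mu *: g l) - g l =
      g l * (G * (z - (l + mu)%:A) - 1) - G * (g l * (z - l%:A) - 1).
    by rewrite scalerDl -[mu *: g l]mulr_algl; ring.
  by apply: N0B; apply: N0M; exact: gP.
rewrite expnS mulnC exprM /=.
set X := (mu *: g l) ^+ (2 ^ m)%N.
have E2 : ((zeta m * mu) *: g l) ^+ (2 ^ m)%N = - X.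
  by rewrite -scalerA exprZn zetaX scaleN1r.
have := IH mu; have := IH (zeta m * mu); rewrite E2 -/X opprK.
set a := avg m l mu; set b := avg m l _ => Hb Ha.
have -> : (2^-1%:C *: (a + b)) * (1 - X ^+ 2) - g l =
    2^-1%:C *: ((1 + X) * (a * (1 - X) - g l) + (1 - X) * (b * (1 + X) - g l)).
  have -> : (1 + X) * (a * (1 - X) - g l) + (1 - X) * (b * (1 + X) - g l) =
    (a + b) * (1 - X ^+ 2) - (g l + g l) by ring.
  rewrite scalerBr -scalerAl; congr (_ - _).
  rewrite scalerDr -scalerDl -[LHS]scale1r; congr (_ *: _).
  by rewrite -rmorphD /= -(rmorph1 (real_complex R)); congr (_%:C); field.
by apply: N0Z; apply: N0D; apply: N0M.
Qed.

(** One of the [2 ^ m] terms averaged is [g (l + mu)]; all the others have norm at most [B]. *)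
Let avg_le B m l mu : (forall k, n k <= B) ->
  q (avg m l mu) <= B - (B - n (l + mu)) / (2 ^ m)%:R.
Proof.
move=> HB; have avgB k nu : q (avg k l nu) <= B.
  elim: k nu => [|k IH] nu /=; first exact: HB.
  rewrite qZ cabsR ger0_norm ?invr_ge0 //.
  have := qD (avg k l nu) (avg k l (zeta k * nu)).
  have := IH nu; have := IH (zeta k * nu); lra.
elim: m mu => [|m IH] mu /=; first by rewrite expn0 divr1 opprB addrCA subrr addr0.
rewrite qZ cabsR ger0_norm ?invr_ge0 //.
have := qD (avg m l mu) (avg m l (zeta m * mu)).
have := IH mu; have := avgB m (zeta m * mu).
rewrite expnS natrM invfM.
set u := (B - n (l + mu)) / (2 ^ m)%:R.
have -> : (B - n (l + mu)) * (2^-1 / (2 ^ m)%:R) = u / 2 by rewrite /u; ring.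
lra.
Qed.

(** A mean that nearly reaches the bound [B] forces each of its terms to do so. For
    [cabs mu = (4 * B)^-1] the mean over [N] points differs from [g l] by at most [4 ^ -N * B],
    while a single term has weight [1 / N]; since [N ^ 2 <= 4 ^ N], taking [N > 2 * B / e] makes the
    loss at most [e]. *)
Let step B mu e : (forall k, n k <= B) -> 0 < B -> cabs mu = (4 * B)^-1 -> 0 < e ->
  exists2 d, 0 < d & forall l, B - d <= n l -> B - e <= n (l + mu).
Proof.
move=> HB B0 muB e0.
pose m := Num.truncn (2 * B / e); pose N := (2 ^ m)%N.
have N0 : 0 < N%:R :> R by rewrite ltr0n expn_gt0.
have Nm : 2 * B / e < N%:R.
  apply: lt_le_trans (Num.Theory.truncnS_gt _) _.
  by rewrite ler_nat /N ltn_expl.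
exists (e / 2 / N%:R); first by rewrite !divr_gt0.
move=> l Hl.
have Ha := avg_le m l mu HB; have Hp := avgP m l mu; rewrite -/N in Ha Hp.
set a := avg m l mu in Ha Hp.
have aB : q a <= B.
  apply: le_trans Ha _; rewrite gerBl divr_ge0 ?subr_ge0 ?HB //.
have X4 : q ((mu *: g l) ^+ N) <= 4^-1 ^+ N.
  rewrite -(prednK (_ : 0 < N)%N) ?expn_gt0 //.
  apply: le_trans (seminorm_expr_le _ _) _; apply: lerXn2r; rewrite ?nnegrE ?q_ge0 ?invr_ge0 //.
  rewrite qZ muB invfM -mulrA ler_piMr ?invr_ge0 //.
  by rewrite ler_pdivrMl ?mulr1 //; exact: HB.
have Hn : n l <= q a + 4^-1 ^+ N * B.
  have h : q (g l - (a - a * (mu *: g l) ^+ N)) = 0.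
    by rewrite -opprB qN; move: Hp; rewrite mulrBr mulr1.
  apply: le_trans (N0_le h) _; apply: le_trans (qD _ _) _; rewrite qN lerD2l mulrC.
  by apply: le_trans (qM _ _) _; apply: ler_pM; rewrite ?q_ge0.
have N4 : 4^-1 ^+ N * N%:R * N%:R <= 1 :> R.
  rewrite exprVn -mulrA ler_pdivrMl ?exprn_gt0 // mulr1 -natrM -natrX ler_nat.
  have -> : (4 ^ N = 2 ^ N * 2 ^ N)%N by rewrite -expnMn.
  by apply: leq_mul; apply: ltnW; apply: ltn_expl.
have H1 : (B - n (l + mu)) / N%:R <= e / 2 / N%:R + 4^-1 ^+ N * B by lra.
move: H1; rewrite ler_pdivrMr // mulrDl mulfVK ?gt_eqF //.
have H2 : 4^-1 ^+ N * B * N%:R <= e / 2.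
  have H3 : 4^-1 ^+ N * N%:R * N%:R * B <= B by rewrite ger_pMl.
  have H4 : 4^-1 ^+ N * B * N%:R * (2 * B / e) <= B.
    apply: le_trans H3; rewrite (_ : 4^-1 ^+ N * N%:R * N%:R * B = 4^-1 ^+ N * B * N%:R * N%:R); last by ring.
    by rewrite ler_wpM2l ?(ltW Nm) // !mulr_ge0 // ?exprn_ge0 ?invr_ge0 // ltW.
  have H5 : 4^-1 ^+ N * B * N%:R * (2 * B / e) = (4^-1 ^+ N * B * N%:R * 2 / e) * B by field; rewrite gt_eqF.
  move: H4; rewrite H5 ger_pMl // ler_pdivrMr // mul1r; lra.
lra.
Qed.

Let steps B (mu : R) k e : (forall k, n k <= B) -> 0 < B -> mu = (4 * B)^-1 -> 0 < e ->
  exists2 d, 0 < d & forall l, B - d <= n l -> B - e <= n (l + (mu *+ k)%:C).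
Proof.
move=> HB B0 muB; elim: k e => [|k IH] e e0.
  by exists e => // l; rewrite mulr0n addr0.
have cmu : cabs mu%:C = (4 * B)^-1.
  by rewrite cabsR muB ger0_norm // invr_ge0 mulr_ge0 // ltW.
have [d1 d10 H1] := step HB B0 cmu e0.
have [d d0 H] := IH d1 d10.
by exists d => // l /H /H1; rewrite -addrA -rmorphD -mulrSr.
Qed.

(* The norm of the resolvent satisfies a maximum principle, which is not
   compatible with its decay at infinity. *)
Lemma resolvent_not_entire : False.
Proof.
have [K HK] := n_bounded.
have hs : has_sup (range n).
  by split; [exists (n 0), 0 | exists K => _ [l _ <-]].
pose B := sup (range n).
have HB l : n l <= B by apply: sup_upper_bound => //; exists l.
have B0 : 0 < B by apply: lt_le_trans (n_gt0 0) (HB 0).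
pose mu := (4 * B)^-1.
have mu0 : 0 < mu by rewrite invr_gt0 mulr_gt0.
pose r := q z + 2 * q 1 / B + 1.
have farB l : r <= cabs l -> n l < B / 2.
  move=> rl; have H := far l; have nl0 := n_gt0 l.
  have H1 := ler_wpM2r (ltW nl0) rl.
  have H2 : (2 * q 1 / B + 1) * n l <= q 1 by move: H1; rewrite /r; lra.
  have : (2 * q 1 / B) * n l < q 1 by lra.
  rewrite mulrAC ltr_pdivrMr // => H3.
  have : q 1 * (2 * n l) < q 1 * B by lra.
  by rewrite ltr_pM2l // => ?; lra.
have r0 : 0 <= r by rewrite /r !addr_ge0 // !divr_ge0 ?mulr_ge0 // ltW.
(* The [k] steps of length [mu] start inside the disc of radius [r] and end outside it, where [farB]
   contradicts the lower bound [B / 2] that they carry along. *)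
pose k := (Num.truncn (2 * r / mu)).+1.
have kr : 2 * r < mu *+ k.
  rewrite -(mulr_natr mu) -ltr_pdivrMl // mulrC; exact: Num.Theory.truncnS_gt.
have B20 : 0 < B / 2 by rewrite divr_gt0.
have [d d0 Hd] := steps k HB B0 (erefl mu) B20.
have md : 0 < Num.min d (B / 2) by rewrite lt_min d0.
have [_ [l _ <-] Hl] := sup_adherent md hs.
have {Hd}/Hd H1 : B - d <= n l.
  by apply: le_trans (ltW Hl); rewrite lerB // ge_min lexx.
have H2 : B / 2 < n l.
  have h : Num.min d (B / 2) <= B / 2 by rewrite ge_min lexx orbT.
  by rewrite -/B in Hl; lra.
have H3 : cabs l < r by rewrite ltNge; apply/negP => /farB; lra.
have : n (l + (mu *+ k)%:C) < B / 2.
  apply: farB; apply: le_trans (Re_cabs _); rewrite Re_add Re_real.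
  have := le_lt_trans (Re_le_cabs l) H3; rewrite ltr_norml; lra.
by lra.
Qed.

End GelfandMazur.

(** * Gelfand theory *)

(** The clause [e <= 1] allows terms in [e ^ 2] to be absorbed in [K * e]. *)
Lemma le_eps_mul (R : realType) (K x y : R) :
  (forall e, 0 < e -> e <= 1 -> x <= y + K * e) -> x <= y.
Proof.
move=> H; apply: le_eps => e e0.
have K1 : 0 < `|K| + 1 by rewrite ltr_wpDl.
pose e' := Num.min 1 (e / (`|K| + 1)).
have e'0 : 0 < e' by rewrite lt_min ltr01 divr_gt0.
have e'1 : e' <= 1 by rewrite ge_min lexx.
apply: le_trans (H _ e'0 e'1) _; rewrite lerD2l.
apply: le_trans (_ : (`|K| + 1) * e' <= _).
  by apply: ler_wpM2r; [exact: ltW|rewrite (le_trans (ler_norm K)) // lerDl].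
by rewrite mulrC -ler_pdivlMr // ge_min lexx orbT.
Qed.

Section Gelfand.
Context {R : realType} {A : comBanachAlgType R[i]}.
Implicit Types (f g : A).

Definition rnorm f : R := Re `|f|.

Lemma normr_rnorm f : `|f| = (rnorm f)%:C.
Proof. by rewrite /rnorm RRe_real // ger0_real. Qed.

Lemma rnorm_ge0 f : 0 <= rnorm f.
Proof. by rewrite -lecR -normr_rnorm; exact: normr_ge0. Qed.

Lemma rnormD f g : rnorm (f + g) <= rnorm f + rnorm g.
Proof. by rewrite -lecR rmorphD /= -!normr_rnorm ler_normD. Qed.

Lemma rnormN f : rnorm (- f) = rnorm f.
Proof. by rewrite /rnorm normrN. Qed.

Lemma rnormZ (a : R[i]) f : rnorm (a *: f) = cabs a * rnorm f.
Proof.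
by apply: complexI; rewrite rmorphM /= -normC_cabs -!normr_rnorm normrZ.
Qed.

Lemma rnormM f g : rnorm (f * g) <= rnorm f * rnorm g.
Proof.
by rewrite -lecR rmorphM /= -!normr_rnorm; exact: banach_normM_le.
Qed.

Lemma rnorm0 : rnorm 0 = 0.
Proof. by rewrite /rnorm normr0. Qed.

Lemma rnorm_eq0 f : rnorm f = 0 -> f = 0.
Proof. by move=> h; apply: normr0_eq0; rewrite normr_rnorm h. Qed.

Lemma rnorm_complete (u : nat -> A) :
  (forall e : R, 0 < e -> exists N, forall n, (N <= n)%N -> rnorm (u n - u N) <= e) ->
  exists s, forall e : R, 0 < e ->
    exists N, forall n, (N <= n)%N -> rnorm (s - u n) <= e.
Proof.
move=> cauchy_u.
have /cauchy_cvg : cauchy (u @ \oo).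
  apply: cauchy_exP => e; rewrite ltcE /= => /andP[/eqP e_im e0].
  have e20 : 0 < Re e / 2 by rewrite divr_gt0.
  have [N HN] := cauchy_u _ e20.
  exists (u N); exists N => // n /= /HN h.
  rewrite -ball_normE /= -normrN opprB normr_rnorm ltcE /= e_im eqxx /=.
  by apply: le_lt_trans h _; rewrite ltr_pdivrMr // ltr_pMr // ltr1n.
move=> /cvg_ex[s /cvgrPdist_lt us]; exists s => e e0.
have eC0 : 0 < e%:C by rewrite ltcR.
have [N _ HN] := us _ eC0; exists N => n /HN /=.
by rewrite normr_rnorm ltcR => /ltW.
Qed.

Lemma small_expr (a e : R) : 0 <= a -> a < 1 -> 0 < e -> exists n, a ^+ n <= e.
Proof.
move=> a0 a1 e0.
have /cvgrPdist_le/(_ e e0)[N _ /(_ N (leqnn _))] /= :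
    (fun n => a ^+ n) @ \oo --> (0 : R) by apply: cvg_expr; rewrite ger0_norm.
by rewrite sub0r normrN ger0_norm ?exprn_ge0 // => h; exists N.
Qed.

(** The factor [rnorm 1] accounts for [n = 0], as the unit may have norm greater than 1. *)
Lemma rnormX f n : rnorm (f ^+ n) <= rnorm 1 * rnorm f ^+ n.
Proof.
elim: n => [|n IH]; first by rewrite !expr0 mulr1.
rewrite exprSr (exprSr (rnorm f)) mulrA; apply: le_trans (rnormM _ _) _.
by apply: ler_wpM2r => //; exact: rnorm_ge0.
Qed.

(** The inverse is the Neumann series: [tail] makes its partial sums Cauchy, and
    [(1 - f) * s n = 1 - f ^+ n] passes to the limit. *)
Lemma small_unit f : rnorm f < 1 -> 1 - f \is a GRing.unit.
Proof.
move=> f1; set a := rnorm f in f1; have a0 : 0 <= a := rnorm_ge0 f.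
have a1 : 0 < 1 - a by rewrite subr_gt0.
pose c := rnorm (1 : A); have c0 : 0 <= c := rnorm_ge0 1.
have c1 : 0 < c + 1 by rewrite ltr_wpDl.
pose s n := \sum_(i < n) f ^+ i.
have tail n k : rnorm (s (n + k)%N - s n) * (1 - a) <= c * a ^+ n * (1 - a ^+ k).
  elim: k => [|k IH]; first by rewrite addn0 subrr rnorm0 mul0r expr0 subrr mulr0.
  rewrite addnS {1}/s big_ord_recr /= -/(s _) addrAC.
  have H1 := ler_wpM2r (ltW a1) (rnormD (s (n + k)%N - s n) (f ^+ (n + k))).
  have H2 := ler_wpM2r (ltW a1) (rnormX f (n + k)).
  apply: le_trans H1 _; rewrite mulrDl; apply: le_trans (lerD IH H2) _.
  by rewrite -/a -/c exprD exprSr; lra.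
have small e : 0 < e -> exists n, c * a ^+ n <= e.
  move=> e0; have e1 : 0 < e / (c + 1) by rewrite divr_gt0.
  have [n Hn] := small_expr a0 f1 e1; exists n.
  apply: le_trans (ler_wpM2l c0 Hn) _.
  by rewrite mulrA ler_pdivrMr // mulrC ler_wpM2l ?lerDl // ltW.
have decr n k : (n <= k)%N -> c * a ^+ k <= c * a ^+ n.
  by move=> nk; apply: ler_wpM2l => //; apply: ler_wiXn2l => //; exact: ltW.
have [e e0|t Ht] := @rnorm_complete s.
  have e1 : 0 < e * (1 - a) by rewrite mulr_gt0.
  have [N HN] := small _ e1; exists N => n Nn.
  rewrite -(ler_pM2r a1); apply: le_trans HN; rewrite -(subnKC Nn).
  apply: le_trans (tail _ _) _; rewrite ler_piMr ?mulr_ge0 ?exprn_ge0 //.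
  by rewrite gerBl exprn_ge0.
have sE n : (1 - f) * s n = 1 - f ^+ n.
  elim: n => [|n IH]; first by rewrite /s big_ord0 mulr0 expr0 subrr.
  by rewrite /s big_ord_recr /= -/(s n) mulrDr IH exprS; ring.
apply/unitrP; exists t; suff E : (1 - f) * t = 1 by rewrite mulrC E.
apply/eqP; rewrite -subr_eq0; apply/eqP/rnorm_eq0/eqP.
rewrite eq_le rnorm_ge0 andbT.
apply: (@le_eps_mul _ (rnorm (1 - f) + 1)) => e e0 _; rewrite add0r.
have [N HN] := Ht _ e0; have [M HM] := small _ e0.
have := HN _ (leq_maxl N M); have := le_trans (decr _ _ (leq_maxr N M)) HM.
set n := maxn N M => H1 H2.
have -> : (1 - f) * t - 1 = (1 - f) * (t - s n) - f ^+ n.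
  by rewrite mulrBr sE; ring.
apply: le_trans (rnormD _ _) _; rewrite rnormN [leRHS]mulrDl mul1r; apply: lerD.
  by apply: le_trans (rnormM _ _) _; rewrite ler_wpM2l ?rnorm_ge0.
exact: le_trans (rnormX _ _) H1.
Qed.

Definition is_ideal (I : set A) :=
  [/\ I 0, ~ I 1 & forall a u v, I u -> I v -> I (a * u + v)].

Lemma idealr_closed_is_ideal (I : {pred A}) :
  idealr_closed I -> is_ideal [set f | f \in I].
Proof. by case=> I0 /negP I1 H; split=> // a u v uI vI; exact: H. Qed.

Lemma is_ideal_idealr_closed (I : set A) :
  is_ideal I -> idealr_closed (fun f => `[< I f >]).
Proof.
case=> I0 I1 H; split; first exact/asboolP.
  by apply/negP => /asboolP.
by move=> a u v /asboolP uI /asboolP vI; apply/asboolP/H.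
Qed.

Lemma krull f : f \isn't a GRing.unit ->
  exists2 I : {pred A}, maximal_ideal I & f \in I.
Proof.
move=> fU; pose P (I : set A) := I = set0 \/ is_ideal I /\ I f.
have [F FP Ftot|I [PI maxI]] := @Zorn_bigcup _ P.
  have [Fne|Fe] := pselect (exists2 I, F I & I !=set0); last first.
    left; rewrite -subset0 => x [I FI Ix]; apply: Fe.
    by exists I => //; exists x.
  right; have idl I x : F I -> I x -> is_ideal I /\ I f.
    by move=> FI Ix; case: (FP I FI) => [I0|//]; rewrite I0 in Ix.
  have [I FI [x Ix]] := Fne; have [[I0 I1 _] If] := idl I x FI Ix.
  split; last by exists I.
  split; first by exists I.
    by move=> [J FJ J1]; have [[_ + _] _] := idl J 1 FJ J1.
  move=> a u v [J FJ Ju] [K FK Kv].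
  have [[_ _ HJ] _] := idl J u FJ Ju; have [[_ _ HK] _] := idl K v FK Kv.
  have [JK|KJ] := Ftot J K FJ FK.
    by exists K => //; apply: HK => //; exact: JK.
  by exists J => //; apply: HJ => //; exact: KJ.
have [idI If] : is_ideal I /\ I f.
  case: PI => // I0; exfalso.
  pose J : set A := [set g | exists h, g = h * f].
  apply: (maxI J); last first.
    right; split; last by exists 1; rewrite mul1r.
    split; first by exists 0; rewrite mul0r.
      move=> [h h1]; move/negP: fU; apply; apply/unitrP.
      by exists h; rewrite -h1 mulrC -h1.
    by move=> a _ _ [h ->] [k ->]; exists (a * h + k); rewrite mulrDl mulrA.
  by rewrite I0; split => // /(_ 0); apply; exists 0; rewrite mul0r.
exists (fun f => `[< I f >]); last exact/asboolP.
split=> [|J /idealr_closed_is_ideal idJ IJ g gJ]; first exact: is_ideal_idealr_closed.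
apply/asboolP; apply: contrapT => ngI.
have IJ' h : I h -> h \in J by move=> Ih; apply: IJ; exact/asboolP.
apply: (maxI [set h | h \in J]); last by right; split => //; exact: IJ'.
by split; [exact: IJ' | move=> /(_ g gJ)].
Qed.

End Gelfand.

(** * Characters from maximal ideals *)

Section QuotientNorm.
Context {R : realType} {A : comBanachAlgType R[i]}.
Variable I : {pred A}.
Hypothesis maxI : maximal_ideal I.

Let I0 : 0 \in I. Proof. by case: maxI => -[]. Qed.
Let I1 : 1 \notin I. Proof. by case: maxI => -[]. Qed.
Let IP a u v : u \in I -> v \in I -> a * u + v \in I.
Proof. by case: maxI => -[_ _ H] _; exact: H. Qed.
Let IM a u : u \in I -> a * u \in I.
Proof. by move=> uI; rewrite -[_ * _]addr0 IP. Qed.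
Let ID u v : u \in I -> v \in I -> u + v \in I.
Proof. by move=> uI vI; rewrite -[u]mul1r IP. Qed.
Let IN u : u \in I -> - u \in I.
Proof. by move=> uI; rewrite -mulN1r IM. Qed.
Let IB u v : u \in I -> v \in I -> u - v \in I.
Proof. by move=> uI vI; rewrite ID ?IN. Qed.
Let IZ a u : u \in I -> a *: u \in I.
Proof. by move=> uI; rewrite -mulr_algl IM. Qed.

Let unit_notin u : u \is a GRing.unit -> u \notin I.
Proof.
by move=> uU; apply: contraNN I1 => uI; rewrite -(mulVr uU) IM.
Qed.

Let q (f : A) : R := inf [set rnorm (f - k) | k in [set k | k \in I]].

Let q_le f k : k \in I -> q f <= rnorm (f - k).
Proof.
move=> kI; apply: ge_inf; last by exists k.
by exists 0 => _ [h _ <-]; exact: rnorm_ge0.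
Qed.

Let q_adh f e : 0 < e -> exists2 k, k \in I & rnorm (f - k) <= q f + e.
Proof.
move=> e0; have hi : has_inf [set rnorm (f - k) | k in [set k | k \in I]].
  split; first by exists (rnorm (f - 0)); exists 0.
  by exists 0 => _ [h _ <-]; exact: rnorm_ge0.
by have [_ [k kI <-] /ltW h] := inf_adherent e0 hi; exists k.
Qed.

Let q_ge f (x : R) : (forall k, k \in I -> x <= rnorm (f - k)) -> x <= q f.
Proof.
move=> H; apply: le_eps => e e0; have [k kI] := q_adh f e0.
exact: le_trans (H k kI).
Qed.

Let q_ge0 f : 0 <= q f. Proof. by apply: q_ge => k _; exact: rnorm_ge0. Qed.

Let qD f g : q (f + g) <= q f + q g.
Proof.
apply: (@le_eps_mul _ 2) => e e0 _.
have [k kI Hk] := q_adh f e0; have [h hI Hh] := q_adh g e0.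
apply: le_trans (q_le _ (ID kI hI)) _.
have -> : f + g - (k + h) = (f - k) + (g - h) by ring.
by apply: le_trans (rnormD _ _) _; lra.
Qed.

Let qM f g : q (f * g) <= q f * q g.
Proof.
apply: (@le_eps_mul _ (q f + q g + 1)) => e e0 e1.
have [k kI Hk] := q_adh f e0; have [h hI Hh] := q_adh g e0.
apply: le_trans (@q_le _ (g * k + (f - k) * h) _) _; first by rewrite ID ?IM.
have -> : f * g - (g * k + (f - k) * h) = (f - k) * (g - h) by ring.
apply: le_trans (rnormM _ _) _.
apply: le_trans (ler_pM (rnorm_ge0 _) (rnorm_ge0 _) Hk Hh) _.
have := q_ge0 f; have := q_ge0 g; nra.
Qed.

Let qZ a f : q (a *: f) = cabs a * q f.
Proof.
have leZ b h : q (b *: h) <= cabs b * q h.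
  apply: (@le_eps_mul _ (cabs b)) => e e0 _; have [k kI Hk] := q_adh h e0.
  apply: le_trans (q_le _ (IZ b kI)) _; rewrite -scalerBr rnormZ -mulrDr.
  by rewrite ler_wpM2l ?cabs_ge0.
apply/eqP; rewrite eq_le leZ /=; have [->|a0] := eqVneq a 0.
  by rewrite cabs0 mul0r q_ge0.
rewrite -ler_pdivlMl ?cabs_gt0 // -cabsV.
by apply: le_trans (leZ _ _); rewrite scalerA mulVf ?scale1r.
Qed.

(** An element [k] of [I] with [rnorm (1 - k) < 1] would be invertible by [small_unit]; so [1] has
    distance at least 1 from [I]. *)
Let q1 : 0 < q 1.
Proof.
apply: lt_le_trans ltr01 (q_ge _) => k kI; rewrite leNgt; apply/negP => /small_unit.
by rewrite opprB addrC subrK => /unit_notin; rewrite kI.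
Qed.

(** Otherwise every [f - l%:A] is invertible modulo [I], since by maximality the ideal [J] that it
    generates together with [I] contains 1. The inverses form a resolvent defined for all [l], which
    [resolvent_not_entire] excludes. *)
Lemma gelfand_mazur f : exists l, f - l%:A \in I.
Proof.
apply: contrapT => noneI.
have inv l : exists g, q (g * (f - l%:A) - 1) = 0.
  set u := f - l%:A; have uI : u \notin I by apply/negP => uI; apply: noneI; exists l.
  have [h [k [kI kh]]] : exists h k, k \in I /\ 1 = h * u + k.
    apply: contrapT => no1; move/negP: uI; apply.
    pose J : set A := [set g | exists h k, k \in I /\ g = h * u + k].
    have idJ : is_ideal J.
      split=> //; first by exists 0, 0; rewrite mul0r addr0.
      move=> a _ _ [h [k [kI ->]]] [h' [k' [k'I ->]]].
      by exists (a * h + h'), (a * k + k'); split; [exact: IP | ring].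
    case: maxI => _ /(_ _ (is_ideal_idealr_closed idJ)); apply.
      by move=> g gI; apply/asboolP; exists 0, g; rewrite mul0r add0r.
    by apply/asboolP; exists 1, 0; rewrite mul1r addr0.
  exists h; apply/eqP; rewrite eq_le q_ge0 andbT.
  have -> : h * u - 1 = - k by rewrite kh; ring.
  by apply: le_trans (q_le _ (IN kI)) _; rewrite subrr rnorm0.
have [g gP] := choice inv.
exact: (resolvent_not_entire qD qM qZ q1 gP).
Qed.

(** The scalar given by [gelfand_mazur] is unique because [1] is not in [I]; linearity and
    multiplicativity of [m] follow from uniqueness. *)
Lemma character_of_maximal_ideal :
  exists2 m, @characters R A m & forall f, (m f == 0) = (f \in I).
Proof.
have [m mP] := choice gelfand_mazur.
have uniq f l : f - l%:A \in I -> m f = l.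
  move=> lI; apply/eqP; rewrite -subr_eq0; apply: contraNT I1 => d0.
  have -> : 1 = (m f - l)^-1 *: ((f - l%:A) - (f - (m f)%:A)) :> A.
    have -> : (f - l%:A) - (f - (m f)%:A) = (m f - l)%:A by rewrite scalerBl; ring.
    by rewrite scalerA mulVf ?scale1r.
  by apply: IZ; apply: IB => //; exact: mP.
have m0 f : (m f == 0) = (f \in I).
  apply/eqP/idP => [mf|fI]; first by have := mP f; rewrite mf scale0r subr0.
  by apply: uniq; rewrite scale0r subr0.
exists m => //; split.
- by exists 1; rewrite m0.
- move=> a f g; apply: uniq.
  have -> : a *: f + g - (a * m f + m g)%:A = a *: (f - (m f)%:A) + (g - (m g)%:A).
    by rewrite scalerDl scalerBr scalerA; ring.
  by apply: ID; [apply: IZ|]; exact: mP.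
- move=> f g; apply: uniq.
  have -> : f * g - (m f * m g)%:A = f * (g - (m g)%:A) + m g *: (f - (m f)%:A).
    rewrite mulrBr scalerBr scalerA -scalerAr mulr1 (mulrC (m f)); ring.
  by apply: ID; [apply: IM|apply: IZ]; exact: mP.
Qed.

End QuotientNorm.

(** * The Gelfand transform and the spectral radius *)

Section GelfandTransform.
Context {R : realType} {A : comBanachAlgType R[i]}.
Implicit Types (f g : A) (m : max_ideal_space A).

Lemma gelfand_linear a f g m :
  gelfand (a *: f + g) m = a * gelfand f m + gelfand g m.
Proof. by have /set_mem[_ H _] := valP m; exact: H. Qed.

Lemma gelfandM f g m : gelfand (f * g) m = (gelfand f m : R[i]) * gelfand g m.
Proof. by have /set_mem[_ _ H] := valP m; exact: H. Qed.

Lemma gelfand1 m : gelfand 1 m = 1.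
Proof.
have /set_mem[[f f0] _ _] := valP m.
by apply: (mulIf f0); rewrite -[LHS]gelfandM !mul1r.
Qed.

Lemma gelfandD f g m : gelfand (f + g) m = (gelfand f m : R[i]) + gelfand g m.
Proof. by rewrite -{1}[f]scale1r gelfand_linear mul1r. Qed.

Lemma gelfand0 m : gelfand 0 m = 0.
Proof. by apply: (addrI (gelfand 0 m)); rewrite -gelfandD !addr0. Qed.

Lemma gelfandZ a f m : gelfand (a *: f) m = a * gelfand f m.
Proof. by rewrite -[a *: f]addr0 gelfand_linear gelfand0 addr0. Qed.

Lemma gelfandN f m : gelfand (- f) m = - (gelfand f m : R[i]).
Proof. by rewrite -scaleN1r gelfandZ mulN1r. Qed.

Lemma gelfandB f g m : gelfand (f - g) m = (gelfand f m : R[i]) - gelfand g m.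
Proof. by rewrite gelfandD gelfandN. Qed.

Lemma gelfandX f n m : gelfand (f ^+ n) m = (gelfand f m : R[i]) ^+ n.
Proof. by elim: n => [|n IH]; rewrite ?gelfand1 // !exprS gelfandM IH. Qed.

Lemma gelfandA a m : gelfand a%:A m = a.
Proof. by rewrite gelfandZ gelfand1 mulr1. Qed.

Lemma char_of_nonunit f : f \isn't a GRing.unit -> exists m, gelfand f m = 0.
Proof.
move=> /krull[I maxI fI]; have [m mP m0] := character_of_maximal_ideal maxI.
exists (SigSub (mem_set mP)); apply/eqP.
by rewrite -[_ == _]/(m f == 0) m0.
Qed.

Lemma gelfand_unit_neq0 f m : f \is a GRing.unit -> gelfand f m != 0.
Proof.
move=> fU; apply/eqP => f0; have := gelfand1 m.
by rewrite -(mulVr fU) gelfandM f0 mulr0 => /esym/eqP; rewrite oner_eq0.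
Qed.

Lemma unit_gelfand f : (forall m, gelfand f m != 0) -> f \is a GRing.unit.
Proof.
move=> H; apply: contrapT => /negP /char_of_nonunit[m fm].
by have := H m; rewrite fm eqxx.
Qed.

Lemma gelfandV f m : f \is a GRing.unit -> gelfand f^-1 m = (gelfand f m : R[i])^-1.
Proof.
move=> fU; apply: (mulIf (gelfand_unit_neq0 m fU)).
by rewrite -[LHS]gelfandM mulVr // gelfand1 mulVf // gelfand_unit_neq0.
Qed.

Lemma spectrumE f : spectrum f = range (gelfand f).
Proof.
apply/seteqP; split=> [l|_ [m _ <-]].
  move=> /char_of_nonunit[m]; rewrite gelfandB gelfandA => /eqP.
  by rewrite subr_eq0 => /eqP lm; exists m.
apply/negP => /(@gelfand_unit_neq0 _ m).
by rewrite gelfandB gelfandA subrr eqxx.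
Qed.

Lemma max_ideal_space_inhabited : exists m : max_ideal_space A, True.
Proof.
have /char_of_nonunit[m _] : (0 : A) \isn't a GRing.unit by rewrite unitr0.
by exists m.
Qed.

(** Otherwise [f] divided by its value at [m] has norm less than 1, and 1 minus this quotient is a
    unit annihilated by [m]. *)
Lemma gelfand_rnorm f m : cabs (gelfand f m) <= rnorm f.
Proof.
rewrite leNgt; apply/negP => h.
have l0 : gelfand f m != 0 by rewrite -cabs_gt0 (le_lt_trans (rnorm_ge0 f)).
have /small_unit : rnorm ((gelfand f m)^-1 *: f) < 1.
  by rewrite rnormZ cabsV mulrC ltr_pdivrMr ?mul1r // cabs_gt0.
by move=> /(@gelfand_unit_neq0 _ m); rewrite gelfandB gelfandZ gelfand1 mulVf // subrr eqxx.
Qed.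

Local Notation r := (@spectral_radius R A).

Lemma gelfand_le_radius f m : cabs (gelfand f m) <= r f.
Proof.
apply: sup_upper_bound; last by exists (gelfand f m) => //; rewrite spectrumE; exists m.
split; first by exists (cabs (gelfand f m)), (gelfand f m) => //; rewrite spectrumE; exists m.
by exists (rnorm f) => _ [l + <-]; rewrite spectrumE => -[k _ <-]; exact: gelfand_rnorm.
Qed.

Lemma sradius_le f (K : R) : (forall m, cabs (gelfand f m) <= K) -> r f <= K.
Proof.
move=> H; apply: ge_sup; last first.
  by move=> _ [l + <-]; rewrite spectrumE => -[m _ <-].
have [m _] := max_ideal_space_inhabited.
by exists (cabs (gelfand f m)), (gelfand f m) => //; rewrite spectrumE; exists m.
Qed.

Lemma sradius_ge0 f : 0 <= r f.
Proof.
have [m _] := max_ideal_space_inhabited.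
exact: le_trans (cabs_ge0 _) (gelfand_le_radius f m).
Qed.

Lemma sradiusD f g : r (f + g) <= r f + r g.
Proof.
apply: sradius_le => m; rewrite gelfandD; apply: le_trans (cabsD _ _) _.
by apply: lerD; exact: gelfand_le_radius.
Qed.

Lemma sradiusM f g : r (f * g) <= r f * r g.
Proof.
apply: sradius_le => m; rewrite gelfandM cabsM.
by apply: ler_pM; rewrite ?cabs_ge0 ?gelfand_le_radius.
Qed.

Lemma sradiusZ a f : r (a *: f) = cabs a * r f.
Proof.
have leZ b h : r (b *: h) <= cabs b * r h.
  apply: sradius_le => m; rewrite gelfandZ cabsM.
  by rewrite ler_wpM2l ?cabs_ge0 ?gelfand_le_radius.
apply/eqP; rewrite eq_le leZ /=; have [->|a0] := eqVneq a 0.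
  by rewrite cabs0 mul0r sradius_ge0.
rewrite -ler_pdivlMl ?cabs_gt0 // -cabsV.
by apply: le_trans (leZ _ _); rewrite scalerA mulVf ?scale1r.
Qed.

Lemma sradiusN f : r (- f) = r f.
Proof. by rewrite -scaleN1r sradiusZ cabsN cabs1 mul1r. Qed.

Lemma sradiusA (a : R[i]) : r a%:A = cabs a.
Proof.
have [m _] := max_ideal_space_inhabited.
apply/eqP; rewrite eq_le; apply/andP; split.
  by apply: sradius_le => k; rewrite gelfandA.
by have := gelfand_le_radius a%:A m; rewrite gelfandA.
Qed.

Lemma sradius1 : r 1 = 1.
Proof. by rewrite -[1](scale1r 1) sradiusA cabs1. Qed.

Lemma sradius0 : r 0 = 0.
Proof. by rewrite -(scale0r 1) sradiusA cabs0. Qed.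

Lemma unit_radius f : r (f - 1) < 1 -> f \is a GRing.unit.
Proof.
move=> h; apply: unit_gelfand => m; apply/eqP => f0.
have := gelfand_le_radius (f - 1) m.
by rewrite gelfandB f0 gelfand1 sub0r cabsN cabs1 leNgt h.
Qed.

Hypothesis hA : semisimple A.

Lemma gelfand_inj f g : (forall m, gelfand f m = gelfand g m) -> f = g.
Proof.
move=> H; apply/eqP; rewrite -subr_eq0; apply/eqP/hA => I maxI.
have [m mP m0] := character_of_maximal_ideal maxI; rewrite -m0.
have := H (SigSub (mem_set mP)).
move/eqP; rewrite -subr_eq0 -[X in X == 0]gelfandB; exact.
Qed.

Lemma sradius_eq0 f g : r (f - g) <= 0 -> f = g.
Proof.
move=> h; apply: gelfand_inj => m; apply/eqP; rewrite -subr_eq0; apply/eqP.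
by apply: cabs_le0; rewrite -gelfandB (le_trans (gelfand_le_radius _ _)).
Qed.

End GelfandTransform.

(** * Extreme points of the functionals below a sublinear functional *)

Section Dominated.
Context {R : realType} {V : lmodType R[i]}.
Implicit Types (D : set V) (p q mu : V -> R).

Definition subspace_set D :=
  [/\ D 0, forall u v, D u -> D v -> D (u + v) & forall (a : R[i]) u, D u -> D (a *: u)].

Definition real_linear D mu :=
  (forall u v, D u -> D v -> mu (u + v) = mu u + mu v) /\
  (forall (t : R) u, D u -> mu (t%:C *: u) = t * mu u).

Definition dominated D p mu :=
  real_linear D mu /\ forall u, D u -> mu u <= p u.

Definition extreme_dominated D p mu :=
  dominated D p mu /\
  forall (s1 s2 : V -> R) (t : R), dominated D p s1 -> dominated D p s2 ->
    0 < t < 1 -> (forall u, D u -> mu u = t * s1 u + (1 - t) * s2 u) ->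
    forall u, D u -> s1 u = mu u.

Definition sublinear_on D q :=
  (forall u v, D u -> D v -> q (u + v) <= q u + q v) /\
  (forall (t : R) u, D u -> 0 <= t -> q (t%:C *: u) <= t * q u).

Lemma real_linearN D mu u : real_linear D mu -> D u -> mu (- u) = - mu u.
Proof.
move=> [_ h] Du; have := h (-1) u Du.
by rewrite rmorphN rmorph1 scaleN1r mulN1r.
Qed.

Section Minimal.
Variables (D : set V) (p : V -> R).
Hypotheses (Dsub : subspace_set D) (psub : sublinear_on D p).

Let D0 : D 0. Proof. by case: Dsub. Qed.
Let DD u v : D u -> D v -> D (u + v). Proof. by case: Dsub => _ h _; exact: h. Qed.
Let DZ a u : D u -> D (a *: u). Proof. by case: Dsub => _ _ h; exact: h. Qed.
Let DN u : D u -> D (- u). Proof. by rewrite -scaleN1r; exact: DZ. Qed.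

Let sub0 q : sublinear_on D q -> q 0 = 0.
Proof.
move=> [qD qZ]; have := qZ 0 0 D0 (lexx 0); have := qD 0 0 D0 D0.
by rewrite scaler0 addr0 mul0r => h1 h2; apply/eqP; rewrite eq_le h2 /=; lra.
Qed.

Let subZ q t u : sublinear_on D q -> D u -> 0 <= t -> q (t%:C *: u) = t * q u.
Proof.
move=> sq Du t0; have [_ qZ] := sq; apply/eqP; rewrite eq_le qZ //=.
have [->|tn0] := eqVneq t 0; first by rewrite mul0r scale0r sub0.
have tp : 0 < t by rewrite lt_neqAle eq_sym tn0.
rewrite -ler_pdivlMl //; apply: le_trans (qZ _ _ (DZ _ Du) _); rewrite ?invr_ge0 //.
by rewrite scalerA -rmorphM /= mulVf // scale1r.
Qed.

Let subN q u : sublinear_on D q -> D u -> - q (- u) <= q u.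
Proof.
by move=> sq Du; have [qD _] := sq; have := qD _ _ Du (DN Du); rewrite subrr sub0 //; lra.
Qed.

(* [q] is the support function of a face of the set of functionals dominated
   by [p]. *)
Let facial q := [/\ sublinear_on D q, forall u, D u -> q u <= p u &
  forall (s1 s2 : V -> R) t, dominated D p s1 -> dominated D p s2 -> 0 < t < 1 ->
    (forall u, D u -> t * s1 u + (1 - t) * s2 u <= q u) ->
    forall u, D u -> s1 u <= q u /\ s2 u <= q u].

Let slopes q h v := [set q (v + t%:C *: h) - t * q h | t in [set t : R | 0 <= t]].

(* The support function of the subface on which [h] is maximal. *)
Let deriv q h v := inf (slopes q h v).

Let deriv_hasinf q h v : sublinear_on D q -> D h -> D v -> has_inf (slopes q h v).
Proof.
move=> sq Dh Dv; split; first by exists (q (v + 0%:C *: h) - 0 * q h), 0 => //=.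
exists (- q (- v)) => _ [t /= t0 <-]; have [qD _] := sq.
have := qD _ _ (DD Dv (DZ t%:C Dh)) (DN Dv).
by rewrite addrAC subrr add0r subZ //; lra.
Qed.

Let deriv_le q h v t : sublinear_on D q -> D h -> D v -> 0 <= t ->
  deriv q h v <= q (v + t%:C *: h) - t * q h.
Proof.
move=> sq Dh Dv t0; apply: ge_inf; last by exists t.
by case: (deriv_hasinf sq Dh Dv).
Qed.

Let deriv_adh q h v e : sublinear_on D q -> D h -> D v -> 0 < e ->
  exists2 t, 0 <= t & q (v + t%:C *: h) - t * q h <= deriv q h v + e.
Proof.
move=> sq Dh Dv e0.
by have [_ [t t0 <-] /ltW H] := inf_adherent e0 (deriv_hasinf sq Dh Dv); exists t.
Qed.

Let deriv_ge q h v x : sublinear_on D q -> D h -> D v ->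
  (forall t, 0 <= t -> x <= q (v + t%:C *: h) - t * q h) -> x <= deriv q h v.
Proof.
move=> sq Dh Dv H; apply: le_eps => e e0.
by have [t t0 Ht] := deriv_adh sq Dh Dv e0; exact: le_trans (H t t0) Ht.
Qed.

Let deriv_le_self q h v : sublinear_on D q -> D h -> D v -> deriv q h v <= q v.
Proof.
move=> sq Dh Dv; apply: le_trans (deriv_le sq Dh Dv (lexx 0)) _.
by rewrite scale0r addr0 mul0r subr0.
Qed.

Let derivN q h : sublinear_on D q -> D h -> deriv q h (- h) <= - q h.
Proof.
move=> sq Dh; apply: le_trans (deriv_le sq Dh (DN Dh) ler01) _.
by rewrite scale1r addNr sub0 // mul1r sub0r.
Qed.

Let facial_deriv q h : facial q -> D h -> facial (deriv q h).
Proof.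
move=> [sq qp qF] Dh; have [qD _] := sq; split.
- split=> [u v Du Dv|s u Du s0].
    apply: (@le_eps_mul _ 2) => e e0 _.
    have [t t0 Ht] := deriv_adh sq Dh Du e0; have [s s0 Hs] := deriv_adh sq Dh Dv e0.
    apply: le_trans (deriv_le sq Dh (DD Du Dv) (addr_ge0 t0 s0)) _.
    have := qD _ _ (DD Du (DZ t%:C Dh)) (DD Dv (DZ s%:C Dh)).
    by rewrite addrACA -scalerDl -rmorphD /=; lra.
  apply: (@le_eps_mul _ s) => e e0 _.
  have [t t0 Ht] := deriv_adh sq Dh Du e0.
  apply: le_trans (deriv_le sq Dh (DZ _ Du) (mulr_ge0 s0 t0)) _.
  rewrite rmorphM -scalerA -scalerDr subZ //; last by apply: DD => //; exact: DZ.
  by have := ler_wpM2l s0 Ht; lra.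
- by move=> u Du; apply: le_trans (qp u Du); exact: deriv_le_self.
- move=> s1 s2 t d1 d2 t01 H.
  have Hq u : D u -> s1 u <= q u /\ s2 u <= q u.
    apply: (qF _ _ _ d1 d2 t01) => v Dv.
    by apply: le_trans (H v Dv) _; exact: deriv_le_self.
  (* The bound at [- h] says that the combination of [s1 h] and [s2 h] is at least [q h]; as neither
     exceeds [q h], both equal it, so [s1] and [s2] lie in the subface where [h] is maximal. *)
  have HN := le_trans (H _ (DN Dh)) (derivN sq Dh).
  rewrite (real_linearN d1.1 Dh) (real_linearN d2.1 Dh) in HN.
  have [h1 h2] := Hq h Dh; have /andP[t0 t1] := t01.
  have e1 : s1 h = q h by apply/eqP; rewrite eq_le h1 /=; nra.
  have e2 : s2 h = q h by apply/eqP; rewrite eq_le h2 /=; nra.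
  move=> u Du; split; apply: deriv_ge => // s s0; rewrite -?e1 -?e2.
    have [sD sZ] := d1.1; have [+ _] := Hq _ (DD Du (DZ s%:C Dh)).
    by rewrite sD ?sZ //; [lra | exact: DZ].
  rewrite e1 -e2; have [sD sZ] := d2.1; have [_] := Hq _ (DD Du (DZ s%:C Dh)).
  by rewrite sD ?sZ //; [lra | exact: DZ].
Qed.

(** Krein-Milman, with support functions in place of faces. [leT] reverses the pointwise order, so
    Zorn's lemma yields a smallest facial [q] subject to [q (- v0) <= - p v0]. Minimality gives
    [q <= deriv q h] for every [h], hence [q (- h) <= - q h] by [derivN]: [q] is linear and its face
    is a single functional. *)
Theorem extreme_dominated_exists v0 : D v0 ->
  exists2 mu, extreme_dominated D p mu & mu v0 = p v0.
Proof.
move=> Dv0; pose Q q := facial q /\ q (- v0) <= - p v0.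
pose T := {q | Q q}.
have fp : facial p by split => // s1 s2 t [_ d1] [_ d2] _ _ u Du; split; [exact: d1|exact: d2].
have Q0 : Q (deriv p v0) by split; [exact: facial_deriv | exact: derivN].
pose t0 : T := exist _ _ Q0.
pose leT (q1 q2 : T) := `[< forall u, D u -> sval q2 u <= sval q1 u >].
have [q qmax] : exists q : T, premaximal leT q.
  apply: (ZL_preorder t0); first by move=> q; exact/asboolP.
    move=> q1 q2 q3 /asboolP h1 /asboolP h2; apply/asboolP => u Du.
    exact: le_trans (h2 u Du) (h1 u Du).
  move=> C Ctot; have [[c Cc]|Ce] := pselect (exists c, C c); last first.
    by exists t0 => s Cs; case: Ce; exists s.
  pose vals u := [set sval q u | q in C]; pose m u := inf (vals u).
  have hi u : D u -> has_inf (vals u).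
    move=> Du; split; first by exists (sval c u), c.
    exists (- p (- u)) => _ [c' _ <-]; have [[sq qp _] _] := proj2_sig c'.
    by apply: le_trans (subN sq Du); rewrite lerN2; apply: qp; exact: DN.
  have m_le u (q : T) : D u -> C q -> m u <= sval q u.
    by move=> Du Cq; apply: ge_inf; [case: (hi u Du) | exists q].
  have m_adh u e : D u -> 0 < e -> exists2 q : T, C q & sval q u <= m u + e.
    move=> Du e0; have [_ [q Cq <-] /ltW h] := inf_adherent e0 (hi u Du).
    by exists q.
  have m_ge u x : D u -> (forall q : T, C q -> x <= sval q u) -> x <= m u.
    move=> Du H; apply: le_eps => e e0; have [q Cq] := m_adh u e Du e0.
    exact: le_trans (H q Cq).
  have Qm : Q m.
    split; last first.
      apply: le_trans (m_le _ _ (DN Dv0) Cc) _; by case: (proj2_sig c).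
    split.
    - split=> [u v Du Dv|s u Du s0].
        apply: (@le_eps_mul _ 2) => e e0 _.
        have [q Cq Hq] := m_adh u e Du e0; have [q' Cq' Hq'] := m_adh v e Dv e0.
        (* Of two members of the chain, nearly minimal at [u] and at [v] respectively, the smaller
           one is nearly minimal at both points; this makes the infimum subadditive. *)
        have {q q' Cq Cq' Hq Hq'} [q [Cq Hq Hq']] :
            exists q : T, [/\ C q, sval q u <= m u + e & sval q v <= m v + e].
          have [/asboolP h|/asboolP h] := Ctot _ _ Cq Cq'.
            by exists q'; split => //; apply: le_trans Hq; exact: h.
          by exists q; split => //; apply: le_trans Hq'; exact: h.
        apply: le_trans (m_le _ _ (DD Du Dv) Cq) _.
        have [[[qD _] _ _] _] := proj2_sig q; have := qD u v Du Dv; rewrite /= in Hq Hq' *; lra.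
      apply: (@le_eps_mul _ s) => e e0 _; have [q Cq Hq] := m_adh u e Du e0.
      apply: le_trans (m_le _ _ (DZ _ Du) Cq) _; rewrite -mulrDr.
      have [[[_ qZ] _ _] _] := proj2_sig q; apply: le_trans (qZ s u Du s0) _.
      exact: ler_wpM2l.
    - by move=> u Du; apply: le_trans (m_le _ _ Du Cc) _; have [[_ h _] _] := proj2_sig c; exact: h.
    - move=> s1 s2 t d1 d2 t01 H u Du.
      have K (q : T) : C q -> s1 u <= sval q u /\ s2 u <= sval q u.
        move=> Cq; have [[_ _ h] _] := proj2_sig q; apply: (h _ _ _ d1 d2 t01) => // v Dv.
        by apply: le_trans (H v Dv) _; exact: m_le.
      by split; apply: m_ge => // q /K[].
  exists (exist _ _ Qm) => s Cs; apply/asboolP => u Du; exact: m_le.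
have [[sq qp qF] qv0] := proj2_sig q; set mu := sval q in sq qp qF qv0.
have muN h : D h -> mu (- h) = - mu h.
  move=> Dh; apply/eqP; rewrite eq_le; apply/andP; split; last first.
    by rewrite lerNl; exact: subN.
  have Qd : Q (deriv mu h).
    by split; [exact: facial_deriv | apply: le_trans qv0; apply: deriv_le_self => //; exact: DN].
  have /asboolP : leT (exist _ _ Qd) q.
    by apply: qmax; apply/asboolP => u Du /=; exact: deriv_le_self.
  by move=> /(_ _ (DN Dh)) /= H; apply: le_trans H _; exact: derivN.
have mulin : real_linear D mu.
  split=> [u v Du Dv|t u Du].
    have [qD _] := sq; apply/eqP; rewrite eq_le qD //=.
    have := qD _ _ (DN Du) (DN Dv); rewrite -opprD !muN //; last exact: DD.
    lra.
  have [t_ge0|t_lt0] := leP 0 t; first exact: subZ.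
  rewrite -[t]opprK rmorphN scaleNr muN; last exact: DZ.
  by rewrite subZ ?mulNr // oppr_ge0 ltW.
exists mu; last first.
  apply/eqP; rewrite eq_le qp //=.
  by have := qv0; rewrite muN // lerN2.
split=> // s1 s2 t d1 d2 t01 E u Du.
have H v : D v -> s1 v <= mu v.
  by move=> Dv; have [|//] := qF _ _ _ d1 d2 t01 _ v Dv; move=> w Dw; rewrite -E.
apply/eqP; rewrite eq_le H //=.
by have := H _ (DN Du); rewrite muN // (real_linearN d1.1 Du) lerN2.
Qed.

End Minimal.
End Dominated.

(** * Hahn-Banach extension with prescribed value *)

Section HahnBanach.
Context {R : realType} {E V : lmodType R[i]}.
Variables (D : set V) (p : V -> R) (J : E -> V) (nu : E -> R).
Hypotheses (Dsub : subspace_set D) (psub : sublinear_on D p).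
Hypotheses (JD : {morph J : a b / a + b}) (JZ : forall (t : R) a, J (t%:C *: a) = t%:C *: J a).
Hypotheses (DJ : forall a, D (J a)) (nulin : real_linear setT nu).
Hypothesis (nup : forall a, nu a <= p (J a)).

Let D0 : D 0. Proof. by case: Dsub. Qed.
Let DD u v : D u -> D v -> D (u + v). Proof. by case: Dsub => _ h _; exact: h. Qed.
Let DZ a u : D u -> D (a *: u). Proof. by case: Dsub => _ _ h; exact: h. Qed.
Let DN u : D u -> D (- u). Proof. by rewrite -scaleN1r; exact: DZ. Qed.
Let JN a : J (- a) = - J a.
Proof. by have := JZ (-1) a; rewrite rmorphN rmorph1 !scaleN1r. Qed.
Let nuN a : nu (- a) = - nu a. Proof. exact: real_linearN nulin I. Qed.
Let nuD a b : nu (a + b) = nu a + nu b. Proof. by case: nulin => h _; exact: h. Qed.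
Let J0 : J 0 = 0. Proof. by apply: (addrI (J 0)); rewrite -JD !addr0. Qed.
Let nu0 : nu 0 = 0. Proof. by apply: (addrI (nu 0)); rewrite -nuD !addr0. Qed.

Let ext u := inf [set nu a + p (u - J a) | a in setT].

Let ext_hasinf u : D u -> has_inf [set nu a + p (u - J a) | a in setT].
Proof.
move=> Du; split; first by exists (nu 0 + p (u - J 0)), 0.
exists (- p (- u)) => _ [a _ <-]; have [pD _] := psub.
have := pD _ _ (DN Du) (DD Du (DN (DJ a))).
by rewrite addrA addNr add0r -JN => h; have := nup (- a); rewrite nuN; lra.
Qed.

Let ext_le u a : D u -> ext u <= nu a + p (u - J a).
Proof. by move=> Du; apply: ge_inf; [case: (ext_hasinf Du) | exists a]. Qed.

Let ext_adh u e : D u -> 0 < e -> exists a, nu a + p (u - J a) <= ext u + e.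
Proof.
move=> Du e0; have [_ [a _ <-] /ltW h] := inf_adherent e0 (ext_hasinf Du).
by exists a.
Qed.

(** Any extension of [nu] dominated by [p] is at most [nu a + p (v0 - J a)] at [v0], for all [a].
    Applying [extreme_dominated_exists] to the infimum [ext] produces an extension reaching this
    bound; the last clause thus turns an upper bound on [mu v0] into an element [a]. *)
Lemma hahn_banach_minimal v0 : D v0 ->
  exists mu, [/\ dominated D p mu, forall a, mu (J a) = nu a &
    forall e, 0 < e -> exists a, nu a + p (v0 - J a) <= mu v0 + e].
Proof.
move=> Dv0; have [pD pZ] := psub.
have extsub : sublinear_on D ext.
  split=> [u v Du Dv|t u Du t0].
    apply: (@le_eps_mul _ 2) => e e0 _.
    have [a Ha] := ext_adh Du e0; have [b Hb] := ext_adh Dv e0.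
    apply: le_trans (ext_le (a + b) (DD Du Dv)) _.
    have := pD _ _ (DD Du (DN (DJ a))) (DD Dv (DN (DJ b))).
    by rewrite addrACA -opprD -JD nuD; lra.
  apply: (@le_eps_mul _ t) => e e0 _; have [a Ha] := ext_adh Du e0.
  apply: le_trans (ext_le (t%:C *: a) (DZ _ Du)) _.
  rewrite JZ -scalerBr; have [_ ->//] := nulin.
  have := pZ t _ (DD Du (DN (DJ a))) t0; have := ler_wpM2l t0 Ha; lra.
have [mu [[mulin mule] _] muv0] := extreme_dominated_exists Dsub extsub Dv0.
have muJ a : mu (J a) <= nu a.
  apply: le_trans (mule _ (DJ a)) _; apply: le_trans (ext_le a (DJ a)) _.
  have : p 0 <= 0.
    by have := pZ 0 0 D0 (lexx 0); rewrite scaler0 mul0r.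
  by rewrite subrr; lra.
exists mu; split.
- split=> // u Du; apply: le_trans (mule u Du) _; apply: le_trans (ext_le 0 Du) _.
  by rewrite nu0 J0 subr0 add0r.
- move=> a; apply/eqP; rewrite eq_le muJ /=.
  by have := muJ (- a); rewrite JN nuN (real_linearN mulin (DJ a)) lerN2.
- by move=> e e0; rewrite muv0; exact: ext_adh.
Qed.

End HahnBanach.

(** * Extreme functionals of norm at most one *)

Section BoundedFunctions.
Context {R : realType} {X : Type} (x0 : X).
Implicit Types (u v : X -> R[i]^o).

Definition bounded_functions : set (X -> R[i]^o) :=
  [set u | exists K : R, forall x, cabs (u x) <= K].

Lemma bounded_subspace : subspace_set bounded_functions.
Proof.
split; first by exists 0 => x /=; rewrite cabs0.
  move=> u v [K HK] [L HL]; exists (K + L) => x /=.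
  by apply: le_trans (cabsD _ _) _; exact: lerD.
by move=> a u [K HK]; exists (cabs a * K) => x /=; rewrite cabsM ler_wpM2l ?cabs_ge0.
Qed.

Lemma cabs_le_supnorm u x : bounded_functions u -> cabs (u x) <= supnorm u.
Proof.
move=> [K HK]; apply: sup_upper_bound; last by exists x.
by split; [exists (cabs (u x)), x | exists K => _ [y _ <-]; exact: HK].
Qed.

Lemma supnorm_le u (K : R) : (forall x, cabs (u x) <= K) -> supnorm u <= K.
Proof.
move=> H; apply: ge_sup; first by exists (cabs (u x0)), x0.
by move=> _ [y _ <-]; exact: H.
Qed.

Lemma supnorm_sublinear : sublinear_on bounded_functions (@supnorm R X).
Proof.
split=> [u v Du Dv|t u Du t0]; apply: supnorm_le => x /=.
  by apply: le_trans (cabsD _ _) _; apply: lerD; exact: cabs_le_supnorm.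
by rewrite cabsM cabsR ger0_norm // ler_wpM2l //; exact: cabs_le_supnorm.
Qed.

(** Domination by [supRe] encodes positivity: it gives [mu u <= 0] whenever [Re u <= 0], as for
    integration against a probability measure. *)
Definition supRe u : R := sup (range (fun x => Re (u x))).

Lemma Re_le_supRe u x : bounded_functions u -> Re (u x) <= supRe u.
Proof.
move=> [K HK]; apply: sup_upper_bound; last by exists x.
split; first by exists (Re (u x)), x.
by exists K => _ [y _ <-]; exact: le_trans (Re_cabs _) (HK y).
Qed.

Lemma supRe_le u (K : R) : (forall x, Re (u x) <= K) -> supRe u <= K.
Proof.
move=> H; apply: ge_sup; first by exists (Re (u x0)), x0.
by move=> _ [y _ <-]; exact: H.
Qed.

Lemma supRe_sublinear : sublinear_on bounded_functions supRe.
Proof.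
split=> [u v Du Dv|t u Du t0]; apply: supRe_le => x /=.
  by rewrite Re_add; apply: lerD; exact: Re_le_supRe.
by rewrite (_ : Re ((t%:C *: u) x) = Re (t%:C * u x)) // Re_rmul ler_wpM2l //; exact: Re_le_supRe.
Qed.

End BoundedFunctions.

Section ExtremeFunctionals.
Context {R : realType} {A : comBanachAlgType R[i]}.
Implicit Types (f g h : A) (m : max_ideal_space A).
Local Notation r := (@spectral_radius R A).
Local Notation X := (max_ideal_space A).
Local Notation B := (@bounded_functions R X).

Lemma gelfand_bounded h : B (gelfand h).
Proof. by exists (r h) => m; exact: gelfand_le_radius. Qed.

Lemma gelfand_morphD : {morph @gelfand R A : a b / a + b}.
Proof. by move=> a b; apply/funext => m; rewrite gelfandD. Qed.

Lemma gelfand_morphZ (a : R[i]) h : gelfand (a *: h) = a *: gelfand h.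
Proof. by apply/funext => m; rewrite gelfandZ. Qed.

Lemma gelfand_morphN h : gelfand (- h) = - gelfand h.
Proof. by apply/funext => m; rewrite gelfandN. Qed.

Lemma supnorm_gelfand h : supnorm (gelfand h) = r h.
Proof.
have [m _] := @max_ideal_space_inhabited R A.
apply/eqP; rewrite eq_le; apply/andP; split.
  by apply: (supnorm_le m) => k; exact: gelfand_le_radius.
by apply: sradius_le => k; apply: cabs_le_supnorm; exact: gelfand_bounded.
Qed.

Lemma sradius_sublinear : sublinear_on setT r.
Proof.
split=> [f g _ _|t f _ t0]; first exact: sradiusD.
by rewrite sradiusZ cabsR ger0_norm.
Qed.

Lemma setT_subspace : @subspace_set R A setT.
Proof. by []. Qed.

(** [mu] stands in for a representing measure: it acts on all bounded functions, in particular on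
    products of Gelfand transforms with arbitrary bounded real functions. *)
Lemma dominated_extends nu : dominated setT r nu ->
  exists2 mu, dominated B (@supnorm R X) mu & forall h, mu (gelfand h) = nu h.
Proof.
move=> [nulin nur]; have [m _] := @max_ideal_space_inhabited R A.
have nup h : nu h <= supnorm (gelfand h) by rewrite supnorm_gelfand; exact: nur.
have [mu [dmu muJ _]] := hahn_banach_minimal bounded_subspace (supnorm_sublinear m)
  gelfand_morphD (fun t => gelfand_morphZ t%:C) gelfand_bounded nulin nup (gelfand_bounded 0).
by exists mu.
Qed.

Lemma sradius_dominated_scale l (a : R) h : real_linear setT l -> 0 <= a ->
  (forall g, r g <= 1 -> l g <= a) -> l h <= a * r h.
Proof.
move=> [_ lZ] a0 H; apply: (@le_eps_mul _ a) => e e0 _; rewrite -mulrDr.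
have s0 : 0 < r h + e by rewrite ltr_wpDl ?sradius_ge0.
rewrite -ler_pdivrMr // mulrC -lZ //; apply: H.
rewrite sradiusZ cabsR ger0_norm ?invr_ge0 ?(ltW s0) //.
by rewrite ler_pdivrMl // mulr1 lerDl ltW.
Qed.

Section Multiplicative.
Variables (nu : A -> R) (mu : (X -> R[i]^o) -> R).
Hypotheses (xnu : extreme_dominated setT r nu).
Hypotheses (dmu : dominated B (@supnorm R X) mu) (muE : forall h, mu (gelfand h) = nu h).

Let mul v h : X -> R[i]^o := fun x => (v x : R)%:C * gelfand h x.

Let mul_bounded v h (K : R) : (forall x, `|v x| <= K) -> B (mul v h).
Proof.
move=> Hv; exists (K * r h) => x; rewrite cabsM cabsR.
by apply: ler_pM; rewrite ?cabs_ge0 ?gelfand_le_radius.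
Qed.

Let mulD v a b : mul v (a + b) = mul v a + mul v b.
Proof. by apply/funext => x; rewrite /mul gelfandD mulrDr. Qed.

Let mulZ v (t : R) a : mul v (t%:C *: a) = t%:C *: mul v a.
Proof. by apply/funext => x; rewrite /mul gelfandZ /= mulrCA. Qed.

(* Multiplication by [v] splits [mu] into two parts whose norms on [A] add up to
   at most 1, so both are proportional to the extreme functional [nu]. *)
Let extension_mul01 v : (forall x, 0 <= v x <= 1) ->
  exists a : R, forall h, mu (mul v h) = a * nu h.
Proof.
move=> v01; have [muD muZ] := dmu.1; have [nuD nuZ] := xnu.1.1.
have Bv h : B (mul v h).
  by apply: (@mul_bounded _ _ 1) => x; have /andP[? ?] := v01 x; rewrite ger0_norm.
pose l h := mu (mul v h); pose l' h := nu h - l h.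
have llin : real_linear setT l.
  by split=> [a b _ _|t a _]; rewrite /l ?mulD ?mulZ ?muD ?muZ.
have llin' : real_linear setT l'.
  have [lD lZ] := llin.
  by split=> [a b _ _|t a _]; rewrite /l' ?lD ?lZ ?nuD ?nuZ //; ring.
have [m _] := @max_ideal_space_inhabited R A.
(* [l a + l' b] is [mu] of the pointwise convex combination of [a] and [b] with weights [v] and
   [1 - v], of modulus at most 1. *)
have key a b : r a <= 1 -> r b <= 1 -> l a + l' b <= 1.
  move=> ra rb; rewrite /l' /l addrCA -muE.
  have -> : mu (mul v a) - mu (mul v b) = mu (mul v (a - b)).
    by rewrite -[RHS]/(l (a - b)) llin.1 // (real_linearN llin).
  rewrite -muD //; last exact: gelfand_bounded.
  apply: le_trans (dmu.2 _ _) _.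
    by case: (bounded_subspace (R := R) (X := X)) => _ h _; apply: h => //; exact: gelfand_bounded.
  apply: (supnorm_le m) => x.
  rewrite (_ : (gelfand b + _) x = gelfand b x + (v x)%:C * gelfand (a - b) x) // gelfandB.
  have /andP[v0 v1] := v01 x.
  have -> : gelfand b x + (v x)%:C * (gelfand a x - gelfand b x) =
      (v x)%:C * gelfand a x + (1 - v x)%:C * gelfand b x.
    by rewrite rmorphB rmorph1; ring.
  apply: le_trans (cabsD _ _) _; rewrite !cabsM !cabsR ger0_norm // ger0_norm ?subr_ge0 //.
  have := le_trans (gelfand_le_radius a x) ra; have := le_trans (gelfand_le_radius b x) rb.
  have := cabs_ge0 (gelfand a x); have := cabs_ge0 (gelfand b x); nra.
pose a := sup [set l h | h in [set h | r h <= 1]].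
have l0 : l 0 = 0.
  by have [_ lZ] := llin; have := lZ 0 0 I; rewrite scaler0 mul0r.
have l'0 : l' 0 = 0.
  by have [_ lZ] := llin'; have := lZ 0 0 I; rewrite scaler0 mul0r.
have r0 : r 0 <= 1 by rewrite sradius0.
have hs : has_sup [set l h | h in [set h | r h <= 1]].
  split; first by exists (l 0), 0.
  by exists 1 => _ [h /= rh <-]; have := key h 0 rh r0; rewrite l'0 addr0.
have la h : r h <= 1 -> l h <= a by move=> rh; apply: sup_upper_bound => //; exists h.
have la' h : r h <= 1 -> l' h <= 1 - a.
  move=> rh; rewrite lerBrDr -lerBrDl; apply: ge_sup; first by case: hs.
  by move=> _ [g /= rg <-]; have := key g h rg rh; lra.
have a0 : 0 <= a by rewrite -l0 la.
have a1 : 0 <= 1 - a by rewrite -l'0 la'.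
have dl h : l h <= a * r h by apply: sradius_dominated_scale.
have dl' h : l' h <= (1 - a) * r h by apply: sradius_dominated_scale.
have zero k : real_linear setT k -> (forall h, k h <= 0) -> forall h, k h = 0.
  move=> klin kle h; apply/eqP; rewrite eq_le kle /=.
  by have := kle (- h); rewrite (real_linearN klin) // oppr_le0.
(* Extremality needs weights strictly between 0 and 1. At either end one of the two parts is
   nonpositive everywhere, hence zero. *)
have [an0|an0] := eqVneq a 0.
  exists 0 => h; rewrite mul0r; apply: (zero l) => // g.
  by have := dl g; rewrite an0 mul0r.
have [an1|an1] := eqVneq (1 - a) 0.
  exists 1 => h; rewrite mul1r; apply/eqP; rewrite eq_sym -subr_eq0; apply/eqP.
  by apply: (zero l') => // g; have := dl' g; rewrite an1 mul0r.
have ap : 0 < a by rewrite lt_neqAle eq_sym an0.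
have ap' : 0 < 1 - a by rewrite lt_neqAle eq_sym an1.
have domscale k c : 0 < c -> real_linear setT k -> (forall h, k h <= c * r h) ->
    dominated setT r (fun h => c^-1 * k h).
  move=> c0 [kD kZ] H; split; first split=> [g h _ _|t h _].
  - by rewrite kD // mulrDr.
  - by rewrite kZ //; ring.
  by move=> h _; rewrite ler_pdivrMl.
exists a => h.
have a01 : 0 < a < 1 by rewrite ap; lra.
have := xnu.2 _ _ a (domscale l a ap llin dl) (domscale l' _ ap' llin' dl') a01 _ h I.
move=> <-; first by rewrite mulrA divff // mul1r.
by move=> g _; rewrite !mulrA !divff // !mul1r /l' addrC subrK.
Qed.

Lemma extension_mul v (K : R) : (forall x, `|v x| <= K) ->
  exists a : R, forall h, mu (fun x => (v x)%:C * gelfand h x) = a * nu h.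
Proof.
move=> Hv; have [muD muZ] := dmu.1.
have [m _] := @max_ideal_space_inhabited R A.
have K0 : 0 <= K := le_trans (normr_ge0 _) (Hv m).
(* An affine change of [v] into [[0, 1]]; [K + 1] instead of [K] keeps [L] positive when [K = 0]. *)
pose L := 2 * (K + 1); have L0 : 0 < L by rewrite mulr_gt0 // ltr_wpDl.
pose w x := (v x + (K + 1)) / L.
have w01 x : 0 <= w x <= 1.
  have := Hv x; rewrite ler_norml => /andP[? ?].
  by rewrite /w divr_ge0 ?ler_pdivrMr //= ?mul1r ?(ltW L0) // /L; lra.
have [a Ha] := extension_mul01 w01.
exists (L * a - (K + 1)) => h.
have Bw g : B (mul w g).
  by apply: (@mul_bounded _ _ 1) => x; have /andP[? ?] := w01 x; rewrite ger0_norm.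
have -> : (fun x => (v x)%:C * gelfand h x) =
    mul w (L%:C *: h) + gelfand ((- (K + 1))%:C *: h).
  apply/funext => x; rewrite (_ : (_ + _) x = (w x)%:C * gelfand (L%:C *: h) x +
    gelfand ((- (K + 1))%:C *: h) x) // !gelfandZ mulrA -rmorphM /= -mulrDl -rmorphD /=.
  by congr ((_)%:C * _); rewrite /w divfK ?gt_eqF //; ring.
rewrite muD //; last exact: gelfand_bounded.
by rewrite Ha muE; have [_ nuZ] := xnu.1.1; rewrite !nuZ //; ring.
Qed.

End Multiplicative.

Lemma eval_dominated (c : R[i]) m : cabs c <= 1 ->
  dominated setT r (fun h => Re (c * gelfand h m)).
Proof.
move=> c1; split; first split=> [g h _ _|t h _].
- by rewrite gelfandD mulrDr Re_add.
- by rewrite gelfandZ mulrCA Re_rmul.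
move=> h _; apply: le_trans (Re_cabs _) _; rewrite cabsM.
apply: le_trans (gelfand_le_radius h m); exact: ler_piMl (cabs_ge0 _) c1.
Qed.

(** Split [k] into real and imaginary parts: inside [mu], multiplication by either acts on [nu] as a
    scalar. Hence the complex-linear [L] with real part [nu] satisfies [L (k * h) = chi k * L h].
    Then [chi] is a character, and [L h] is [L 1] times the value of [h] at it. *)
Lemma extreme_dominated_eval nu : extreme_dominated setT r nu ->
  exists c m, cabs c = 1 /\ forall h, nu h = Re (c * gelfand h m).
Proof.
move=> xnu; have [[nuD nuZ] nur] := xnu.1.
have [mu dmu muE] := dominated_extends xnu.1; have [muD muZ] := dmu.1.
have [m0 _] := @max_ideal_space_inhabited R A.
have key k : exists a : R[i], forall h, nu (k * h) = Re a * nu h + Im a * nu ('i *: h).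
  have rk x : `|Re (gelfand k x)| <= r k.
    exact: le_trans (Re_le_cabs _) (gelfand_le_radius k x).
  have ik x : `|Im (gelfand k x)| <= r k.
    exact: le_trans (Im_le_cabs _) (gelfand_le_radius k x).
  have [a Ha] := extension_mul xnu dmu muE rk.
  have [b Hb] := extension_mul xnu dmu muE ik.
  exists (a +i* b) => h; rewrite -Ha -Hb -muE -muD.
  - congr mu; apply/funext => x; rewrite (_ : (_ + _) x =
      (Re (gelfand k x))%:C * gelfand h x + (Im (gelfand k x))%:C * gelfand ('i *: h) x) //.
    by rewrite gelfandM gelfandZ mulc_ReIm.
  - exists (r k * r h) => x; rewrite cabsM cabsR.
    by apply: ler_pM; rewrite ?cabs_ge0 ?gelfand_le_radius.
  - exists (r k * r ('i *: h)) => x; rewrite cabsM cabsR.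
    by apply: ler_pM; rewrite ?cabs_ge0 ?gelfand_le_radius.
have [chi chiP] := choice key.
have [L LRe LIm] : exists2 L : A -> R[i], (forall h, Re (L h) = nu h) &
    (forall h, Im (L h) = - nu ('i *: h)).
  by exists (fun h => nu h +i* (- nu ('i *: h))).
have LD g h : L (g + h) = L g + L h.
  by apply: complexP; rewrite !ReImE ?LRe ?LIm ?scalerDr nuD // opprD.
have iiN h : 'i *: ('i *: h) = - h :> A.
  by rewrite scalerA -expr2 sqr_i scaleN1r.
have nuN h : nu (- h) = - nu h := real_linearN xnu.1.1 I.
have LM k h : L (k * h) = chi k * L h.
  apply: complexP; rewrite !ReImE !LRe !LIm; first by rewrite chiP; ring.
  by rewrite scalerAr chiP iiN nuN; ring.
have LZ a h : L (a *: h) = a * L h.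
  have nuC g : nu (a *: g) = Re a * nu g + Im a * nu ('i *: g).
    rewrite {1}[a]complexE scalerDl nuD // -nuZ // -nuZ // scalerA.
    by rewrite [_ * 'i]mulrC.
  apply: complexP; rewrite !ReImE !LRe !LIm; first by rewrite nuC; ring.
  by rewrite scalerA mulrC -scalerA nuC iiN nuN; ring.
have half01 : 0 < (2^-1 : R) < 1 by lra.
(* The zero functional is not extreme, being the midpoint of an evaluation and its opposite. *)
have [h0 Lh0] : exists h0, L h0 != 0.
  apply: contrapT => H.
  have nu0 h : nu h = 0.
    apply: contrapT => /eqP h0; apply: H; exists h.
    by apply: contraNN h0 => /eqP/(congr1 (@complex.Re R)); rewrite LRe => ->.
  have c1 : cabs (1 : R[i]) <= 1 by rewrite cabs1.
  have cN1 : cabs (-1 : R[i]) <= 1 by rewrite cabsN cabs1.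
  suff : Re (1 * gelfand 1 m0) = nu 1.
    by rewrite nu0 gelfand1 mulr1 => /eqP; rewrite oner_eq0.
  apply: (xnu.2 _ _ _ (eval_dominated m0 c1) (eval_dominated m0 cN1) half01 _ 1 I) => h _.
  by rewrite nu0 mul1r mulN1r Re_opp; lra.
have chiA : @characters R A chi.
  split.
  - exists 1; apply/eqP => chi1; have := LM 1 h0; rewrite mul1r chi1 mul0r => /eqP.
    by rewrite (negPf Lh0).
  - move=> a f g; apply: (mulIf Lh0).
    by rewrite -LM mulrDl mulrDl -mulrA -!LM -LZ scalerAl LD.
  - by move=> f g; apply: (mulIf Lh0); rewrite -mulrA -!LM mulrA.
pose m : X := SigSub (mem_set chiA).
have nuL h : nu h = Re (L 1 * gelfand h m).
  have -> : gelfand h m = chi h by [].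
  by rewrite mulrC -LM mulr1.
exists (L 1), m; split => //; apply/eqP; rewrite eq_le; apply/andP; split.
  have [d [d1 dL]] := phase (L 1).
  have := nur d%:A I; rewrite sradiusA d1 nuL gelfandA mulrC dL //.
rewrite leNgt; apply/negP => L1.
(* If [cabs (L 1) < 1], then [nu] is the midpoint of the functionals with coefficients [L 1 + e] and
   [L 1 - e], still dominated by [r]. *)
pose e := 1 - cabs (L 1); have e0 : 0 < e by rewrite subr_gt0.
have c1 : cabs (L 1 + e%:C) <= 1.
  by apply: le_trans (cabsD _ _) _; rewrite cabsR gtr0_norm // /e; lra.
have c2 : cabs (L 1 - e%:C) <= 1.
  by apply: le_trans (cabsB _ _) _; rewrite cabsR gtr0_norm // /e; lra.
suff : Re ((L 1 + e%:C) * gelfand 1 m) = nu 1.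
  by rewrite nuL gelfand1 !mulr1 Re_add Re_real; lra.
apply: (xnu.2 _ _ _ (eval_dominated m c1) (eval_dominated m c2) half01 _ 1 I) => h _.
by rewrite nuL mulrDl [(L 1 - _) * _]mulrBl !Re_add Re_opp; lra.
Qed.

Lemma extreme_dominated_attains f : exists2 nu, extreme_dominated setT r nu & nu f = r f.
Proof.
exact: (extreme_dominated_exists setT_subspace sradius_sublinear).
Qed.

End ExtremeFunctionals.

(** * The Choquet boundary *)

Section ChoquetBoundary.
Context {R : realType} {A : comBanachAlgType R[i]}.
Implicit Types (f g h : A) (m : max_ideal_space A) (F G : max_ideal_space A -> R[i]).
Local Notation r := (@spectral_radius R A).
Local Notation X := (max_ideal_space A).
Local Notation B := (@bounded_functions R X).

Lemma clP F : cl A F <->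
  forall e : R, 0 < e -> exists h, forall m, cabs (F m - gelfand h m) <= e.
Proof.
split=> [clF e e0|H U].
  have eC0 : 0 < e%:C by rewrite ltcR.
  have [_ [[h _ <-] H]] : range (@gelfand R A) `&`
      [set u | forall x, setT x -> ball (F x : R[i]^o) e%:C (u x)] !=set0.
    apply: clF; apply/uniform_nbhs.
    exists [set xy : R[i]^o * R[i]^o | ball xy.1 e%:C xy.2]; split => //.
    by have := @entourage_ball R[i] (R[i]^o) (PosNum eC0).
  exists h => m; have := H m I; rewrite -ball_normE /= normC_cabs ltcR => /ltW.
  by [].
move=> /uniform_nbhs[E [+ sub]]; rewrite -entourage_ballE => -[e /= e0 He].
have /andP[/eqP e_im e_re] : (Im e == Im 0) && (Re 0 < Re e) by rewrite -ltcE.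
have e20 : 0 < Re e / 2 by rewrite divr_gt0.
have [h Hh] := H _ e20; exists (gelfand h); split; first by exists h.
apply: sub => x _; apply: He; rewrite /= -ball_normE /= normC_cabs ltcE /= e_im eqxx /=.
by apply: le_lt_trans (Hh x) _; rewrite ltr_pdivrMr // ltr_pMr // ltr1n.
Qed.

Lemma gelfand_cl h : cl A (gelfand h).
Proof. by apply/clP => e e0; exists h => m; rewrite subrr cabs0 ltW. Qed.

Lemma cl_bounded F : cl A F -> B F.
Proof.
move=> /clP/(_ 1 ltr01)[h Hh]; exists (1 + r h) => m.
rewrite -[F m](subrK (gelfand h m : R[i])); apply: le_trans (cabsD _ _) _.
by apply: lerD => //; exact: gelfand_le_radius.
Qed.

Lemma cl_lin (a : R[i]) h F : cl A F -> cl A (fun x => a * gelfand h x + F x).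
Proof.
move=> /clP clF; apply/clP => e /clF[g Hg]; exists (a *: h + g) => m.
by rewrite gelfandD gelfandZ opprD addrACA subrr add0r.
Qed.

Section States.
Variable L : (X -> R[i]) -> R[i].
Hypothesis stL : is_state (@cl R A) L.

Lemma state_gelfand_lin (a : R[i]) f g :
  L (gelfand (a *: f + g)) = a * L (gelfand f) + L (gelfand g).
Proof.
case: stL => Llin _ _; rewrite -Llin; [|exact: gelfand_cl|exact: gelfand_cl].
by congr L; apply/funext => x; rewrite gelfandD gelfandZ.
Qed.

Lemma state_gelfandZ (a : R[i]) f : L (gelfand (a *: f)) = a * L (gelfand f).
Proof.
have L0 : L (gelfand 0) = 0.
  apply: (addrI (L (gelfand 0))); have := state_gelfand_lin 1 0 0.
  by rewrite scale1r addr0 mul1r => <-; rewrite addr0.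
by have := state_gelfand_lin a f 0; rewrite addr0 L0 addr0.
Qed.

Lemma state_near F h e : cl A F -> (forall m, cabs (F m - gelfand h m) <= e) ->
  cabs (L F - L (gelfand h)) <= e.
Proof.
move=> clF Hh; have [m _] := @max_ideal_space_inhabited R A.
case: stL => Llin _ Lle.
have -> : L F - L (gelfand h) = L (fun x => -1 * gelfand h x + F x).
  by rewrite Llin //; [ring | exact: gelfand_cl].
apply: le_trans (Lle _ _) _; first exact: cl_lin.
apply: (supnorm_le m) => x.
by rewrite mulN1r addrC.
Qed.

Lemma state_dominated (c : R[i]) : cabs c <= 1 ->
  dominated setT r (fun h => Re (c * L (gelfand h))).
Proof.
move=> c1; split; first split=> [f g _ _|t f _].
- by have := state_gelfand_lin 1 f g; rewrite scale1r mul1r => ->; rewrite mulrDr Re_add.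
- by rewrite state_gelfandZ mulrCA Re_rmul.
move=> h _; apply: le_trans (Re_cabs _) _; rewrite cabsM.
case: stL => _ _ Lle; have := Lle _ (@gelfand_cl h); rewrite supnorm_gelfand.
by move=> le; apply: le_trans le; exact: ler_piMl (cabs_ge0 _) c1.
Qed.

End States.

Lemma eval_state m : is_state (@cl R A) (fun F => F m).
Proof.
by split=> // F /cl_bounded BF; exact: cabs_le_supnorm.
Qed.

(** Imaginary parts are recovered by testing on ['i *: h], and the rest of [cl A] by density and
    [state_near]. *)
Lemma eq_states L1 L2 : is_state (@cl R A) L1 -> is_state (@cl R A) L2 ->
  (forall h, Re (L1 (gelfand h)) = Re (L2 (gelfand h))) ->
  forall F, cl A F -> L1 F = L2 F.
Proof.
move=> st1 st2 H F clF.
have E h : L1 (gelfand h) = L2 (gelfand h).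
  apply: complexP => //; have := H ('i *: h).
  by rewrite !state_gelfandZ // !ReImE !mul0r !sub0r !mul1r => /oppr_inj.
apply: (@cabs_eps _ _ _ 2) => e e0; have [h Hh] := (clP F).1 clF e e0.
have := state_near st1 clF Hh; have := state_near st2 clF Hh; rewrite -E.
have := cabs_distD (L1 F) (L1 (gelfand h)) (L2 F).
by rewrite (cabs_distC (L1 (gelfand h))); lra.
Qed.

(** States splitting the evaluation at [m], once multiplied by [c] and reduced to real parts on [A],
    split the given functional; [eq_states] leads back to [cl A]. *)
Lemma extreme_Ch (c : R[i]) m : cabs c = 1 ->
  extreme_dominated setT r (fun h => Re (c * gelfand h m)) -> Ch A m.
Proof.
move=> c1 [_ xt]; split; first exact: eval_state.
have cle1 : cabs c <= 1 by rewrite c1.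
have key L1 L2 t : is_state (@cl R A) L1 -> is_state (@cl R A) L2 -> 0 < t < 1 ->
    (forall F, cl A F -> F m = t%:C * L1 F + (1 - t)%:C * L2 F) ->
    forall F, cl A F -> L1 F = F m.
  move=> st1 st2 t01 H.
  have Hc h : Re (c * L1 (gelfand h)) = Re (c * gelfand h m).
    apply: (xt _ _ _ (state_dominated st1 cle1) (state_dominated st2 cle1) t01 _ h I).
    by move=> g _; rewrite (H _ (@gelfand_cl g)) mulrDr !(mulrCA c) Re_add !Re_rmul.
  apply: (eq_states st1 (eval_state m)) => h.
  have := Hc (c^-1 *: h); rewrite state_gelfandZ // gelfandZ !mulrA divff ?mul1r //.
  by rewrite -cabs_eq0 c1 oner_eq0.
move=> L1 L2 t st1 st2 /andP[t0 t1] H F clF; split.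
  by apply: (key L1 L2 t) => //; rewrite t0.
apply: (key L2 L1 (1 - t)) => //; first by apply/andP; split; lra.
by move=> G /H ->; rewrite opprB addrCA subrr addr0 addrC.
Qed.

(** A complex-linear functional is recovered from its real part [mu] by this formula. *)
Definition complexification (mu : (X -> R[i]^o) -> R) (F : X -> R[i]) : R[i] :=
  mu F +i* (- mu (fun x => 'i * F x)).

Lemma Re_complexification mu F : Re (complexification mu F) = mu F.
Proof. by []. Qed.

Lemma Im_complexification mu F :
  Im (complexification mu F) = - mu (fun x => 'i * F x).
Proof. by []. Qed.

Section Complexification.
Variable mu : (X -> R[i]^o) -> R.
Hypothesis dmu : dominated B (@supnorm R X) mu.

Lemma bounded_scale (a : R[i]) F : B F -> B (fun x => a * F x).
Proof. by case: (@bounded_subspace R X) => _ _ h; exact: h. Qed.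

Lemma bounded_zero : B (fun=> 0).
Proof. by case: (@bounded_subspace R X). Qed.

Lemma dominated_zero : mu (fun=> 0) = 0.
Proof.
have := real_linearN dmu.1 bounded_zero.
by rewrite (_ : - _ = (fun=> 0 : R[i]^o)); [lra | apply/funext => x; exact: oppr0].
Qed.

Lemma complexification_lin (a : R[i]) F G : B F -> B G ->
  complexification mu (fun x => a * F x + G x) =
  a * complexification mu F + complexification mu G.
Proof.
move=> BF BG; have [muD muZ] := dmu.1.
have mulin b H K : B H -> B K -> mu (fun x => b * H x + K x) =
    Re b * mu H + Im b * mu (fun x => 'i * H x) + mu K.
  have [_ BD BZ] := @bounded_subspace R X.
  move=> BH BK; have BiH : B (fun x => 'i * H x) := bounded_scale _ BH.
  rewrite -muZ // -[Im b * _]muZ // -muD; [|exact: BZ|exact: BZ].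
  rewrite -muD //; last by apply: BD; exact: BZ.
  congr mu; apply/funext => x.
  rewrite (_ : (_ + _) x = (Re b)%:C * H x + (Im b)%:C * ('i * H x) + K x) //.
  by rewrite -mulc_ReIm.
apply: complexP; rewrite !(Re_complexification, Im_complexification, Re_add, Im_add, Re_mul, Im_mul).
  by rewrite mulin //; ring.
have -> : (fun x => 'i * (a * F x + G x)) =
    (fun x => a * ('i * F x) + 'i * G x) by apply/funext => x; ring.
rewrite mulin; [|exact: bounded_scale..].
have -> : (fun x => 'i * ('i * F x)) = (fun x => -1 * F x + 0).
  by apply/funext => x; rewrite mulrA -expr2 sqr_i addr0.
rewrite mulin //; last exact: bounded_zero.
by rewrite dominated_zero !ReImE; ring.
Qed.

Lemma complexificationZ (a : R[i]) F : B F ->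
  complexification mu (fun x => a * F x) = a * complexification mu F.
Proof.
move=> BF; have c0 : complexification mu (fun=> 0) = 0.
  apply: complexP; rewrite (Re_complexification, Im_complexification) ?dominated_zero //.
  by rewrite (_ : (fun x => _) = (fun=> 0)) ?dominated_zero ?oppr0 //; apply/funext => x; exact: mulr0.
have := complexification_lin a BF bounded_zero; rewrite c0 addr0 => <-.
by congr complexification; apply/funext => x; rewrite addr0.
Qed.

Lemma complexification_le F : B F -> cabs (complexification mu F) <= supnorm F.
Proof.
move=> BF; have [m _] := @max_ideal_space_inhabited R A.
have [d [d1 dE]] := phase (complexification mu F).
rewrite -[leLHS]/(Re (cabs (complexification mu F))%:C) -dE -complexificationZ //.
apply: le_trans (dmu.2 _ (bounded_scale _ BF)) _; apply: (supnorm_le m) => x.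
by rewrite cabsM d1 mul1r; exact: cabs_le_supnorm.
Qed.

End Complexification.

(** Functionals [s1] and [s2] that split the rotated evaluation become states of [cl A] after
    extension, complexification and multiplication by the conjugate of [c]; extremality among states
    then applies. *)
Lemma Ch_extreme (c : R[i]) m : cabs c = 1 -> Ch A m ->
  extreme_dominated setT r (fun h => Re (c * gelfand h m)).
Proof.
move=> c1 [_ xt]; split; first by apply: eval_dominated; rewrite c1.
move=> s1 s2 t d1 d2 t01 H g _; have /andP[t0 t1] := t01.
have [mu1 dmu1 mu1E] := dominated_extends d1; have [mu2 dmu2 mu2E] := dominated_extends d2.
have cJ : c * c^* = 1 by rewrite mulc_conj_sqr c1 expr1n.
have Bh h : B (gelfand h) := gelfand_bounded h.
have rc : r (c^*)%:A = 1 by rewrite sradiusA cabsJ c1.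
(* At this constant the convex combination of [s1] and [s2] equals 1 while each is at most 1, so
   both equal 1. This supplies the normalization required of a state. *)
have one : s1 (c^*)%:A = 1 /\ s2 (c^*)%:A = 1.
  have := H (c^*)%:A I; rewrite gelfandA cJ Re_one.
  have := d1.2 (c^*)%:A I; have := d2.2 (c^*)%:A I; rewrite rc => h2 h1 h.
  by split; apply/eqP; rewrite eq_le ?h1 ?h2 /=; nra.
pose st mu := fun F => c^* * complexification mu F.
have stE mu s h : dominated B (@supnorm R X) mu -> (forall h, mu (gelfand h) = s h) ->
    Re (st mu (gelfand h)) = s (c^* *: h).
  move=> dmu muE; rewrite /st -complexificationZ // /= -muE; congr mu.
  by apply/funext => x; rewrite gelfandZ.
have state mu s : dominated B (@supnorm R X) mu -> (forall h, mu (gelfand h) = s h) ->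
    s (c^*)%:A = 1 -> is_state (@cl R A) (st mu).
  move=> dmu muE s1E.
  have le F : B F -> cabs (st mu F) <= supnorm F.
    by move=> BF; rewrite /st cabsM cabsJ c1 mul1r; exact: complexification_le.
  have E1 : (fun=> 1) = gelfand (1 : A) by apply/funext => x; rewrite gelfand1.
  split; last by move=> F /cl_bounded; exact: le.
    by move=> a F G /cl_bounded BF /cl_bounded BG; rewrite /st complexification_lin //; ring.
  have Re1 : Re (st mu (fun=> 1)) = 1 by rewrite E1 (stE _ s).
  apply: complexP => //; apply/eqP; rewrite -sqrf_eq0 eq_le sqr_ge0 andbT.
  have := le (fun=> 1); rewrite [in supnorm _]E1 supnorm_gelfand sradius1.
  have B1 : B (fun=> 1) by rewrite E1.
  move=> /(_ B1) h; have := cabs_sqr (st mu (fun=> 1)); rewrite Re1.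
  have := cabs_ge0 (st mu (fun=> 1)); nra.
have st1 := state _ _ dmu1 mu1E one.1; have st2 := state _ _ dmu2 mu2E one.2.
have comb F : cl A F -> F m = t%:C * st mu1 F + (1 - t)%:C * st mu2 F.
  apply: (@eq_states (fun F => F m)
    (fun F => t%:C * st mu1 F + (1 - t)%:C * st mu2 F)); first exact: eval_state.
    case: st1 => lin1 one1 le1; case: st2 => lin2 one2 le2; split.
    - by move=> a F' G clF clG; rewrite lin1 // lin2 //; ring.
    - by rewrite one1 one2 rmorphB rmorph1; ring.
    - move=> F' clF; apply: le_trans (cabsD _ _) _.
      rewrite (cabsM t%:C) (cabsM (1 - t)%:C) !cabsR gtr0_norm // gtr0_norm ?subr_gt0 //.
      have t1' : 0 <= 1 - t by rewrite subr_ge0 ltW.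
      have := ler_wpM2l (ltW t0) (le1 _ clF); have := ler_wpM2l t1' (le2 _ clF); lra.
  move=> h; rewrite Re_add !Re_rmul (stE _ s1) // (stE _ s2) // -H //.
  by rewrite gelfandZ mulrA cJ mul1r.
have [E _] := xt _ _ t st1 st2 t01 comb _ (@gelfand_cl (c *: g)).
have := congr1 (@complex.Re R) E; rewrite (stE _ s1) // scalerA mulrC cJ scale1r => ->.
by rewrite gelfandZ.
Qed.

(** An extreme functional attaining [r f] is a rotated evaluation, and its point lies in the Choquet
    boundary by [extreme_Ch]. *)
Theorem Ch_boundary f : exists2 m, Ch A m & cabs (gelfand f m) = r f.
Proof.
have [nu xnu nuf] := extreme_dominated_attains f.
have [c [m [c1 nuE]]] := extreme_dominated_eval xnu.
exists m.
  by apply: (extreme_Ch c1); rewrite (_ : (fun h => _) = nu) //; apply/funext => h; rewrite nuE.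
apply/eqP; rewrite eq_le gelfand_le_radius -nuf nuE.
by apply: le_trans (Re_cabs _) _; rewrite cabsM c1 mul1r.
Qed.

(* A Hahn-Banach extension [mu] of the evaluation at [m] annihilates
   [|k| ^ 2] by [extension_mul], hence also the indicator of [d <= |k|]. *)
Lemma Ch_peak m k (d e : R) : Ch A m -> gelfand k m = 0 -> 0 < d -> 0 < e ->
  exists h, [/\ forall x, 0 <= Re (gelfand h x), Re (gelfand h m) <= e &
    forall x, d <= cabs (gelfand k x) -> 1 <= Re (gelfand h x)].
Proof.
move=> Chm km d0 e0.
have c1 : cabs (1 : R[i]) = 1 by exact: cabs1.
pose nu h := Re (1 * gelfand h m).
have xnu : extreme_dominated setT r nu := Ch_extreme c1 Chm.
have nup h : nu h <= supRe (gelfand h).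
  by rewrite /nu mul1r; apply: Re_le_supRe; exact: gelfand_bounded.
pose u0 : X -> R[i]^o := fun x => (if d <= cabs (gelfand k x) then 1 else 0 : R)%:C.
have Bu0 : B u0.
  by exists 1 => x; rewrite cabsR; case: ifP; rewrite ?normr1 ?normr0.
have [mu [dmu muE muinf]] := hahn_banach_minimal bounded_subspace (supRe_sublinear m)
  gelfand_morphD (fun t => gelfand_morphZ t%:C) gelfand_bounded xnu.1.1 nup Bu0.
have dmu' : dominated B (@supnorm R X) mu.
  split; first exact: dmu.1.
  move=> u Bu; apply: le_trans (dmu.2 u Bu) _; apply: (supRe_le m) => x.
  by apply: le_trans (Re_cabs _) _; exact: cabs_le_supnorm.
have rk x : `|Re (gelfand k x)| <= r k.
  exact: le_trans (Re_le_cabs _) (gelfand_le_radius k x).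
have ik x : `|Im (gelfand k x)| <= r k.
  exact: le_trans (Im_le_cabs _) (gelfand_le_radius k x).
have [a Ha] := extension_mul xnu dmu' muE rk.
have [b Hb] := extension_mul xnu dmu' muE ik.
(* [g1 + g2] is the square of the modulus of [k], written with the elements [k] and [- 'i *: k],
   both zero at [m], times bounded real functions, as [extension_mul] requires. *)
pose g1 : X -> R[i]^o := fun x => (Re (gelfand k x))%:C * gelfand k x.
pose g2 : X -> R[i]^o := fun x => (Im (gelfand k x))%:C * gelfand (- 'i%C *: k) x.
have Bg1 : B g1.
  by exists (r k * r k) => x; rewrite cabsM cabsR; apply: ler_pM; rewrite ?cabs_ge0 ?gelfand_le_radius.
have Bg2 : B g2.
  exists (r k * r (- 'i%C *: k)) => x; rewrite cabsM cabsR.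
  by apply: ler_pM; rewrite ?cabs_ge0 ?gelfand_le_radius.
have mug1 : mu g1 = 0 by rewrite Ha /nu km mulr0 mulr0.
have mug2 : mu g2 = 0 by rewrite Hb /nu gelfandZ km !mulr0.
have [_ BD BZ] := @bounded_subspace R X.
have [muD muZ] := dmu.1.
pose s := (- (d ^+ 2)^-1)%:C.
have Bs : B (s *: (g1 + g2)) by apply: BZ; exact: BD.
(* Pointwise [u0] is at most the squared modulus of [k] divided by [d ^+ 2], on which [mu] vanishes;
   positivity of [mu] concludes. *)
have mu_u0 : mu u0 <= 0.
  have : mu (u0 + s *: (g1 + g2)) <= 0.
    apply: le_trans (dmu.2 _ (BD _ _ Bu0 Bs)) _; apply: (supRe_le m) => x.
    rewrite (_ : (u0 + _) x = u0 x + s * (g1 x + g2 x)) // Re_add Re_rmul Re_add !Re_rmul gelfandZ.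
    have ReNi (z : R[i]) : Re (- 'i%C * z) = Im z.
      by case: z => a1 b1 /=; ring.
    rewrite Re_real ReNi -!expr2 -cabs_sqr mulNr.
    have d2 : 0 < d ^+ 2 by rewrite exprn_gt0.
    case: ifP => [dk|_]; last by rewrite sub0r oppr_le0 mulr_ge0 ?invr_ge0 ?sqr_ge0.
    rewrite subr_le0 ler_pdivlMl // mulr1.
    by rewrite ler_sqr ?nnegrE ?cabs_ge0 // ltW.
  by rewrite muD // muZ ?muD // ?mug1 ?mug2 ?addr0 ?mulr0 ?addr0 //; exact: BD.
(* [mu] takes the largest possible value at [u0], so [mu u0 <= 0] yields an [h] whose shift by [t]
   has real part above [u0] and at most [e] at [m]. *)
have [h Hh] := muinf e e0.
have Bd : B (u0 - gelfand h).
  by apply: BD => //; rewrite -gelfand_morphN; exact: gelfand_bounded.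
pose t := supRe (u0 - gelfand h).
have tP x : Re (u0 x) <= Re (gelfand h x) + t.
  have := Re_le_supRe x Bd; rewrite (_ : (u0 - _) x = u0 x - gelfand h x) //.
  by rewrite Re_add Re_opp -/t; lra.
exists (h + t%:C%:A); split.
- move=> x; rewrite gelfandD gelfandA Re_add; apply: le_trans (tP x).
  by rewrite Re_real; case: ifP.
- rewrite gelfandD gelfandA Re_add.
  by have := Hh; rewrite /nu mul1r -/t => h1; apply: le_trans h1 _; rewrite gerDr.
- move=> x dk; rewrite gelfandD gelfandA Re_add; apply: le_trans (tP x).
  by rewrite Re_real dk.
Qed.

End ChoquetBoundary.

(** * The derivative at the identity *)

Section GeometricLimits.
Context {R : realType}.

Lemma half_exp_gt0 n : 0 < 2^-1 ^+ n :> R.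
Proof. by rewrite exprn_gt0 // invr_gt0. Qed.

Lemma half_exp_small (K e : R) : 0 < e -> exists n, forall j, (n <= j)%N -> K * 2^-1 ^+ j <= e.
Proof.
move=> e0; have K1 : 0 < `|K| + 1 by rewrite ltr_wpDl.
have h1 : (2^-1 : R) < 1 by lra.
have h0 : 0 <= (2^-1 : R) by lra.
have e1 : 0 < e / (`|K| + 1) by rewrite divr_gt0.
have [n Hn] := small_expr h0 h1 e1; exists n => j nj.
have Hj : 2^-1 ^+ j <= e / (`|K| + 1).
  by apply: le_trans Hn; apply: ler_wiXn2l => //; exact: ltW.
apply: le_trans (_ : (`|K| + 1) * 2^-1 ^+ j <= e); last by rewrite mulrC -ler_pdivlMr.
by rewrite ler_wpM2r ?(ltW (half_exp_gt0 _)) // (le_trans (ler_norm K)) // lerDl.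
Qed.

(** The intervals of centre [x j] and radius [2 * K * 2^-1 ^+ j] are nested; [l] is the supremum of
    their left ends. *)
Lemma geometric_real_limit (x : nat -> R) (K : R) n : 0 <= K ->
  (forall j, (n <= j)%N -> `|x j.+1 - x j| <= K * 2^-1 ^+ j) ->
  exists l, forall j, (n <= j)%N -> `|x j - l| <= 2 * K * 2^-1 ^+ j.
Proof.
move=> K0 H; pose lo j := x j - 2 * K * 2^-1 ^+ j; pose hi j := x j + 2 * K * 2^-1 ^+ j.
have mono k : lo n <= lo (n + k)%N /\ hi (n + k)%N <= hi n.
  elim: k => [|k [IH1 IH2]]; first by rewrite addn0.
  have := H (n + k)%N (leq_addr _ _); rewrite ler_norml => /andP[h1 h2].
  rewrite addnS; split.
    by apply: le_trans IH1 _; rewrite /lo exprS; lra.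
  by apply: le_trans IH2; rewrite /hi exprS; lra.
have mono2 i j : (n <= i)%N -> (i <= j)%N -> lo i <= lo j /\ hi j <= hi i.
  move=> ni ij; have -> : j = (i + (j - i))%N by rewrite subnKC.
  move: (j - i)%N => k; elim: k => [|k [IH1 IH2]]; first by rewrite addn0.
  have := H (i + k)%N (leq_trans ni (leq_addr _ _)); rewrite ler_norml => /andP[h1 h2].
  rewrite addnS; split.
    by apply: le_trans IH1 _; rewrite /lo exprS; lra.
  by apply: le_trans IH2; rewrite /hi exprS; lra.
have lohi i j : (n <= i)%N -> (n <= j)%N -> lo i <= hi j.
  move=> ni nj; have [h1 _] := mono2 i (maxn i j) ni (leq_maxl _ _).
  have [_ h2] := mono2 j (maxn i j) nj (leq_maxr _ _).
  apply: le_trans h1 _; apply: le_trans h2; rewrite /lo /hi.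
  have : 0 <= 2 * K * 2^-1 ^+ maxn i j.
    by rewrite !mulr_ge0 // ltW // half_exp_gt0.
  by lra.
pose S := [set lo j | j in [set j | (n <= j)%N]].
have hsup : has_sup S.
  split; first by exists (lo n), n => //=.
  by exists (hi n) => _ [j nj <-]; exact: lohi.
exists (sup S) => j nj; rewrite ler_distl.
have h1 : lo j <= sup S by apply: sup_upper_bound => //; exists j.
have h2 : sup S <= hi j.
  apply: ge_sup; first by case: hsup.
  by move=> _ [i ni <-]; exact: lohi.
by move: h1 h2; rewrite /lo /hi => h1 h2; apply/andP; split; lra.
Qed.

Lemma geometric_limit (z : nat -> R[i]) (K : R) n : 0 <= K ->
  (forall j, (n <= j)%N -> cabs (z j.+1 - z j) <= K * 2^-1 ^+ j) ->
  exists l, forall j, (n <= j)%N -> cabs (z j - l) <= 4 * K * 2^-1 ^+ j.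
Proof.
move=> K0 H.
have [|a Ha] := @geometric_real_limit (fun j => Re (z j)) K n K0.
  by move=> j nj; rewrite -Re_opp -Re_add; apply: le_trans (Re_le_cabs _) (H j nj).
have [|b Hb] := @geometric_real_limit (fun j => Im (z j)) K n K0.
  by move=> j nj; rewrite -Im_opp -Im_add; apply: le_trans (Im_le_cabs _) (H j nj).
exists (a +i* b) => j nj; apply: le_trans (cabs_le_ReIm _) _.
by rewrite Re_add Im_add Re_opp Im_opp /=; have := Ha j nj; have := Hb j nj; lra.
Qed.

End GeometricLimits.

Section AdditiveBounded.
Context {R : realType} {A : comBanachAlgType R[i]}.
Local Notation r := (@spectral_radius R A).

(** For [t >= 0] let [k] be the integer part of [t * N]. By additivity, [N] times the defect of
    homogeneity at [t] is the defect at [t * N - k], which lies in [[0, 1]]; so the defect at [t] is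
    at most [2 * r a / N]. *)
Lemma additive_bounded_real_linear (L : A -> R[i]) :
  {morph L : a b / a + b} -> (forall a, cabs (L a) <= r a) ->
  forall (t : R) a, L (t%:C *: a) = t%:C * L a.
Proof.
move=> LD Lr; have L0 : L 0 = 0 by apply: (addrI (L 0)); rewrite -LD !addr0.
have LN a : L (- a) = - L a.
  by apply/eqP; rewrite -addr_eq0 -LD addNr L0.
have Ln n a : L (n%:R%:C *: a) = n%:R%:C * L a.
  elim: n => [|n IH]; first by rewrite scale0r mul0r L0.
  by rewrite -natr1 rmorphD rmorph1 scalerDl LD IH !scale1r mulrDl mul1r.
have pos t a : 0 <= t -> L (t%:C *: a) = t%:C * L a.
  move=> t0; apply: (@cabs_eps _ _ _ (2 * r a)) => e e0.
  pose N := (Num.truncn e^-1).+1; pose k := Num.truncn (t * N%:R).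
  have N0 : 0 < N%:R :> R by rewrite ltr0n.
  have Ne : N%:R^-1 <= e.
    rewrite -[e]invrK lef_pV2 ?posrE ?invr_gt0 //; apply: ltW; exact: Num.Theory.truncnS_gt.
  have [k1 k2] : 0 <= t * N%:R - k%:R /\ t * N%:R - k%:R <= 1.
    have := @Num.Theory.truncn_itv R (t * N%:R) (mulr_ge0 t0 (ltW N0)).
    by rewrite -/k -natr1 => /andP[h1 h2]; split; lra.
  have E : N%:R%:C * (L (t%:C *: a) - t%:C * L a) =
      L ((t * N%:R - k%:R)%:C *: a) - (t * N%:R - k%:R)%:C * L a.
    have -> : L ((t * N%:R - k%:R)%:C *: a) = N%:R%:C * L (t%:C *: a) - k%:R%:C * L a.
      by rewrite rmorphB scalerBl LD LN Ln (mulrC t) rmorphM -scalerA Ln.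
    by rewrite rmorphB rmorphM /=; ring.
  have := congr1 (@cabs R) E; rewrite cabsM cabsR gtr0_norm // => E2.
  have B : N%:R * cabs (L (t%:C *: a) - t%:C * L a) <= 2 * r a.
    rewrite E2; apply: le_trans (cabsB _ _) _; rewrite cabsM cabsR ger0_norm //.
    have := Lr ((t * N%:R - k%:R)%:C *: a); rewrite sradiusZ cabsR ger0_norm //.
    have := ler_pM k1 (cabs_ge0 (L a)) k2 (Lr a).
    have := ler_wpM2r (sradius_ge0 a) k2; lra.
  rewrite -(ler_pM2l N0); apply: le_trans B _; rewrite mulrCA ler_peMr //.
    by rewrite mulr_ge0 // sradius_ge0.
  by rewrite -ler_pdivrMl ?mulr1.
move=> t a; have [|t0] := leP 0 t; first exact: pos.
rewrite -[t]opprK rmorphN scaleNr LN pos ?oppr_ge0 ?(ltW t0) //.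
by rewrite mulNr.
Qed.

End AdditiveBounded.

Lemma unit_morphism1 (A B : unitRingType) (T : A -> B) :
  {in GRing.unit &, {morph T : f g / f * g}} -> T 1 \is a GRing.unit -> T 1 = 1.
Proof.
move=> TM T1U; have T11 : T 1 * T 1 = T 1 * 1 by rewrite -TM ?unitr1 // !mulr1.
exact: mulrI T1U _ _ T11.
Qed.

Section Derivative.
Context {R : realType} {A : comBanachAlgType R[i]}.
Local Notation r := (@spectral_radius R A).
Variable tau : A -> R[i].
Hypothesis tauM : {in GRing.unit &, {morph tau : f g / f * g}}.
Hypothesis tau_le : forall f, f \is a GRing.unit -> cabs (tau f - 1) <= r (f - 1).

Lemma sradius_near1_unit (a : A) : r a <= 2^-1 -> 1 + a \is a GRing.unit.
Proof. by move=> ra; apply: unit_radius; rewrite addrAC subrr add0r; lra. Qed.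

Lemma tau_1 : tau 1 = 1.
Proof.
apply/eqP; rewrite -subr_eq0; apply/eqP/cabs_le0.
by have := tau_le (unitr1 _); rewrite subrr sradius0.
Qed.

Lemma tau_neq0 f : f \is a GRing.unit -> tau f != 0.
Proof.
move=> fU; apply/eqP => f0; have := @tauM f f^-1; rewrite unitrV => /(_ fU fU).
by rewrite divrr // tau_1 f0 mul0r => /eqP; rewrite oner_eq0.
Qed.

Lemma sradius_inv_le f : f \is a GRing.unit -> r (f - 1) <= 2^-1 -> r f^-1 <= 2.
Proof.
move=> fU h; apply: sradius_le => m; rewrite gelfandV // cabsV.
have fm := gelfand_unit_neq0 m fU.
rewrite -[leRHS]invrK lef_pV2 ?posrE ?invr_gt0 ?cabs_gt0 //.
have := le_trans (gelfand_le_radius (f - 1) m) h; rewrite gelfandB gelfand1 => h1.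
have := cabs_distD (gelfand f m : R[i]) 1 0; rewrite !subr0 cabs1.
have := cabs_distD 1 (gelfand f m : R[i]) 0; rewrite !subr0 cabs1 (cabs_distC 1); lra.
Qed.

(** The difference is [tau g * (tau (f / g) - 1)]; 3 is the product of the bound [3 / 2] on the
    modulus of [tau g] and the bound 2 on [r g^-1]. *)
Lemma tau_lip f g : f \is a GRing.unit -> r (g - 1) <= 2^-1 ->
  cabs (tau f - tau g) <= 3 * r (f - g).
Proof.
move=> fU hg; have gU : g \is a GRing.unit by apply: unit_radius; lra.
have gVU : g^-1 \is a GRing.unit by rewrite unitrV.
have E : tau f - tau g = tau g * (tau (f / g) - 1).
  by rewrite mulrBr mulr1 -tauM ?unitrM ?fU // mulrC divrK.
have E2 : f / g - 1 = (f - g) * g^-1 by rewrite mulrBl divrr.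
rewrite E cabsM.
have tg : cabs (tau g) <= 3 / 2.
  have := cabs_distD (tau g) 1 0; rewrite !subr0 cabs1.
  have := tau_le gU; lra.
have tfg := @tau_le (f / g); rewrite unitrM fU gVU E2 in tfg.
have := le_trans (tfg isT) (sradiusM _ _); have := sradius_inv_le gU hg => h1 h2.
apply: le_trans (ler_pM (cabs_ge0 _) (cabs_ge0 _) tg h2) _.
have := ler_wpM2l (sradius_ge0 (f - g)) h1; lra.
Qed.

(** [(1 + a) * (1 + b)] and [1 + (a + b)] differ by [a * b], which costs [3 * r (a * b)] by
    [tau_lip]; the product of the two increments costs [r a * r b] more. *)
Lemma tau_add a b : r a <= 4^-1 -> r b <= 4^-1 ->
  cabs (tau (1 + (a + b)) - 1 - (tau (1 + a) - 1) - (tau (1 + b) - 1)) <= 4 * (r a * r b).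
Proof.
move=> ra rb; have ua : 1 + a \is a GRing.unit by apply: sradius_near1_unit; lra.
have ub : 1 + b \is a GRing.unit by apply: sradius_near1_unit; lra.
have -> : tau (1 + (a + b)) - 1 - (tau (1 + a) - 1) - (tau (1 + b) - 1) =
    (tau (1 + a) - 1) * (tau (1 + b) - 1) - (tau ((1 + a) * (1 + b)) - tau (1 + (a + b))).
  by rewrite tauM //; ring.
apply: le_trans (cabsB _ _) _; rewrite cabsM.
have H1 : cabs (tau (1 + a) - 1) * cabs (tau (1 + b) - 1) <= r a * r b.
  apply: ler_pM; rewrite ?cabs_ge0 //.
    by have := tau_le ua; rewrite addrAC subrr add0r.
  by have := tau_le ub; rewrite addrAC subrr add0r.
have hab : r (1 + (a + b) - 1) <= 2^-1.
  by rewrite addrAC subrr add0r; have := sradiusD a b; lra.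
have := @tau_lip ((1 + a) * (1 + b)) _ _ hab; rewrite unitrM ua ub => /(_ isT).
have -> : (1 + a) * (1 + b) - (1 + (a + b)) = a * b by ring.
by have := sradiusM a b; lra.
Qed.

Let h j : R := 2^-1 ^+ j.
Let d j a : R[i] := 2%:R ^+ j * (tau (1 + (h j)%:C *: a) - 1).

Let rh j a : r ((h j)%:C *: a) = h j * r a.
Proof. by rewrite sradiusZ cabsR gtr0_norm // half_exp_gt0. Qed.

Let c2 j : cabs (2%:R ^+ j : R[i]) = (h j)^-1.
Proof.
rewrite cabsX (_ : (2%:R : R[i]) = (2%:R : R)%:C); last by rewrite rmorph_nat.
by rewrite cabsR ger0_norm // /h exprVn invrK.
Qed.

Let dS j a : h j * r a <= 4^-1 -> cabs (d j.+1 a - d j a) <= (4 * r a ^+ 2) * h j.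
Proof.
move=> hj; pose b := (h j.+1)%:C *: a.
have bb : (h j)%:C *: a = b + b.
  by rewrite -scalerDl -rmorphD /=; congr (_%:C *: _); rewrite /h exprS; lra.
have rb : r b = h j * r a / 2 by rewrite rh /h exprS; lra.
have rb4 : r b <= 4^-1 by have := sradius_ge0 b; rewrite rb; lra.
have -> : d j.+1 a - d j a = - (2%:R ^+ j *
    (tau (1 + (b + b)) - 1 - (tau (1 + b) - 1) - (tau (1 + b) - 1))).
  by rewrite /d -bb exprS -/b; ring.
rewrite cabsN cabsM c2 mulrC ler_pdivrMr ?half_exp_gt0 //.
apply: le_trans (tau_add rb4 rb4) _; rewrite rb.
have := sqr_ge0 (h j * r a); rewrite !expr2; lra.
Qed.

Let d_le j a : h j * r a <= 4^-1 -> cabs (d j a) <= r a.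
Proof.
move=> hj; rewrite /d cabsM c2 mulrC ler_pdivrMr ?half_exp_gt0 // mulrC -rh.
have u : 1 + (h j)%:C *: a \is a GRing.unit by apply: sradius_near1_unit; rewrite rh; lra.
by have := tau_le u; rewrite (addrAC 1) subrr add0r.
Qed.

Let small a (j0 : nat) : exists n, forall j, (n <= j)%N -> h j * r a <= 4^-1 /\ (j0 <= j)%N.
Proof.
have e0 : 0 < 4^-1 :> R by rewrite invr_gt0.
have [n Hn] := half_exp_small (r a) e0; exists (maxn n j0) => j; rewrite geq_max => /andP[nj ->].
by split => //; rewrite mulrC; exact: Hn.
Qed.

Let limit a : exists l, forall j, h j * r a <= 4^-1 ->
  cabs (d j a - l) <= 16 * r a ^+ 2 * h j.
Proof.
have ex : exists n, h n * r a <= 4^-1 by have [n /(_ n (leqnn n))[]] := small a 0; exists n.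
(* The least admissible index makes the estimate valid for every admissible [j], including [j = 0]
   when [r a <= 4^-1]; that case is the last clause of [tau_derivative]. *)
case: (ex_minnP ex) => n hn nmin.
have hj j : (n <= j)%N -> h j * r a <= 4^-1.
  move=> nj; apply: le_trans hn; rewrite ler_wpM2r ?sradius_ge0 //.
  by apply: ler_wiXn2l => //; lra.
have K0 : 0 <= 4 * r a ^+ 2 by rewrite mulr_ge0 // sqr_ge0.
have [j nj|l Hl] := @geometric_limit _ (fun j => d j a) (4 * r a ^+ 2) n K0.
  exact: dS (hj j nj).
by exists l => j /nmin/Hl; rewrite mulrA (_ : 4 * 4 = 16) //; ring.
Qed.

(** Additivity of the limit: at scale [h k] the defect in [tau_add] is of order [h k ^+ 2], and
    [d k] multiplies it only by [(h k)^-1]. *)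
Lemma tau_derivative : exists L : A -> R[i],
  [/\ {morph L : a b / a + b}, forall (t : R) a, L (t%:C *: a) = t%:C * L a,
    forall a, cabs (L a) <= r a &
    forall a, r a <= 4^-1 -> cabs (tau (1 + a) - 1 - L a) <= 16 * r a ^+ 2].
Proof.
have [L LP] := choice limit.
have Lr a : cabs (L a) <= r a.
  apply: le_eps => e e0; have [n Hn] := half_exp_small (16 * r a ^+ 2) e0.
  have [k /(_ k (leqnn k))[hk nk]] := small a n.
  have := cabs_distD (L a) (d k a) 0; rewrite !subr0 cabs_distC.
  by have := d_le hk; have := LP a k hk; have := Hn k nk; rewrite -/(h k); lra.
have LD : {morph L : a b / a + b}.
  move=> a b; apply: (@cabs_eps _ _ _ 4) => e e0.
  have [n1 Hn1] := half_exp_small (16 * r a ^+ 2) e0.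
  have [n2 Hn2] := half_exp_small (16 * r b ^+ 2) e0.
  have [n3 Hn3] := half_exp_small (16 * r (a + b) ^+ 2) e0.
  have [n4 Hn4] := half_exp_small (4 * (r a * r b)) e0.
  have [k1 Hk1] := small a (maxn n1 n2); have [k2 Hk2] := small b (maxn n3 n4).
  have [k3 Hk3] := small (a + b) 0.
  pose k := maxn k1 (maxn k2 k3).
  have [ha] := Hk1 k (leq_maxl _ _); rewrite geq_max => /andP[/Hn1 e1 /Hn2 e2].
  have [] := Hk2 k; first by rewrite /k leq_max leq_maxl orbT.
  move=> hb; rewrite geq_max => /andP[/Hn3 e3 /Hn4 e4].
  have [] := Hk3 k; first by rewrite /k leq_max leq_maxr orbT.
  move=> hab _.
  have F1 := LP _ _ ha; have F2 := LP _ _ hb; have F3 := LP _ _ hab.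
  have F4 : cabs (d k (a + b) - d k a - d k b) <= e.
    have -> : d k (a + b) - d k a - d k b = 2%:R ^+ k *
      (tau (1 + ((h k)%:C *: a + (h k)%:C *: b)) - 1 - (tau (1 + (h k)%:C *: a) - 1)
       - (tau (1 + (h k)%:C *: b) - 1)).
      by rewrite /d scalerDr; ring.
    have ra : r ((h k)%:C *: a) <= 4^-1 by rewrite rh.
    have rb : r ((h k)%:C *: b) <= 4^-1 by rewrite rh.
    rewrite cabsM c2 mulrC ler_pdivrMr ?half_exp_gt0 //.
    apply: le_trans (tau_add ra rb) _; rewrite !rh.
    have := ler_wpM2r (ltW (half_exp_gt0 k)) e4; rewrite -/(h k); lra.
  have -> : L (a + b) - (L a + L b) = (d k (a + b) - d k a - d k b)
      - (d k (a + b) - L (a + b)) + ((d k a - L a) + (d k b - L b)) by ring.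
  apply: le_trans (cabsD _ _) _.
  have := cabsB (d k (a + b) - d k a - d k b) (d k (a + b) - L (a + b)).
  have := cabsD (d k a - L a) (d k b - L b).
  rewrite -/(h k) in e1 e2 e3; lra.
exists L; split => //; first exact: additive_bounded_real_linear.
move=> a ra; have := LP a 0 _; rewrite /h expr0 mul1r mulr1 => /(_ ra).
by rewrite /d /h !expr0 mul1r scale1r.
Qed.

End Derivative.

(** * From the derivative to the homomorphism *)

Section LocalForm.
Context {R : realType} {A : comBanachAlgType R[i]}.
Local Notation r := (@spectral_radius R A).
Variables (tau : A -> R[i]) (x : max_ideal_space A).
Hypothesis tauM : {in GRing.unit &, {morph tau : f g / f * g}}.
Hypothesis tau_le : forall f, f \is a GRing.unit -> cabs (tau f - 1) <= r (f - 1).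
Hypothesis tau_der : forall a, r a <= 4^-1 ->
  cabs (tau (1 + a) - 1 - gelfand a x) <= 16 * r a ^+ 2.
Hypothesis Chx : Ch A x.

Let c f : R[i] := tau f / gelfand f x.

Let ev0 f : f \is a GRing.unit -> (gelfand f x : R[i]) != 0.
Proof. exact: gelfand_unit_neq0. Qed.

Let tau1 : tau 1 = 1. Proof. exact: tau_1. Qed.
Let tau0 f : f \is a GRing.unit -> tau f != 0. Proof. exact: tau_neq0. Qed.

Let c1 : c 1 = 1. Proof. by rewrite /c gelfand1 tau1 divr1. Qed.

Let cM f g : f \is a GRing.unit -> g \is a GRing.unit -> c (f * g) = c f * c g.
Proof. by move=> fU gU; rewrite /c tauM // gelfandM invfM; ring. Qed.

Let c0 f : f \is a GRing.unit -> c f != 0.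
Proof. by move=> fU; rewrite mulf_neq0 ?invr_eq0 ?tau0 ?ev0. Qed.

Let cV f : f \is a GRing.unit -> c f^-1 = (c f)^-1.
Proof.
move=> fU; apply: (mulIf (c0 fU)); rewrite mulVf ?c0 // -cM ?unitrV // mulVr //.
Qed.

Let cX f n : f \is a GRing.unit -> c (f ^+ n) = c f ^+ n.
Proof.
by move=> fU; elim: n => [|n IH]; rewrite ?expr0 // !exprS cM ?unitrX // IH.
Qed.

(** The value of [f] at [x] has modulus at least [3 / 4], and [16 / (3 / 4) < 22]. *)
Let c_near f : r (f - 1) <= 4^-1 -> cabs (c f - 1) <= 22 * r (f - 1) ^+ 2.
Proof.
move=> hf; have fU : f \is a GRing.unit by apply: unit_radius; lra.
have fx := ev0 fU.
have -> : c f - 1 = (tau (1 + (f - 1)) - 1 - gelfand (f - 1) x) / gelfand f x.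
  have -> : 1 + (f - 1) = f by ring.
  by rewrite gelfandB gelfand1 /c; field.
have fx34 : 3 / 4 <= cabs (gelfand f x).
  have := le_trans (gelfand_le_radius (f - 1) x) hf; rewrite gelfandB gelfand1.
  have := cabs_distD 1 (gelfand f x : R[i]) 0; rewrite !subr0 cabs1 (cabs_distC 1); lra.
rewrite cabsM cabsV ler_pdivrMr; last by lra.
apply: le_trans (tau_der hf) _.
have := sqr_ge0 (r (f - 1)); nra.
Qed.

(* Along the segment from [1] to [1 + a] the quotient of [tau] by the
   evaluation has zero derivative. *)
Let c_segment a : r a <= 2^-1 -> c (1 + a) = 1.
Proof.
move=> ra; apply: (@cabs_eps _ _ _ 44) => e e0.
(* With [n >= 44] the accumulated error [44 * k / n ^ 2] stays at most 1, so each of the [n] steps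
   adds at most twice the [22 / n ^ 2] of [c_near]; the total is [44 / n]. *)
pose n := (Num.truncn e^-1 + 44)%N.
have n44 : 44 <= n%:R :> R by rewrite ler_nat leq_addl.
have n0 : 0 < n%:R :> R by lra.
have ne : n%:R^-1 <= e.
  rewrite -[e]invrK lef_pV2 ?posrE ?invr_gt0 //; apply: ltW.
  apply: lt_le_trans (Num.Theory.truncnS_gt _) _.
  by rewrite ler_nat /n -addn1 leq_add2l.
pose f k : A := 1 + (k%:R / n%:R)%:C *: a.
have rf k : (k <= n)%N -> r (f k - 1) <= 2^-1.
  move=> kn; rewrite /f addrAC subrr add0r sradiusZ cabsR ger0_norm ?divr_ge0 //.
  have k1 : k%:R / n%:R <= 1 :> R by rewrite ler_pdivrMr // mul1r ler_nat.
  have k0 : 0 <= k%:R / n%:R :> R by rewrite divr_ge0.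
  by have := ler_pM k0 (sradius_ge0 a) k1 ra; lra.
have fU k : (k <= n)%N -> f k \is a GRing.unit.
  by move=> /rf h; apply: unit_radius; lra.
have H k : (k <= n)%N -> cabs (c (f k) - 1) <= 44 * k%:R / n%:R ^+ 2.
  elim: k => [|k IH] kn.
    by rewrite /f mul0r scale0r addr0 c1 subrr cabs0 mulr0 mul0r.
  have kn' := ltnW kn; have IHk := IH kn'.
  pose g := f k.+1 / f k.
  have gU : g \is a GRing.unit by rewrite unitrM unitrV !fU.
  have -> : f k.+1 = f k * g by rewrite mulrC divrK ?fU.
  have g1 : g - 1 = (n%:R^-1)%:C *: (a / f k).
    have -> : g - 1 = (f k.+1 - f k) / f k by rewrite mulrBl divrr ?fU.
    rewrite scalerAl; congr (_ * _); rewrite /f opprD addrACA subrr add0r -scalerBl.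
    by rewrite -rmorphB /= -natr1; congr (_%:C *: _); ring.
  have rg : r (g - 1) <= n%:R^-1.
    rewrite g1 sradiusZ cabsR ger0_norm ?invr_ge0 // ler_piMr ?invr_ge0 //.
    have := sradius_inv_le (fU _ kn') (rf _ kn') => h.
    apply: le_trans (sradiusM _ _) _.
    by have := ler_pM (sradius_ge0 a) (sradius_ge0 _) ra h; lra.
  have nn : n%:R^-1 <= 44^-1 :> R by rewrite lef_pV2 ?posrE.
  have cg : cabs (c g - 1) <= 22 / n%:R ^+ 2.
    apply: le_trans (c_near _) _; first by lra.
    rewrite ler_wpM2l // -exprVn.
    by rewrite ler_sqr ?nnegrE ?sradius_ge0 ?invr_ge0.
  have ck1 : cabs (c (f k) - 1) <= 1.
    apply: le_trans IHk _; rewrite ler_pdivrMr ?exprn_gt0 // mul1r expr2.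
    by apply: ler_pM => //; rewrite ler_nat.
  rewrite cM ?fU //.
  have -> : c (f k) * c g - 1 = (c (f k) - 1) * (c g - 1) + (c (f k) - 1) + (c g - 1) by ring.
  apply: le_trans (cabsD _ _) _.
  have := cabsD ((c (f k) - 1) * (c g - 1)) (c (f k) - 1); rewrite cabsM.
  have := ler_wpM2r (cabs_ge0 (c g - 1)) ck1; rewrite mul1r.
  have -> : 44 * k.+1%:R / n%:R ^+ 2 = 44 * k%:R / n%:R ^+ 2 + 2 * (22 / n%:R ^+ 2) :> R.
    by rewrite -[k.+1%:R]natr1; ring.
  lra.
have := H n (leqnn n); rewrite /f divff ?gt_eqF // scale1r => h.
apply: le_trans h _; rewrite -mulrA ler_wpM2l //.
by rewrite expr2 invfM mulrA divff ?gt_eqF // mul1r.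
Qed.

(** A square root [m] of [l] with [0 <= Re m] and [1 <= cabs m] has [2 <= cabs (m + 1) ^+ 2]; so
    each root at least halves the squared distance to 1, until [c_segment] applies at distance
    [1 / 2]. *)
Let c_const_ge1 k (l : R[i]) : 1 <= cabs l -> cabs (l - 1) ^+ 2 <= 2 ^+ k / 4 -> c l%:A = 1.
Proof.
elim: k l => [|k IH] l l1 hl.
  have -> : l%:A = 1 + (l - 1)%:A :> A by rewrite scalerBl scale1r; ring.
  apply: c_segment; rewrite sradiusA.
  rewrite -ler_sqr ?nnegrE ?cabs_ge0 ?invr_ge0 //.
  by apply: le_trans hl _; rewrite expr0; lra.
have [m [ml m0]] := sqrt_Re_ge0 l.
have m1 : 1 <= cabs m.
  by rewrite -(@ler_sqr R 1) ?nnegrE ?cabs_ge0 // expr1n -cabsX ml.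
have mU : (m%:A : A) \is a GRing.unit.
  by apply: unit_gelfand => y; rewrite gelfandA -cabs_eq0; apply/eqP; lra.
have -> : l%:A = m%:A ^+ 2 :> A by rewrite -ml exprZn expr1n.
rewrite cX // IH ?expr1n //.
have E : l - 1 = (m - 1) * (m + 1) by rewrite -ml; ring.
move: hl; rewrite E cabsM exprMn (exprS 2 k) => hl.
have m2 : 2 <= cabs (m + 1) ^+ 2.
  have := cabs_sqr m; rewrite (cabs_sqr (m + 1)) !ReImE addr0 => hm.
  have : 1 <= cabs m ^+ 2 by rewrite expr_ge1 // cabs_ge0.
  by rewrite hm; nra.
have := ler_wpM2l (sqr_ge0 (cabs (m - 1))) m2; lra.
Qed.

Let c_const (l : R[i]) : l != 0 -> c l%:A = 1.
Proof.
have ge1 z : 1 <= cabs z -> c z%:A = 1.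
  move=> z1; pose k := Num.truncn (4 * cabs (z - 1) ^+ 2).
  apply: (@c_const_ge1 k) => //; rewrite ler_pdivlMr // mulrC; apply: ltW.
  apply: lt_le_trans (Num.Theory.truncnS_gt _) _.
  by rewrite -natrX ler_nat; exact: ltn_expl.
move=> l0; have [/ge1 //|l1] := leP 1 (cabs l).
have lU : (l%:A : A) \is a GRing.unit by apply: unit_gelfand => y; rewrite gelfandA.
have lVU : (l^-1%:A : A) \is a GRing.unit by apply: unit_gelfand => y; rewrite gelfandA invr_eq0.
have lV1 : 1 <= cabs l^-1.
  by rewrite cabsV -[leLHS]invr1 lef_pV2 ?posrE ?cabs_gt0 //; exact: ltW.
by have := cM lU lVU; rewrite (ge1 _ lV1) mulr1 -scalerAl mul1r scalerA divff // scale1r c1.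
Qed.

(* [|1 - z| ^ 2 <= (N - 1) * (1 - |z| ^ 2)] means that [N * z] lies in the disc
   of center 1 and radius [N - 1]; the hypothesis is the case [N = 2]. *)
Let disc_power (z : R[i]) m : cabs (1 - z) ^+ 2 <= 1 - cabs z ^+ 2 ->
  cabs (1 - z ^+ m) ^+ 2 <= (2 * m)%:R * (1 - cabs z ^+ (2 * m)).
Proof.
set q := cabs z => hz; have q0 : 0 <= q := cabs_ge0 z.
have q1 : q <= 1.
  by rewrite -(@ler_sqr R q 1) ?nnegrE // expr1n; have := sqr_ge0 (cabs (1 - z)); lra.
pose sum k := \sum_(i < k) q ^+ i.
have sumE k : (1 - q) * sum k = 1 - q ^+ k.
  elim: k => [|k IH]; first by rewrite /sum big_ord0 mulr0 expr0 subrr.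
  by rewrite /sum big_ord_recr /= -/(sum k) mulrDr IH exprS; ring.
have h1 k : cabs (1 - z ^+ k) <= cabs (1 - z) * sum k.
  elim: k => [|k IH]; first by rewrite /sum big_ord0 mulr0 expr0 subrr cabs0.
  rewrite /sum big_ord_recr /= -/(sum k) mulrDr.
  have -> : 1 - z ^+ k.+1 = (1 - z ^+ k) + (1 - z) * z ^+ k by rewrite exprS; ring.
  by apply: le_trans (cabsD _ _) _; apply: lerD => //; rewrite cabsM cabsX.
pose S := sum m; have SE : (1 - q) * S = 1 - q ^+ m := sumE m.
have S0 : 0 <= S by apply: sumr_ge0 => i _; rewrite exprn_ge0.
have Sm : S <= m%:R.
  rewrite -[m in m%:R]card_ord -sum1_card natr_sum; apply: ler_sum => i _.
  by rewrite exprn_ile1.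
have h2 : cabs (1 - z ^+ m) ^+ 2 <= cabs (1 - z) ^+ 2 * S ^+ 2.
  by rewrite -exprMn ler_sqr ?nnegrE ?mulr_ge0 ?cabs_ge0 ?h1.
apply: le_trans h2 _.
have h3 := ler_wpM2r (sqr_ge0 S) hz; apply: le_trans h3 _.
have -> : (1 - q ^+ 2) * S ^+ 2 = (1 + q) * S * ((1 - q) * S) by ring.
have qm : q ^+ (2 * m) = q ^+ m * q ^+ m by rewrite mul2n -addnn exprD.
have qm0 : 0 <= q ^+ m by rewrite exprn_ge0.
have qm1 : q ^+ m <= 1 by rewrite exprn_ile1.
have m0 : 0 <= m%:R :> R by [].
rewrite SE natrM qm.
have h4 : (1 + q) * S <= 2 * m%:R by apply: ler_pM => //; lra.
have h5 : 0 <= 1 - q ^+ m by lra.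
have := ler_wpM2r h5 h4; set v := q ^+ m in qm0 qm1 h5 *.
have : 0 <= m%:R * (v * (1 - v)) by rewrite !mulr_ge0.
lra.
Qed.

(** The exponent [m], and with it [N], depends on [r f] alone. The peaking element depends on [d],
    which tends to 0 with [N] fixed, so the error terms disappear from the final bound. *)
Let c_bound f : f \is a GRing.unit -> gelfand f x = 1 ->
  exists2 N : R, 1 < N & cabs (N%:C * c f - 1) <= N - 1.
Proof.
move=> fU fx1.
have q0 : 0 <= (5 / 6 : R) by lra.
have q1 : (5 / 6 : R) < 1 by lra.
have rf1 : 1 <= r f by have := gelfand_le_radius f x; rewrite fx1 cabs1.
have e0 : 0 < (3 * r f)^-1 by rewrite invr_gt0; lra.
have [m' Hm'] := small_expr q0 q1 e0.
pose m := m'.+1; pose N : R := (2 * m).+1%:R.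
have qm : (5 / 6 : R) ^+ m * r f <= 3^-1.
  have : (5 / 6 : R) ^+ m <= (3 * r f)^-1.
    by apply: le_trans Hm'; rewrite exprS ler_piMl ?exprn_ge0 // ltW.
  move=> h; have := ler_wpM2r (sradius_ge0 f) h; rewrite invfM -mulrA mulVf ?mulr1 //.
  by rewrite gt_eqF //; lra.
have N3 : 3 <= N by rewrite /N ler_nat /m mulnS.
exists N; first by lra.
apply: (@le_eps_mul _ (N + N * cabs (c f) * m%:R)) => d d0 d1.
have kx : gelfand (f - 1) x = 0 by rewrite gelfandB gelfand1 fx1 subrr.
have [h [h_ge0 hx h_off]] := Ch_peak Chx kx d0 d0.
(* Removing an imaginary constant makes the value at [x] real and leaves all real parts
   unchanged. *)
pose h1 := h - ('i * (Im (gelfand h x))%:C)%:A.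
have h1E y : gelfand h1 y = (gelfand h y : R[i]) - 'i * (Im (gelfand h x))%:C.
  by rewrite gelfandB gelfandA.
have Re_h1 y : Re (gelfand h1 y) = Re (gelfand h y).
  by rewrite h1E !ReImE; ring.
have h1x : gelfand h1 x = (Re (gelfand h x))%:C.
  by rewrite h1E; apply: complexP; rewrite !ReImE; ring.
have Re_1h y : 1 <= Re (gelfand (1 + h1) y).
  by rewrite gelfandD gelfand1 Re_add Re_one Re_h1; have := h_ge0 y; lra.
have hU : 1 + h1 \is a GRing.unit.
  apply: unit_gelfand => y; apply/eqP => h0.
  by have := Re_1h y; rewrite h0 Re_zero; lra.
(* [1 + h1] has real part at least 1 everywhere and at least 2 where [f] is [d] away from 1, and
   lies in [[1, 1 + d]] at [x]; the reciprocal therefore peaks at [x]. *)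
pose g := (1 + h1)^-1.
have gV y (k : R) : 0 < k -> k <= Re (gelfand (1 + h1) y) -> cabs (gelfand g y) <= k^-1.
  move=> k0 hk; have hk' := le_trans hk (Re_cabs _).
  by rewrite gelfandV // cabsV lef_pV2 ?posrE // (lt_le_trans k0).
have g1 y : cabs (gelfand g y) <= 1 by rewrite -invr1; exact: gV.
have g_off y : d <= cabs (gelfand (f - 1) y) -> cabs (gelfand g y) <= 2^-1.
  move=> /h_off hy; apply: gV => //.
  by rewrite gelfandD gelfand1 Re_add Re_one Re_h1; lra.
have gx : cabs (gelfand g x - 1) <= d.
  have -> : gelfand g x - 1 = ((1 + Re (gelfand h x))^-1 - 1)%:C.
    by rewrite gelfandV // gelfandD gelfand1 h1x rmorphB fmorphV rmorphD rmorph1.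
  have hx0 := h_ge0 x; set t := Re (gelfand h x) in hx hx0 *.
  have t1 : 1 + t != 0 by rewrite gt_eqF //; lra.
  have -> : (1 + t)^-1 - 1 = - (t / (1 + t)) by field.
  rewrite cabsR normrN ger0_norm ?divr_ge0 //; last by lra.
  rewrite ler_pdivrMr; last by lra.
  nra.
have rg : r (2^-1%:C *: g) <= 2^-1.
  rewrite sradiusZ cabsR ger0_norm // ler_piMr //; exact: sradius_le.
(* [(2 + g) / 3], factored so that [c p = 1] follows from [c_const] and [c_segment]. Its values lie
   in the disc of diameter [[1 / 3, 1]], which [disc_power] accepts, and [5 / 6] is
   [(2 + 1 / 2) / 3]. *)
pose p := (2 / 3)%:C%:A * (1 + 2^-1%:C *: g).
have pE y : gelfand p y = 3^-1%:C * (2%:C + gelfand g y).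
  rewrite gelfandM gelfandA gelfandD gelfand1 gelfandZ.
  have -> : (2 / 3 : R) = 3^-1 * 2 by rewrite mulrC.
  rewrite rmorphM /= -mulrA mulrDr mulr1; congr (_ * (_ + _)).
  by rewrite mulrA -rmorphM /= divff ?mul1r.
have c23U : ((2 / 3)%:C%:A : A) \is a GRing.unit.
  apply: unit_gelfand => y; rewrite gelfandA -cabs_eq0 cabsR normr_eq0.
  by apply/eqP; lra.
have gU1 : 1 + 2^-1%:C *: g \is a GRing.unit by exact: sradius_near1_unit.
have pU : p \is a GRing.unit by rewrite unitrM c23U.
have cp : c p = 1.
  rewrite cM // c_segment // mulr1 c_const // -cabs_eq0 cabsR normr_eq0.
  by apply/eqP; lra.
have p_disc y : cabs (1 - gelfand p y) ^+ 2 <= 1 - cabs (gelfand p y) ^+ 2.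
  rewrite pE; have := g1 y; have := cabs_sqr (gelfand g y).
  have := cabs_ge0 (gelfand g y).
  set w := (gelfand g y : R[i]) => w0 wE w1.
  have Rw := Re_cabs w.
  rewrite !cabs_sqr !ReImE.
  have w2 : cabs w ^+ 2 <= 1 by rewrite exprn_ile1.
  rewrite wE in w2; nra.
have p_off y : d <= cabs (gelfand (f - 1) y) -> cabs (gelfand p y) <= 5 / 6.
  move=> /g_off hy; rewrite pE cabsM cabsR ger0_norm //.
  have := cabsD 2%:C (gelfand g y : R[i]); rewrite cabsR ger0_norm //; lra.
pose u := N%:C%:A * p ^+ m.
have NU : (N%:C%:A : A) \is a GRing.unit.
  apply: unit_gelfand => y; rewrite gelfandA -cabs_eq0 cabsR normr_eq0.
  by apply/eqP; lra.
have uU : u \is a GRing.unit by rewrite unitrM NU unitrX.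
have cu : c u = 1.
  rewrite cM ?unitrX // cX // cp expr1n mulr1 c_const // -cabs_eq0 cabsR normr_eq0.
  by apply/eqP; lra.
have uE y : gelfand u y = N%:C * (gelfand p y : R[i]) ^+ m by rewrite gelfandM gelfandA gelfandX.
have pm1 y : cabs ((gelfand p y : R[i]) ^+ m) <= 1.
  rewrite cabsX exprn_ile1 ?cabs_ge0 //.
  rewrite -(@ler_sqr R _ 1) ?nnegrE ?cabs_ge0 // expr1n.
  by have := p_disc y; have := sqr_ge0 (cabs (1 - gelfand p y)); lra.
have u_disc y : cabs (gelfand u y - 1) <= N - 1.
  rewrite uE; have := disc_power m (p_disc y).
  set w := (gelfand p y : R[i]).
  have -> : cabs w ^+ (2 * m) = cabs (w ^+ m) ^+ 2 by rewrite cabsX -exprM mulnC.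
  set z := w ^+ m.
  have -> : (2 * m)%:R = N - 1 :> R by rewrite /N -natr1; ring.
  move=> hz; rewrite -ler_sqr ?nnegrE ?cabs_ge0 //; last by lra.
  move: hz; rewrite !cabs_sqr !ReImE; nra.
(* Where [f] is within [d] of 1, [u_disc] costs an extra [N * d]. Elsewhere [u * f] has modulus at
   most [N / 3], and [N / 3 + 1 <= N - 1] because [N >= 3]. *)
have rub : r (u * f - 1) <= N - 1 + N * d.
  apply: sradius_le => y; rewrite gelfandB gelfandM gelfand1.
  have [/p_off pd|fd] := leP d (cabs (gelfand (f - 1) y)).
    apply: le_trans (cabsB _ _) _; rewrite cabsM cabs1 uE cabsM cabsX cabsR ger0_norm; last by lra.
    have h2 : cabs (gelfand p y) ^+ m <= (5 / 6) ^+ m by rewrite lerXn2r ?nnegrE ?cabs_ge0.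
    have h3 := ler_pM (exprn_ge0 m (cabs_ge0 (gelfand p y))) (cabs_ge0 (gelfand f y)) h2
      (gelfand_le_radius f y).
    have N0 : 0 <= N by lra.
    have h4 := ler_wpM2l N0 (le_trans h3 qm); have : 0 <= N * d by rewrite mulr_ge0 // ltW.
    by rewrite -mulrA; lra.
  rewrite gelfandB gelfand1 in fd.
  have -> : (gelfand u y : R[i]) * gelfand f y - 1 =
    (gelfand u y - 1) + gelfand u y * (gelfand f y - 1) by ring.
  apply: le_trans (cabsD _ _) _; apply: lerD => //.
  rewrite cabsM; apply: ler_pM; rewrite ?cabs_ge0 //; last exact: ltW.
  rewrite uE cabsM cabsR ger0_norm; last by lra.
  by rewrite ler_piMr //; lra.
have tuf : tau (u * f) = c f * gelfand u x.
  have := cM uU fU; rewrite cu mul1r => <-.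
  by rewrite /c gelfandM fx1 mulr1 divfK // ev0.
have ufU : u * f \is a GRing.unit by rewrite unitrM uU.
have := le_trans (tau_le ufU) rub; rewrite tuf uE => H.
have px : cabs (1 - (gelfand p x : R[i]) ^+ m) <= m%:R * d.
  have px1 : cabs (1 - gelfand p x) <= d.
    have -> : 1 - gelfand p x = 3^-1%:C * (1 - gelfand g x).
      by rewrite pE; apply: complexP; rewrite !ReImE; field.
    rewrite cabsM cabsR ger0_norm // cabs_distC; lra.
  have pc : cabs (gelfand p x) <= 1 by have := pm1 x; rewrite cabsX expr_le1 ?cabs_ge0.
  elim: (m) => [|k IH]; first by rewrite expr0 subrr cabs0 mul0r.
  have -> : 1 - (gelfand p x : R[i]) ^+ k.+1 =
      (1 - gelfand p x) + gelfand p x * (1 - (gelfand p x : R[i]) ^+ k).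
    by rewrite exprS; ring.
  apply: le_trans (cabsD _ _) _; rewrite cabsM -[k.+1%:R]natr1 mulrDl mul1r addrC; apply: lerD => //.
  by apply: le_trans IH; rewrite ler_piMl ?cabs_ge0.
have -> : N%:C * c f - 1 = (c f * (N%:C * (gelfand p x : R[i]) ^+ m) - 1) +
    N%:C * c f * (1 - (gelfand p x : R[i]) ^+ m) by ring.
apply: le_trans (cabsD _ _) _.
rewrite !(cabsM (N%:C * c f)) (cabsM N%:C) cabsR ger0_norm; last by lra.
have Nc : 0 <= N * cabs (c f) by rewrite mulr_ge0 ?cabs_ge0 //; lra.
have := ler_wpM2l Nc px; lra.
Qed.

(** Normalize [f] to the value 1 at [x]. The disc of [c_bound] gives [cabs (c f0) <= 1], the one for
    [f0^-1] gives equality, and a point of modulus [N] in the disc of centre 1 and radius [N - 1] is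
    [N]. *)
Lemma local_form f : f \is a GRing.unit -> tau f = gelfand f x.
Proof.
move=> fU; have fx := ev0 fU.
suff cf : c f = 1 by rewrite -[tau f](divfK fx) -/(c f) cf mul1r.
pose f0 := ((gelfand f x : R[i])^-1)%:A * f.
have lU : (((gelfand f x : R[i])^-1)%:A : A) \is a GRing.unit.
  by apply: unit_gelfand => y; rewrite gelfandA invr_eq0.
have f0U : f0 \is a GRing.unit by rewrite unitrM lU.
have <- : c f0 = c f by rewrite cM // c_const ?mul1r // invr_eq0.
have f0x : gelfand f0 x = 1 by rewrite gelfandM gelfandA mulVf.
have le1 g : g \is a GRing.unit -> gelfand g x = 1 -> cabs (c g) <= 1.
  move=> gU gx; have [N N1 H] := c_bound gU gx.
  have := cabs_distD (N%:C * c g) 1 0; rewrite !subr0 cabs1 cabsM cabsR gtr0_norm; last by lra.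
  move=> h; have : N * cabs (c g) <= N * 1 by lra.
  by rewrite ler_pM2l //; lra.
have h1 := le1 _ f0U f0x.
have h2 : 1 <= cabs (c f0).
  have := le1 f0^-1; rewrite unitrV gelfandV // f0x invr1 cV // cabsV => /(_ f0U erefl).
  by rewrite invf_le1 // cabs_gt0 c0.
have [N N1 H] := c_bound f0U f0x.
have h3 : cabs (N%:C * c f0 - 1) ^+ 2 <= (N - 1) ^+ 2.
  by rewrite ler_sqr ?nnegrE ?cabs_ge0 //; lra.
have h4 : cabs (c f0) ^+ 2 = 1 by rewrite (_ : cabs (c f0) = 1) ?expr1n //; lra.
rewrite cabs_sqr Re_add Im_add Re_opp Im_opp Re_one Im_one Re_rmul Im_rmul in h3.
rewrite cabs_sqr in h4.
have re1 : 1 <= Re (c f0).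
  have E : N * (Re (c f0) * 2) = N ^+ 2 * (Re (c f0) ^+ 2 + Im (c f0) ^+ 2) + 1 -
      ((N * Re (c f0) - 1) ^+ 2 + (N * Im (c f0)) ^+ 2) by ring.
  have : N * 2 <= N * (Re (c f0) * 2).
    have : (N * Re (c f0) - 1) ^+ 2 + (N * Im (c f0)) ^+ 2 <= (N - 1) ^+ 2.
      by move: h3; rewrite oppr0 addr0.
    by rewrite E h4; lra.
  by rewrite ler_pM2l; lra.
have sq := sqr_ge0 (Im (c f0)).
by apply: complexP; rewrite ?Re_one ?Im_one; nra.
Qed.

End LocalForm.

(** * The pointwise form of an isometry *)

(** Identities between derivatives are available only with a quadratic error at [s *: a]; dividing
    by [s] and letting [s] tend to 0 removes the error. *)
Lemma eq_of_quadratic (R : realType) (x y K s0 : R) : 0 < s0 ->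
  (forall s, 0 < s -> s <= s0 -> `|s * x - s * y| <= K * s ^+ 2) -> x = y.
Proof.
move=> s00 H; have K0 : 0 <= K.
  have := le_trans (normr_ge0 _) (H s0 s00 (lexx _)).
  by rewrite pmulr_lge0 // exprn_gt0.
apply/eqP; rewrite -subr_eq0 -normr_eq0 eq_le normr_ge0 andbT.
apply: (@le_eps_mul _ (K * s0)) => e e0 e1; rewrite add0r.
have se0 : 0 < s0 * e by rewrite mulr_gt0.
have := H (s0 * e) se0; rewrite ger_pMr // => /(_ e1).
rewrite -mulrBr normrM gtr0_norm // expr2 mulrCA ler_pM2l //.
by rewrite mulrA.
Qed.

Section UnitGroupIsometry.
Context {R : realType} {A B : comBanachAlgType R[i]}.
Local Notation rA := (@spectral_radius R A).
Local Notation rB := (@spectral_radius R B).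

(** [T'] inverts [T] on one side only; assuming the property for both [T, T'] and [T', T] keeps the
    two algebras symmetric. *)
Definition unit_group_isometry (T : A -> B) (T' : B -> A) : Prop :=
  [/\ {in GRing.unit &, {morph T : f g / f * g}},
      forall f, f \is a GRing.unit -> T f \is a GRing.unit,
      forall f, f \is a GRing.unit -> T' (T f) = f &
      forall f, f \is a GRing.unit -> rB (T f - 1) = rA (f - 1)].

End UnitGroupIsometry.

Section PointwiseForm.
Context {R : realType} {A B : comBanachAlgType R[i]}.
Local Notation rA := (@spectral_radius R A).
Local Notation rB := (@spectral_radius R B).
Variables (T : A -> B) (T' : B -> A).
Hypotheses (HT : unit_group_isometry T T') (HT' : unit_group_isometry T' T).

Let tauM y : {in GRing.unit &, {morph (fun f => gelfand (T f) y : R[i]) : f g / f * g}}.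
Proof. by move=> f g fU gU; have [TM _ _ _] := HT; rewrite TM // gelfandM. Qed.

Let tau_le y f : f \is a GRing.unit -> cabs (gelfand (T f) y - 1) <= rA (f - 1).
Proof.
move=> fU; have [_ _ _ Tr] := HT; rewrite -Tr //.
by apply: le_trans (gelfand_le_radius _ y); rewrite gelfandB gelfand1.
Qed.

Let tauM' x : {in GRing.unit &, {morph (fun f => gelfand (T' f) x : R[i]) : f g / f * g}}.
Proof. by move=> f g fU gU; have [TM _ _ _] := HT'; rewrite TM // gelfandM. Qed.

Let tau_le' x f : f \is a GRing.unit -> cabs (gelfand (T' f) x - 1) <= rB (f - 1).
Proof.
move=> fU; have [_ _ _ Tr] := HT'; rewrite -Tr //.
by apply: le_trans (gelfand_le_radius _ x); rewrite gelfandB gelfand1.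
Qed.

Let is_der (L : max_ideal_space B -> A -> R[i]) := forall y,
  [/\ {morph L y : a b / a + b}, forall (t : R) a, L y (t%:C *: a) = t%:C * L y a,
    forall a, cabs (L y a) <= rA a &
    forall a, rA a <= 4^-1 -> cabs (gelfand (T (1 + a)) y - 1 - L y a) <= 16 * rA a ^+ 2].

Let is_der' (L' : max_ideal_space A -> B -> R[i]) := forall x,
  [/\ {morph L' x : a b / a + b}, forall (t : R) a, L' x (t%:C *: a) = t%:C * L' x a,
    forall a, cabs (L' x a) <= rB a &
    forall a, rB a <= 4^-1 -> cabs (gelfand (T' (1 + a)) x - 1 - L' x a) <= 16 * rB a ^+ 2].

Lemma dominated_lip (C : comBanachAlgType R[i]) (mu : (max_ideal_space C -> R[i]^o) -> R)
    (u v : max_ideal_space C -> R[i]^o) (e : R) :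
  dominated (@bounded_functions R (max_ideal_space C)) (@supnorm R _) mu ->
  bounded_functions u -> bounded_functions v ->
  (forall x, cabs (u x - v x) <= e) -> `|mu u - mu v| <= e.
Proof.
move=> [mulin mule] Bu Bv H; have [m _] := @max_ideal_space_inhabited R C.
have [_ BD BZ] := @bounded_subspace R (max_ideal_space C).
have BN (w : max_ideal_space C -> R[i]^o) : bounded_functions w -> bounded_functions (- w).
  by move=> Bw; have := BZ (-1) w Bw; rewrite scaleN1r.
have le (w w' : max_ideal_space C -> R[i]^o) : bounded_functions w -> bounded_functions w' ->
    (forall x, cabs (w x - w' x) <= e) -> mu w - mu w' <= e.
  move=> Bw Bw' Hw; rewrite -(real_linearN mulin) // -mulin.1 //; last exact: BN.
  apply: le_trans (mule _ (BD _ _ Bw (BN _ Bw'))) _.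
  by apply: (supnorm_le m) => x; exact: Hw.
rewrite ler_norml lerNl opprB !le //.
by move=> x; rewrite cabs_distC.
Qed.

(** To second order, [b] is [L a] on [M_B], and [L' b] is [a] on [M_A] since [T'] sends [1 + b] back
    to [1 + a]. In this sense [L'] inverts [L]. *)
Let near (L : max_ideal_space B -> A -> R[i]) (L' : max_ideal_space A -> B -> R[i]) a :
  is_der L -> is_der' L' -> rA a <= 4^-1 -> exists b,
  [/\ rB b = rA a, 1 + b = T (1 + a), forall y, cabs (gelfand b y - L y a) <= 16 * rA a ^+ 2 &
      forall x, cabs (L' x b - gelfand a x) <= 16 * rA a ^+ 2].
Proof.
move=> LP LP' ra; have [_ _ TK Tr] := HT.
have aU : 1 + a \is a GRing.unit by apply: sradius_near1_unit; lra.
exists (T (1 + a) - 1).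
have rb : rB (T (1 + a) - 1) = rA a by rewrite Tr // addrAC subrr add0r.
split => //; first by ring.
  by move=> y; have [_ _ _ H] := LP y; rewrite gelfandB gelfand1; exact: H.
move=> x; have [_ _ _ H] := LP' x.
have := H (T (1 + a) - 1); rewrite rb => /(_ ra).
have -> : 1 + (T (1 + a) - 1) = T (1 + a) by ring.
rewrite TK // gelfandD gelfand1 cabs_distC => h; apply: le_trans h.
by rewrite (addrAC 1) subrr add0r.
Qed.

(** Suppose [s1] and [s2] split the functional. Their extensions [mu1] and [mu2], composed with [F],
    are dominated by [rB] and split the rotated evaluation at [y]; extremality of the latter
    identifies [mu1] on every [F b], and [near] transports this back to [s1]. [F b] is only a
    bounded function, whence the extensions. Each identity is tested on [s] times an element, up to
    an error in [s ^+ 2]. *)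
Let der_extreme L L' (c : R[i]) y : is_der L -> is_der' L' -> cabs c = 1 -> Ch B y ->
  extreme_dominated setT rA (fun a => Re (c * L y a)).
Proof.
move=> LP LP' c1 Chy; have [LD LZ Lr LE] := LP y.
split.
  split; first split=> [a b _ _|t a _].
  - by rewrite LD mulrDr Re_add.
  - by rewrite LZ mulrCA Re_rmul.
  by move=> a _; apply: le_trans (Re_cabs _) _; rewrite cabsM c1 mul1r; exact: Lr.
move=> s1 s2 t d1 d2 t01 H.
have [mu1 dmu1 mu1E] := dominated_extends d1; have [mu2 dmu2 mu2E] := dominated_extends d2.
pose F b : max_ideal_space A -> R[i]^o := fun x => L' x b.
have BF b : bounded_functions (F b).
  by exists (rB b) => x; have [_ _ h _] := LP' x; exact: h.
have FD b b' : F (b + b') = F b + F b'.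
  by apply/funext => x; have [h _ _ _] := LP' x; exact: h.
have FZ (k : R) b : F (k%:C *: b) = k%:C *: F b.
  by apply/funext => x; have [_ h _ _] := LP' x; exact: h.
have [m0 _] := @max_ideal_space_inhabited R A.
have domN mu : dominated (@bounded_functions R (max_ideal_space A)) (@supnorm R _) mu ->
    dominated setT rB (fun b => mu (F b)).
  move=> [[muD muZ] mule]; split; first split=> [b b' _ _|k b _].
  - by rewrite FD muD.
  - by rewrite FZ muZ.
  move=> b _; apply: le_trans (mule _ (BF b)) _; apply: (supnorm_le m0) => x.
  by have [_ _ h _] := LP' x; exact: h.
have FZE mu (k : R) b : dominated (@bounded_functions R (max_ideal_space A)) (@supnorm R _) mu ->
    mu (F (k%:C *: b)) = k * mu (F b).
  by move=> [[_ muZ] _]; rewrite FZ muZ.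
have inverse (b : B) : rB b <= 4^-1 -> exists a, [/\ rA a = rB b,
    cabs (gelfand b y - L y a) <= 16 * rB b ^+ 2 &
    forall x, cabs (gelfand a x - L' x b) <= 16 * rB b ^+ 2].
  move=> rb; have [_ _ TK' Tr'] := HT'.
  have bU : 1 + b \is a GRing.unit by apply: sradius_near1_unit; lra.
  have ra : rA (T' (1 + b) - 1) = rB b by rewrite Tr' // addrAC subrr add0r.
  exists (T' (1 + b) - 1); split => //.
    have := LE (T' (1 + b) - 1); rewrite ra => /(_ rb).
    have -> : 1 + (T' (1 + b) - 1) = T' (1 + b) by ring.
    by rewrite TK' // gelfandD gelfand1 (addrAC 1) subrr add0r.
  move=> x; have [_ _ _ h] := LP' x; rewrite gelfandB gelfand1; exact: h.
have [t0 t1] := andP t01.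
have scale_small (C : comBanachAlgType R[i]) (a : C) :
    exists2 k : R, 0 < k & forall s, 0 < s -> s <= k -> spectral_radius (s%:C *: a) <= 4^-1.
  exists (4^-1 / (spectral_radius a + 1)).
    by rewrite divr_gt0 // ltr_wpDl // sradius_ge0.
  move=> s s0 hs; rewrite sradiusZ cabsR gtr0_norm //.
  have r1 : 0 < spectral_radius a + 1 by rewrite ltr_wpDl // sradius_ge0.
  by move: hs; rewrite ler_pdivlMr // mulrDr mulr1; lra.
have Re_near (z w : R[i]) e : cabs (z - w) <= e -> `|Re (c * z) - Re (c * w)| <= e.
  move=> h; rewrite -Re_opp -Re_add -mulrBr; apply: le_trans (Re_le_cabs _) _.
  by rewrite cabsM c1 mul1r.
have comb b : Re (c * gelfand b y) = t * mu1 (F b) + (1 - t) * mu2 (F b).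
  have [s0 s00 Hs] := scale_small B b.
  apply: (@eq_of_quadratic _ _ _ (32 * rB b ^+ 2) s0 s00) => s sp ss.
  have rb := Hs s sp ss; have [a [ra H1 H2]] := inverse _ rb.
  have rsb : rB (s%:C *: b) = s * rB b by rewrite sradiusZ cabsR gtr0_norm.
  have D1 := dominated_lip dmu1 (gelfand_bounded a) (BF _) H2.
  have D2 := dominated_lip dmu2 (gelfand_bounded a) (BF _) H2.
  have D3 := Re_near _ _ _ H1.
  rewrite mu1E FZE // rsb exprMn in D1; rewrite mu2E FZE // rsb exprMn in D2.
  rewrite rsb exprMn gelfandZ mulrCA Re_rmul (H a I) in D3.
  move: D1 D2 D3; rewrite !ler_norml => /andP[l1 u1] /andP[l2 u2] /andP[l3 u3].
  apply/andP; split; nra.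
have [_ xB] := Ch_extreme c1 Chy.
have N1E b : mu1 (F b) = Re (c * gelfand b y).
  by apply: (xB _ _ t (domN _ dmu1) (domN _ dmu2) t01) => // b' _; exact: comb.
move=> a _.
have [s0 s00 Hs] := scale_small A a.
apply: (@eq_of_quadratic _ _ _ (32 * rA a ^+ 2) s0 s00) => s sp ss.
have ra := Hs s sp ss; have [b [rb _ H1 H2]] := near LP LP' ra.
have rsa : rA (s%:C *: a) = s * rA a by rewrite sradiusZ cabsR gtr0_norm.
have D1 := dominated_lip dmu1 (BF b) (gelfand_bounded _) H2.
have D3 := Re_near _ _ _ (H1 y).
rewrite mu1E N1E rsa exprMn in D1; rewrite rsa exprMn LZ mulrCA Re_rmul in D3.
have sZ : s1 (s%:C *: a) = s * s1 a by have [[_ h] _] := d1; exact: h.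
rewrite sZ in D1.
move: D1 D3; rewrite !ler_norml => /andP[l1 u1] /andP[l3 u3].
by apply/andP; split; lra.
Qed.

(* [|1 - s z| <= 1] makes the powers of [1 - s z] stay within distance 2 of 1,
   so that [T (1 - s z)] has modulus at most 1. *)
Let der_const_ge0 L y (z : R[i]) : is_der L -> 0 < Re z -> 0 <= Re (L y z%:A).
Proof.
move=> LP z0; have [_ LZ _ LE] := LP y.
have zc : 0 < cabs z := lt_le_trans z0 (Re_cabs z).
have key s : 0 < s -> s * cabs z <= 4^-1 -> s * cabs z ^+ 2 <= 2 * Re z ->
    - (16 * (s * cabs z) ^+ 2) <= s * Re (L y z%:A).
  move=> s0 s4 sz; pose w := - (s%:C *: z%:A) : A.
  have rw : rA w = s * cabs z by rewrite sradiusN sradiusZ sradiusA cabsR gtr0_norm.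
  have wU : 1 + w \is a GRing.unit by apply: sradius_near1_unit; rewrite rw; lra.
  have wE x : gelfand (1 + w) x = 1 - s%:C * z.
    by rewrite gelfandD gelfand1 gelfandN gelfandZ gelfandA.
  have w1 : cabs (1 - s%:C * z) <= 1.
    rewrite -(@ler_sqr R _ 1) ?nnegrE ?cabs_ge0 // expr1n cabs_sqr.
    rewrite Re_add Im_add Re_opp Im_opp Re_one Im_one Re_rmul Im_rmul.
    have := ler_wpM2l (ltW s0) sz; rewrite cabs_sqr; nra.
  have tw n : cabs (gelfand (T (1 + w)) y : R[i]) ^+ n <= 3.
    have wnU : (1 + w) ^+ n \is a GRing.unit by rewrite unitrX.
    have TX : T ((1 + w) ^+ n) = T (1 + w) ^+ n.
      have [TM _ _ Tr] := HT; elim: n {wnU} => [|n IH]; last by rewrite !exprS TM ?unitrX // IH.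
      rewrite !expr0; apply: (unit_morphism1 TM).
      by have [_ h _ _] := HT; apply: h; rewrite unitr1.
    have := tau_le y wnU; rewrite TX gelfandX => h.
    have r2 : rA ((1 + w) ^+ n - 1) <= 2.
      apply: sradius_le => x; rewrite gelfandB gelfandX gelfand1 wE.
      apply: le_trans (cabsB _ _) _; rewrite cabs1 cabsX.
      have := exprn_ile1 n (cabs_ge0 _) w1; lra.
    rewrite -cabsX; have := cabs_distD ((gelfand (T (1 + w)) y : R[i]) ^+ n) 1 0.
    rewrite !subr0 cabs1; lra.
  have tw1 : cabs (gelfand (T (1 + w)) y : R[i]) <= 1.
    rewrite leNgt; apply/negP => gt1; set q := cabs _ in tw gt1.
    have q0 : 0 < q - 1 by rewrite subr_gt0.
    (* Bernoulli's inequality: a modulus [q] above 1 would have unbounded powers, against [tw]. *)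
    have bern n : 1 + n%:R * (q - 1) <= q ^+ n.
      elim: n => [|n IH]; first by rewrite mul0r addr0 expr0.
      rewrite exprS -[n.+1%:R]natr1.
      have n0 : 0 <= n%:R * (q - 1) ^+ 2 by rewrite mulr_ge0 // sqr_ge0.
      have q1 : 0 <= q by lra.
      have := ler_wpM2l q1 IH; nra.
    have [n Hn] : exists n, 3 < n%:R * (q - 1).
      by exists (Num.truncn (3 / (q - 1))).+1; rewrite -ltr_pdivrMr //; exact: Num.Theory.truncnS_gt.
    have := le_trans (bern n) (tw n); lra.
  have rw4 : rA w <= 4^-1 by rewrite rw.
  have := LE w rw4; rewrite rw.
  have -> : L y w = - (s%:C * L y z%:A).
    rewrite /w -scaleNr -rmorphN LZ rmorphN mulNr //.
  move=> h; have := le_trans (Re_cabs _) h.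
  rewrite -cabsN in h; have := le_trans (Re_cabs _) h.
  rewrite !Re_opp !Re_add !Re_opp Re_rmul Re_one.
  have := le_trans (Re_cabs _) tw1; lra.
have q0 : 0 < cabs z ^+ 2 by rewrite exprn_gt0.
apply: (@le_eps_mul _ (16 * cabs z ^+ 2)) => e e0 _.
pose s := Num.min e (Num.min (4^-1 / cabs z) (2 * Re z / cabs z ^+ 2)).
have s0 : 0 < s by rewrite !lt_min e0 !divr_gt0 // mulr_gt0.
have s4 : s * cabs z <= 4^-1 by rewrite -ler_pdivlMr // !ge_min lexx orbT.
have s2 : s * cabs z ^+ 2 <= 2 * Re z by rewrite -ler_pdivlMr // !ge_min lexx !orbT.
have se : s <= e by rewrite ge_min lexx.
have := key s s0 s4 s2; rewrite exprMn.
have -> : - (16 * (s ^+ 2 * cabs z ^+ 2)) = s * (- (16 * s * cabs z ^+ 2)) by ring.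
rewrite ler_pM2l // => h.
have := ler_wpM2r (ltW q0) se; lra.
Qed.

Let der_form L L' y : is_der L -> is_der' L' -> Ch B y ->
  exists x (s : bool), Ch A x /\ forall a, L y a = conj_unless s (gelfand a x).
Proof.
move=> LP LP' Chy; have [LD LZ Lr LE] := LP y.
have ext (c : R[i]) : cabs c = 1 -> exists d x, cabs d = 1 /\
    forall a, Re (c * L y a) = Re (d * gelfand a x).
  by move=> c1; exact: extreme_dominated_eval (der_extreme LP LP' c1 Chy).
have [d1 [x1 [d1E H1]]] := ext 1 (cabs1).
have d1_1 : d1 = 1.
  have pos (z : R[i]) : 0 < Re z -> 0 <= Re (d1 * z).
    by move=> /(der_const_ge0 y LP); rewrite -[L y _]mul1r H1 gelfandA.
  have sq := cabs_sqr d1; rewrite d1E expr1n in sq.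
  have d1im : Im d1 = 0.
    apply/eqP; apply: contrapT => /negP im0.
    (* This number has real part 1, while its product with [d1] has real part [-1]. *)
    have := pos (1 +i* ((Re d1 + 1) / Im d1)); rewrite Re_mul /= ltr01 => /(_ isT).
    by rewrite mulr1 mulrC divfK //; lra.
  have := pos 1; rewrite Re_one mulr1 ltr01 => /(_ isT) h.
  rewrite d1im expr0n addr0 in sq.
  by apply: complexP => //; rewrite Re_one; nra.
have ReL a : Re (L y a) = Re (gelfand a x1).
  by have := H1 a; rewrite d1_1 !mul1r.
have L1 : L y 1 = 1.
  have re1 := ReL 1; rewrite gelfand1 Re_one in re1.
  have := Lr 1; rewrite sradius1 => h.
  apply: complexP => //; rewrite Im_one.
  have : cabs (L y 1) ^+ 2 <= 1 by rewrite exprn_ile1 // cabs_ge0.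
  by rewrite cabs_sqr re1; nra.
have cNi : cabs (- 'i%C : R[i]) = 1 by rewrite cabsN cabs_i.
have ReNi (z : R[i]) : Re (- 'i%C * z) = Im z by case: z => a1 b1 /=; ring.
have [d2 [x2 [d2E H2]]] := ext _ cNi.
have d2re : Re d2 = 0.
  by have := H2 1; rewrite gelfand1 mulr1 ReNi L1 Im_one.
pose s := - Im d2.
have s2 : s ^+ 2 = 1.
  by have := cabs_sqr d2; rewrite d2E d2re expr1n expr0n add0r /s sqrrN.
have ImL a : Im (L y a) = s * Im (gelfand a x2).
  by have := H2 a; rewrite ReNi Re_mul d2re mul0r sub0r /s mulNr.
(* A unimodular number with both parts nonzero: [Re (c3 * w)] is [(3 * Re w + 4 * Im w) / 5], which
   relates [x1] and [x2] to a single third point. *)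
pose c3 : R[i] := (3 / 5) -i* (4 / 5).
have c3E : cabs c3 = 1.
  apply/eqP; rewrite -(@eqrXn2 _ 2) ?cabs_ge0 // expr1n cabs_sqr /c3 /=.
  by apply/eqP; field.
have [d3 [x3 [d3E H3]]] := ext c3 c3E.
pose D : R[i] := 3 -i* (4 * s).
(* [lin] compares real parts; testing it on ['i *: b] gives the imaginary parts, and [b = 1]
   identifies [D] with [5 * d3]. *)
have key a : D * gelfand a x3 = 3%:C * gelfand a x1 + (0 -i* (4 * s)) * gelfand a x2.
  have lin b : 3 * Re (gelfand b x1) + 4 * (s * Im (gelfand b x2)) = 5 * Re (d3 * gelfand b x3).
    by rewrite -H3 Re_mul ReL ImL /c3 /=; field.
  have linC b : 3%:C * gelfand b x1 + (0 -i* (4 * s)) * gelfand b x2 = 5%:C * (d3 * gelfand b x3).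
    apply: complexP.
      by rewrite Re_rmul -lin Re_add Re_rmul Re_mul /=; ring.
    have Re_i (z : R[i]) : Re ('i%C * z) = - Im z by case: z => u v /=; ring.
    have Im_i (z : R[i]) : Im ('i%C * z) = Re z by case: z => u v /=; ring.
    have Im_w (z : R[i]) : Im ((0 -i* (4 * s)) * z) = - (4 * s) * Re z.
      by case: z => u v /=; ring.
    have := lin ('i%C *: b); rewrite !gelfandZ (mulrCA d3) !Re_i Im_i Im_rmul Im_add Im_rmul Im_w.
    lra.
  have D3 : D = 5%:C * d3.
    by have := linC 1; rewrite !gelfand1 !mulr1 => <-; apply: complexP => /=; ring.
  by rewrite linC D3 mulrA.
(* Let [w] be the value of [a] at [x3]. Computing [(D * w) ^+ 2] from [key] at [a] and at [a ^+ 2]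
   leaves [3 * be * (p - q) ^+ 2 = 0]. *)
have x12 a : gelfand a x1 = gelfand a x2 :> R[i].
  have k1 := key a; have k2 := key (a ^+ 2); rewrite !gelfandX in k2.
  have DE : D = 3%:C + (0 -i* (4 * s)) by apply: complexP => /=; ring.
  set p := (gelfand a x1 : R[i]) in k1 k2 *; set q := (gelfand a x2 : R[i]) in k1 k2 *.
  set w := (gelfand a x3 : R[i]) in k1 k2; set be := (0 -i* (4 * s)) in k1 k2 DE.
  have E : 3%:C * be * (p - q) ^+ 2 = 0.
    have -> : 3%:C * be * (p - q) ^+ 2 =
        D * (3%:C * p ^+ 2 + be * q ^+ 2) - (3%:C * p + be * q) ^+ 2 by rewrite DE; ring.
    by rewrite -k1 -k2; ring.
  have be0 : be != 0.
    apply/eqP => /(congr1 (@complex.Im R)) /=; rewrite /be /= => h.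
    have s0 : s = 0 by lra.
    by move: s2; rewrite s0 expr0n /= => /eqP; rewrite eq_sym oner_eq0.
  have t0 : (3%:C : R[i]) != 0 by rewrite -cabs_eq0 cabsR normr_eq0 pnatr_eq0.
  move/eqP: E; rewrite !mulf_eq0 (negPf t0) (negPf be0) /= orbb subr_eq0.
  by move/eqP.
exists x1, (s == 1); split.
  apply: (@extreme_Ch _ _ 1); first exact: cabs1.
  have := der_extreme LP LP' (@cabs1 R) Chy.
  by rewrite (_ : (fun a => Re (1 * L y a)) = (fun h => Re (1 * gelfand h x1))) //; apply/funext => a; rewrite !mul1r ReL.
move=> a; have sE : s = 1 \/ s = -1.
  by move/eqP: s2; rewrite sqrf_eq1 => /orP[]/eqP; [left|right].
rewrite /conj_unless; apply: complexP.
  by rewrite ReL; case: ifP => _ //; case: (gelfand a x1).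
rewrite ImL -x12; case: sE => ->; first by rewrite eqxx mul1r.
have -> : (-1 == 1 :> R) = false by apply/negbTE; rewrite lt_eqF //; lra.
by rewrite mulN1r; case: (gelfand a x1).
Qed.

(** Composition with [conj_unless s] turns the derivative at 1 into the evaluation at [x] in both
    cases, and [local_form] applies to the composite. *)
Theorem unit_group_isometry_form y : Ch B y -> exists x (s : bool), Ch A x /\
  forall f, f \is a GRing.unit -> gelfand (T f) y = conj_unless s (gelfand f x).
Proof.
move=> Chy.
have [L LP] := choice (fun y => tau_derivative (tauM y) (tau_le y)).
have [L' LP'] := choice (fun x => tau_derivative (tauM' x) (tau_le' x)).
have [x [s [Chx LE]]] := der_form LP LP' Chy.
exists x, s; split => // f fU.
have := @local_form _ _ (fun f => conj_unless s (gelfand (T f) y)) x _ _ _ Chx f fU.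
have H1 : {in GRing.unit &, {morph (fun f => conj_unless s (gelfand (T f) y)) : f g / f * g}}.
  by move=> g h gU hU; rewrite -conj_unlessM -tauM.
have H2 g : g \is a GRing.unit -> cabs (conj_unless s (gelfand (T g) y) - 1) <= rA (g - 1).
  by move=> gU; rewrite -{1}(conj_unless1 s) -conj_unlessB cabs_conj_unless; exact: tau_le.
have H3 a : rA a <= 4^-1 ->
    cabs (conj_unless s (gelfand (T (1 + a)) y) - 1 - gelfand a x) <= 16 * rA a ^+ 2.
  move=> ra; have [_ _ _ h] := LP y; have := h a ra.
  by rewrite LE -(cabs_conj_unless s (_ - _)) !conj_unlessB conj_unless1 conj_unlessK.
by move=> /(_ H1 H2 H3) E; rewrite -[LHS](conj_unlessK s) E.
Qed.

End PointwiseForm.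

(** * The representation on the Choquet boundary *)

Lemma continuous_into_subtype (Z X : topologicalType) (S : set X) (f : Z -> set_type S) :
  continuous (fun z => set_val (f z)) -> continuous f.
Proof.
move=> cf z U [_ [[C Co <-] Cz sub]].
apply: (@filterS _ (nbhs z) _ (fun w => C (set_val (f w)))); first by move=> w /sub.
by apply: cf; apply: open_nbhs_nbhs.
Qed.

Section Topology.
Context {R : realType} {A : comBanachAlgType R[i]}.

Lemma gelfand_continuous (a : A) : continuous (gelfand a).
Proof.
move=> m.
have c1 : {for m, continuous (set_val : max_ideal_space A -> {ptws A -> R[i]^o})}.
  exact: initial_continuous.
have c2 : {for set_val m, continuous (fun f : {ptws A -> R[i]^o} => f a)}.
  exact: (@proj_continuous A (fun=> R[i]^o) a).
exact: continuous_comp c1 c2.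
Qed.

Lemma continuous_into_max_ideal_space (Z : topologicalType) (f : Z -> max_ideal_space A) :
  (forall a : A, continuous (fun z => gelfand a (f z))) -> continuous f.
Proof.
move=> H; apply: continuous_into_subtype => z.
by apply/pointwise_cvgP => a; exact: H.
Qed.

Lemma Ch_inj (f g : A) : semisimple A ->
  (forall m, Ch A m -> gelfand f m = gelfand g m) -> f = g.
Proof.
move=> hA H; apply: (sradius_eq0 hA); have [m Chm <-] := Ch_boundary (f - g).
by rewrite gelfandB H // subrr cabs0.
Qed.

End Topology.

Lemma continuous_cabs (R : realType) (Z : topologicalType) (f : Z -> R[i]^o) z :
  {for z, continuous f} <->
  forall e : R, 0 < e -> \forall w \near z, cabs (f z - f w) < e.
Proof.
split=> [/cvgrPdist_lt cf e e0|H].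
  have eC0 : 0 < e%:C by rewrite ltcR.
  by apply: filterS (cf _ eC0) => w; rewrite normC_cabs ltcR.
apply/cvgrPdist_lt => e; rewrite ltcE => /andP[/eqP e_im e0].
by apply: filterS (H _ e0) => w h; rewrite normC_cabs ltcE /= e_im eqxx.
Qed.

(** * The equivalence and the extension to a real-algebra isomorphism *)

Section UnitGroupTheorem.
Context {R : realType}.
Implicit Types A B : comBanachAlgType R[i].

(** If [T f = T g], then [T (f / g) = 1], so [f / g - 1] has spectral radius 0 and vanishes by
    semisimplicity; a right inverse of [T] on units is thus two-sided. *)
Lemma unit_group_isometry_inverse A B (T : A -> B) : semisimple A ->
  unit_group_epimorphism T ->
  (forall f, f \is a GRing.unit -> spectral_radius (T f - 1) = spectral_radius (f - 1)) ->
  exists T' : B -> A, unit_group_isometry T T' /\ unit_group_isometry T' T.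
Proof.
move=> hA [TU TM Tsurj] Tr.
have [T' T'P] : {T' : B -> A & forall g, g \is a GRing.unit ->
    T' g \is a GRing.unit /\ T (T' g) = g}.
  apply: (@choice _ _ (fun g f => g \is a GRing.unit -> f \is a GRing.unit /\ T f = g)) => g.
  have [gU|gN] := boolP (g \is a GRing.unit).
    by have [f fU Tf] := Tsurj g gU; exists f.
  by exists 0.
have Tinj f g : f \is a GRing.unit -> g \is a GRing.unit -> T f = T g -> f = g.
  move=> fU gU Tfg.
  have gV : g^-1 \is a GRing.unit by rewrite unitrV.
  have fgU : f / g \is a GRing.unit by rewrite unitrM fU.
  have T1 : T (f / g) = 1.
    rewrite TM // Tfg -TM // divrr //.
    by apply: (unit_morphism1 TM); apply: TU; rewrite unitr1.
  have fg1 : f / g = 1.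
    by apply: (sradius_eq0 hA); rewrite -Tr // T1 subrr sradius0.
  by rewrite -[f](divrK gU) fg1 mul1r.
have TK f : f \is a GRing.unit -> T' (T f) = f.
  by move=> fU; have [h1 h2] := T'P _ (TU f fU); exact: Tinj.
exists T'; split; split => //.
- move=> g h gU hU; have [? e1] := T'P _ gU; have [? e2] := T'P _ hU.
  have ghU : g * h \is a GRing.unit by rewrite unitrM gU.
  have [? e3] := T'P _ ghU; apply: Tinj => //; first by rewrite unitrM; apply/andP.
  by rewrite TM // e1 e2 e3.
- by move=> g /T'P[].
- by move=> g /T'P[].
- by move=> g gU; have [h1 h2] := T'P _ gU; rewrite -Tr // h2.
Qed.

(** Every element is a unit minus a real constant, and conjugation fixes real constants; this
    carries identities from units to all elements. *)
Lemma unit_of_shift A (f : A) : f + (spectral_radius f + 1)%:C%:A \is a GRing.unit.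
Proof.
have rl : spectral_radius f < spectral_radius f + 1 by rewrite ltrDl.
apply: unit_gelfand => m; apply/eqP; rewrite gelfandD gelfandA => /eqP.
rewrite addr_eq0 => /eqP E; have := le_lt_trans (gelfand_le_radius f m) rl.
by rewrite E cabsN cabsR ltNge ler_norm.
Qed.

(* Evaluation at ['i] excludes conjugation. *)
Lemma eq_points A (x x' : max_ideal_space A) s :
  (forall f, f \is a GRing.unit -> gelfand f x = conj_unless s (gelfand f x')) -> x = x'.
Proof.
move=> H; have iU : ('i%C%:A : A) \is a GRing.unit.
  by apply: unit_gelfand => m; rewrite gelfandA -cabs_eq0 cabs_i oner_eq0.
have s1 : s by apply: (@conj_unless_i R); have := H _ iU; rewrite !gelfandA => <-.
rewrite s1 /conj_unless in H; apply/val_inj/funext => f.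
have := H _ (unit_of_shift f); rewrite !gelfandD !gelfandA => /addIr; exact.
Qed.

Lemma gelfand_set_val_continuous A (a : A) : continuous (fun x : set_type (Ch A) => gelfand a (set_val x)).
Proof. by move=> x; apply: continuous_comp; [exact: initial_continuous | exact: gelfand_continuous]. Qed.

Section Form.
Variables (A B : comBanachAlgType R[i]) (T : A -> B) (phi : set_type (Ch B) -> set_type (Ch A))
  (s : set_type (Ch B) -> bool).
Hypothesis phiE : forall f, f \is a GRing.unit -> forall y,
  gelfand (T f) (set_val y) = conj_unless (s y) (gelfand f (set_val (phi y))).

(** The image of the constant ['i] is continuous, with value ['i] or its conjugate at [y] according
    to [s y]; these two numbers are at distance 2. *)
Lemma conj_type_locally_constant y : \forall y' \near y, s y' = s y.
Proof.
have iU : ('i%C%:A : A) \is a GRing.unit.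
  by apply: unit_gelfand => m; rewrite gelfandA -cabs_eq0 cabs_i oner_eq0.
have Ti y' : gelfand (T 'i%C%:A) (set_val y') = conj_unless (s y') 'i%C by rewrite phiE // gelfandA.
have := (continuous_cabs _ _).1 (@gelfand_set_val_continuous B (T 'i%C%:A) y) 1 ltr01.
apply: filterS => y' /=; rewrite !Ti.
case: (s y); case: (s y') => //=; rewrite /conj_unless.
  have -> : 'i%C - ('i%C)^* = 2%:C * 'i%C :> R[i] by apply: complexP => /=; ring.
  by rewrite cabsM cabsR cabs_i mulr1 ger0_norm // => h; exfalso; lra.
have -> : ('i%C)^* - 'i%C = - (2%:C * 'i%C) :> R[i] by apply: complexP => /=; ring.
by rewrite cabsN cabsM cabsR cabs_i mulr1 ger0_norm // => h; exfalso; lra.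
Qed.

Lemma conj_type_clopen : clopen [set y | s y].
Proof.
split.
  rewrite openE => y /= sy; rewrite /interior.
  by apply: filterS (conj_type_locally_constant y) => y' /= ->.
rewrite -openC openE => y /= sy; rewrite /interior.
by apply: filterS (conj_type_locally_constant y) => y' /= ->.
Qed.

Lemma form_continuous : continuous phi.
Proof.
apply: continuous_into_subtype; apply: continuous_into_max_ideal_space => a y.
apply/continuous_cabs => e e0.
pose f := a + (spectral_radius a + 1)%:C%:A.
have fU : f \is a GRing.unit by exact: unit_of_shift.
have aE y' : (gelfand a (set_val (phi y')) : R[i]) =
    conj_unless (s y') (gelfand (T f) (set_val y')) - (spectral_radius a + 1)%:C.
  by rewrite phiE // conj_unlessK gelfandD gelfandA addrK.
have := (continuous_cabs _ _).1 (@gelfand_set_val_continuous B (T f) y) e e0.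
apply: filterS2 (conj_type_locally_constant y) => y' sy h.
rewrite !aE sy (_ : _ - _ =
    conj_unless (s y) (gelfand (T f) (set_val y) - gelfand (T f) (set_val y'))) ?cabs_conj_unless //.
by rewrite conj_unlessB; ring.
Qed.

End Form.

Lemma choquet_form A B (T : A -> B) (T' : B -> A) :
  unit_group_isometry T T' -> unit_group_isometry T' T ->
  exists (phi : set_type (Ch B) -> set_type (Ch A)) (s : set_type (Ch B) -> bool),
    forall f, f \is a GRing.unit -> forall y,
      gelfand (T f) (set_val y) = conj_unless (s y) (gelfand f (set_val (phi y))).
Proof.
move=> HT HT'.
have /choice[F FP] : forall y : set_type (Ch B), exists xs : set_type (Ch A) * bool,
    forall f, f \is a GRing.unit ->
      gelfand (T f) (set_val y) = conj_unless xs.2 (gelfand f (set_val xs.1)).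
  move=> y; have [x [s [Chx H]]] := unit_group_isometry_form HT HT' (set_valP y).
  by exists (SigSub (mem_set Chx), s).
by exists (fun y => (F y).1), (fun y => (F y).2) => f fU y; exact: FP.
Qed.

(** Since [T (T' g) = g], evaluation at [y] agrees on units, up to conjugation, with evaluation at
    [psi (phi y)]; [eq_points] identifies the two points. *)
Lemma choquet_form_cancel A B (T : A -> B) (T' : B -> A) phi s psi s' :
  (forall g, g \is a GRing.unit -> T' g \is a GRing.unit /\ T (T' g) = g) ->
  (forall f, f \is a GRing.unit -> forall y : set_type (Ch B),
    gelfand (T f) (set_val y) = conj_unless (s y) (gelfand f (set_val (phi y : set_type (Ch A))))) ->
  (forall g, g \is a GRing.unit -> forall x : set_type (Ch A),
    gelfand (T' g) (set_val x) = conj_unless (s' x) (gelfand g (set_val (psi x : set_type (Ch B))))) ->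
  cancel phi psi.
Proof.
move=> T'P phiE psiE y; apply/val_inj/esym.
apply: (@eq_points B _ _ (s y == s' (phi y))) => g gU; have [T'U TT'] := T'P g gU.
by rewrite -{1}TT' phiE // psiE // conj_unless_comp.
Qed.

Lemma sradius_isometry_representation A B (T : A -> B) : semisimple A ->
  unit_group_epimorphism T ->
  (forall f, f \is a GRing.unit -> spectral_radius (T f - 1) = spectral_radius (f - 1)) ->
  choquet_representation T.
Proof.
move=> hA hT Tr; have [T' [HT HT']] := unit_group_isometry_inverse hA hT Tr.
have [phi [s phiE]] := choquet_form HT HT'; have [psi [s' psiE]] := choquet_form HT' HT.
have [_ TU TK _] := HT; have [_ TU' TK' _] := HT'.
exists phi, [set y | s y]; split; last first.
- move=> f fU y; rewrite phiE // /conj_unless.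
  by have -> : (y \in [set y | s y]) = s y by apply/idP/idP; rewrite inE.
- exact: conj_type_clopen phiE.
- exists psi; split; [| |exact: form_continuous phiE|exact: form_continuous psiE].
    by apply: choquet_form_cancel phiE psiE => g gU; rewrite TU' // TK'.
  by apply: choquet_form_cancel psiE phiE => f fU; rewrite TU // TK.
Qed.

Lemma representation_form A B (T : A -> B) : choquet_representation T ->
  exists (phi : set_type (Ch B) -> set_type (Ch A)) (s : set_type (Ch B) -> bool),
    (forall x, exists y, phi y = x) /\
    forall f, f \is a GRing.unit -> forall y,
      gelfand (T f) (set_val y) = conj_unless (s y) (gelfand f (set_val (phi y))).
Proof.
move=> [phi [K [[psi [_ psiK _ _]] _ H]]]; exists phi, (fun y => y \in K); split => //.
by move=> x; exists (psi x).
Qed.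

(** Conjugation preserves moduli, and by [Ch_boundary] spectral radii are attained on the Choquet
    boundaries; surjectivity of [phi] gives the second inequality. *)
Lemma representation_sradius_isometry A B (T : A -> B) : choquet_representation T ->
  forall f g, f \is a GRing.unit -> g \is a GRing.unit ->
    spectral_radius (T f - T g) = spectral_radius (f - g).
Proof.
move=> /representation_form[phi [s [surj phiE]]] f g fU gU.
have E y : cabs (gelfand (T f - T g) (set_val y)) = cabs (gelfand (f - g) (set_val (phi y))).
  by rewrite !gelfandB !phiE // -conj_unlessB cabs_conj_unless.
apply/eqP; rewrite eq_le; apply/andP; split.
  have [m Chm <-] := Ch_boundary (T f - T g).
  by have := E (SigSub (mem_set Chm)) => ->; exact: gelfand_le_radius.
have [m Chm <-] := Ch_boundary (f - g); have [y yE] := surj (SigSub (mem_set Chm)).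
by have := E y; rewrite yE => <-; exact: gelfand_le_radius.
Qed.

Lemma representation_extends A B (T : A -> B) : semisimple A -> semisimple B ->
  unit_group_epimorphism T -> choquet_representation T ->
  exists S : A -> B, real_algebra_isomorphism S /\
    forall f, f \is a GRing.unit -> S f = T f.
Proof.
move=> hA hB [TU _ Tsurj] /representation_form[phi [s [surj phiE]]].
have [S SE] : exists S : A -> B, forall f y,
    gelfand (S f) (set_val y) = conj_unless (s y) (gelfand f (set_val (phi y))).
  (* The real shift depends on [f] but cancels in the values on the Choquet boundary, from which the
     algebraic properties of [S] are then read off. *)
  exists (fun f => T (f + (spectral_radius f + 1)%:C%:A) - (spectral_radius f + 1)%:C%:A).
  move=> f y; rewrite gelfandB phiE ?unit_of_shift // gelfandD !gelfandA.
  by rewrite -[X in _ - X](conj_unless_real (s y)) -conj_unlessB; congr conj_unless; ring.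
have eqB (f g : B) : (forall y : set_type (Ch B), gelfand f (set_val y) = gelfand g (set_val y)) -> f = g.
  by move=> H; apply: (Ch_inj hB) => m Chm; exact: (H (SigSub (mem_set Chm))).
have conj_inj t : injective (@conj_unless R t) := can_inj (conj_unlessK t).
have S_inj : injective S.
  move=> f g Sfg; apply: (Ch_inj hA) => m Chm; have [y yE] := surj (SigSub (mem_set Chm)).
  by apply: (conj_inj (s y)); have := SE f y; rewrite Sfg SE yE.
have S_surj g : exists f, S f = g.
  have [f fU Tf] := Tsurj _ (unit_of_shift g).
  exists (f - (spectral_radius g + 1)%:C%:A); apply: eqB => y.
  rewrite SE gelfandB gelfandA conj_unlessB conj_unless_real -phiE // Tf gelfandD gelfandA.
  by rewrite addrK.
exists S; split; last first.
  by move=> f fU; apply: eqB => y; rewrite SE phiE.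
split.
- have [S' S'P] := choice S_surj; exists S' => //.
  by move=> f; apply: S_inj; rewrite S'P.
- move=> a f g; apply: eqB => y.
  rewrite gelfandD gelfandZ !SE gelfandD gelfandZ.
  by rewrite conj_unlessD conj_unlessM conj_unless_real.
- move=> f g; apply: eqB => y; by rewrite gelfandM !SE gelfandM conj_unlessM.
Qed.

End UnitGroupTheorem.

Theorem corollary5p15 (R : realType) (A B : comBanachAlgType R[i])
    (hA : semisimple A) (hB : semisimple B)
    (T : A -> B) (hT : unit_group_epimorphism T) :
  let cond_i := forall f g : A, f \is a GRing.unit -> g \is a GRing.unit ->
    spectral_radius (T f - T g) = spectral_radius (f - g) in
  let cond_ii := forall f : A, f \is a GRing.unit ->
    spectral_radius (T f - 1) = spectral_radius (f - 1) in
  let cond_iii := choquet_representation T in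
  [/\ cond_i <-> cond_ii,
      cond_ii <-> cond_iii &
      cond_i \/ cond_ii \/ cond_iii ->
        (exists S : A -> B, real_algebra_isomorphism S /\
           forall f : A, f \is a GRing.unit -> S f = T f) /\
        (exists S : A -> B, real_algebra_isomorphism S)].
Proof.
move=> cond_i cond_ii cond_iii.
have i_ii : cond_i -> cond_ii.
  move=> Hi f fU; have := Hi f 1 fU (unitr1 _); have [TU TM _] := hT.
  by rewrite (unit_morphism1 TM) // TU // unitr1.
have ii_iii : cond_ii -> cond_iii by exact: sradius_isometry_representation.
have iii_i : cond_iii -> cond_i by exact: representation_sradius_isometry.
split; [split => // Hii; exact/iii_i/ii_iii | split => // Hiii; exact/i_ii/iii_i |].
move=> H; have Hiii : cond_iii by case: H => [/i_ii/ii_iii|[/ii_iii|]].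
have [S [Siso SE]] := representation_extends hA hB hT Hiii.
by split; exists S.
Qed.
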